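(* Let $\varphi=(\varphi_1,\varphi_2):\mathbb{D}^2\to\mathbb{D}^2$ be a holomorphic self-map such that both $\varphi_1$ and $\varphi_2$ are Lipschitz on $\overline{\mathbb{D}^2}$. Then the composition operator $C_\varphi$ is compact on $A^2(\mathbb{D}^2)$ if and only if $\varphi(\overline{\mathbb{D}^2})\cap\mathbb{T}^2=\emptyset$ and $\varphi(\overline{\mathbb{D}^2}\setminus\mathbb{T}^2)\cap b\mathbb{D}^2=\emptyset$.
   Context: $\mathbb{D}$ is the open unit disc in $\mathbb{C}$, $\mathbb{T}$ is the unit circle, $\mathbb{D}^2=\mathbb{D}\times\mathbb{D}$ is the bidisc, and $b\mathbb{D}^2$ is the topological boundary of $\mathbb{D}^2$ in $\mathbb{C}^2$. The Bergman space $A^2(\mathbb{D}^2)$ is the Hilbert space of all holomorphic $f:\mathbb{D}^2\to\mathbb{C}$ with $\int_{\mathbb{D}^2}|f|^2\,dV<\infty$, where $V$ is Lebesgue (volume) measure. The composition operator with symbol $\varphi$ is $C_\varphi f=f\circ\varphi$. That $\varphi_j$ is Lipschitz on $\overline{\mathbb{D}^2}$ means that $\varphi_j$ extends to a Lipschitz function on $\overline{\mathbb{D}^2}$ (with respect to Euclidean distance); the extension of $\varphi$ to $\overline{\mathbb{D}^2}$ is still denoted $\varphi$. ''Compact on $A^2(\mathbb{D}^2)$'' means that $C_\varphi$ maps $A^2(\mathbb{D}^2)$ into itself and is a compact linear operator. *)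

(* Defs.v *)
From HB Require Import structures.
From mathcomp Require Import all_boot all_order all_algebra.
From mathcomp Require Import all_classical all_reals all_analysis.
From mathcomp Require Import complex.

Set Implicit Arguments.
Unset Strict Implicit.
Unset Printing Implicit Defensive.

Import Order.TTheory GRing.Theory Num.Theory.
Import numFieldNormedType.Exports.

Local Open Scope classical_set_scope.
Local Open Scope ring_scope.
Local Open Scope complex_scope.

(* [R[i]] carries its normed-module structure over itself under the alias
   [_^o].  The product [CC2] gets the max norm, which induces the usual
   topology of the complex plane squared. *)
Notation CC R := ((R[i])^o).
Notation CC2 R := (CC R * CC R)%type.

Definition cabs (R : realType) (z : CC R) : R := ComplexField.Normc.normc z.

Definition edist (R : realType) (z w : CC2 R) : R :=
  Num.sqrt (cabs (z.1 - w.1) ^+ 2 + cabs (z.2 - w.2) ^+ 2).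

Definition disc {R : realType} : set (CC R) := [set z | cabs z < 1].
Definition circle {R : realType} : set (CC R) := [set z | cabs z = 1].

Definition bidisc {R : realType} : set (CC2 R) := disc `*` disc.
Definition torus {R : realType} : set (CC2 R) := circle `*` circle.

Definition boundary (T : topologicalType) (A : set T) : set T :=
  closure A `\` interior A.

(* Fréchet differentiability is over the scalar field [R[i]], so on an open set
   this is holomorphy; the values of [f] outside [A] are irrelevant there. *)
Definition holomorphic_on (R : realType) (V W : normedModType R[i])
    (A : set V) (f : V -> W) : Prop :=
  forall z, A z -> differentiable f z.

Definition lipschitz_euclidean (R : realType) (A : set (CC2 R))
    (f : CC2 R -> CC R) : Prop :=
  exists L : R, forall z w, A z -> A w -> cabs (f z - f w) <= L * edist z w.

Definition cpoint {R : realType} (p : (R * R) * (R * R)) : CC2 R :=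
  (p.1.1 +i* p.1.2, p.2.1 +i* p.2.2).

(* Inference of a sigma-finite structure on [m1 \x m2] only succeeds when [m1]
   and [m2] are subprobabilities, so the two products below get theirs by hand. *)
Lemma sigma_finite_product d1 d2 (T1 : measurableType d1)
    (T2 : measurableType d2) (R : realType)
    (m1 : {sigma_finite_measure set T1 -> \bar R})
    (m2 : {sigma_finite_measure set T2 -> \bar R}) :
  sigma_finite setT (m1 \x m2)%E.
Proof.
have /sigma_finiteP[F [TF ndF Foo]] := sigma_finiteT m1.
have /sigma_finiteP[G [TG ndG Goo]] := sigma_finiteT m2.
exists (fun n => F n `*` G n).
  rewrite -setXTT TF TG predeqE => -[x y]; split.
    move=> [/= [n _ Fnx] [k _ Gky]]; exists (maxn n k) => //; split.
    - by move: x Fnx; exact/subsetPset/ndF/leq_maxl.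
    - by move: y Gky; exact/subsetPset/ndG/leq_maxr.
  by move=> [n _ []/= ? ?]; split; exists n.
move=> k; have [? ?] := Foo k; have [? ?] := Goo k.
split; first exact: measurableX.
by rewrite product_measure1E// lte_mul_pinfty// ge0_fin_numE.
Qed.

Definition lebesgue2 (R : realType) :
    set (measurableTypeR R * measurableTypeR R) -> \bar R :=
  (@lebesgue_measure R \x @lebesgue_measure R)%E.

HB.instance Definition _ (R : realType) := Measure.on (@lebesgue2 R).
HB.instance Definition _ (R : realType) :=
  Measure_isSigmaFinite.Build _ _ _ (@lebesgue2 R)
    (sigma_finite_product (@lebesgue_measure R) (@lebesgue_measure R)).

Definition volume (R : realType) :
    set ((measurableTypeR R * measurableTypeR R) *
         (measurableTypeR R * measurableTypeR R)) -> \bar R :=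
  (@lebesgue2 R \x @lebesgue2 R)%E.

HB.instance Definition _ (R : realType) := Measure.on (@volume R).
HB.instance Definition _ (R : realType) :=
  Measure_isSigmaFinite.Build _ _ _ (@volume R)
    (sigma_finite_product (@lebesgue2 R) (@lebesgue2 R)).

Definition sqnorm (R : realType) (f : CC2 R -> CC R) : \bar R :=
  (\int[@volume R]_(p in cpoint @^-1` bidisc)
     (cabs (f (cpoint p)) ^+ 2)%:E)%E.

(* An element of the Bergman space is represented by any total function with
   the given restriction to the bidisc; membership and norm depend only on that
   restriction, and so does [f \o phi] on the bidisc when [phi] maps the bidisc
   into itself. *)
Definition bergman {R : realType} : set (CC2 R -> CC R) :=
  [set f | holomorphic_on bidisc f /\ (sqnorm f < +oo)%E].

Definition bergman_norm (R : realType) (f : CC2 R -> CC R) : R :=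
  Num.sqrt (fine (sqnorm f)).

Definition composition_operator (R : realType) (phi : CC2 R -> CC2 R)
    (f : CC2 R -> CC R) : CC2 R -> CC R := f \o phi.

Definition bergman_linear (R : realType)
    (T : (CC2 R -> CC R) -> (CC2 R -> CC R)) : Prop :=
  forall (a : CC R) (f g : CC2 R -> CC R), bergman f -> bergman g ->
  forall z, bidisc z ->
    T (fun w => a * f w + g w) z = a * T f z + T g z.

(* Every norm-bounded sequence of the Bergman space has a subsequence whose
   image under [T] converges, in norm, to an element of the Bergman space. *)
Definition compact_on_bergman (R : realType)
    (T : (CC2 R -> CC R) -> (CC2 R -> CC R)) : Prop :=
  [/\ forall f, bergman f -> bergman (T f),
      bergman_linear T &
      forall u : nat -> (CC2 R -> CC R),
        (forall n, bergman (u n)) ->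
        (exists M : R, forall n, bergman_norm (u n) <= M) ->
        exists s : nat -> nat, exists g : CC2 R -> CC R,
        [/\ {homo s : m n / (m < n)%N}, bergman g &
            bergman_norm (fun z => T (u (s n)) z - g z) @[n --> \oo] --> 0]].

(* Main.v *)
Require Import Defs.
From mathcomp Require Import all_boot all_order all_algebra.
From mathcomp Require Import all_classical all_reals all_analysis.
From mathcomp Require Import complex.
From mathcomp Require Import measurable_realfun ring lra.

(** The theorem compares the boundary distances of [z] and [phi z].

    Necessity. The kernels [test_function w] are bounded in the Bergman space,
    tend to zero locally uniformly as [w] tends to the boundary, and have modulus
    comparable at [w] to the inverse of (1 - |w1|)(1 - |w2|). If the operator is
    compact, their images at [w = phi (z_n)] tend to zero in norm along a
    subsequence; evaluating at [z_n] shows that (1 - |z1|)(1 - |z2|) must be small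
    compared to (1 - |phi1 z|)(1 - |phi2 z|) when [phi (z_n)] tends to the boundary
    ([comparable_distances_not_compact]). The Lipschitz condition contradicts this along a
    radius ending at a point that violates either condition ([necessity]).

    Sufficiency. Under the two conditions, compactness of the closed bidisc shows
    that where one component of [phi] is near the circle, the other component stays
    away from it and both variables are near the circle. For fixed first variable
    [x], the slice [h] of that component satisfies 1 - |h y| >= kap (1 - |y|) with
    [kap] independent of [x] ([schwarz_power], [slice_constants]), and the points
    mapped by [h] into the disc of centre [xi] and radius 1 - |xi| have area at most a
    constant times (1 - |xi|)^2, uniformly in [x] ([carleson_area]: a positive
    harmonic function, Re 1/(1 - conj xi h), is large there). Together with the
    sub-mean value property at [phi z] and Tonelli's theorem this bounds the
    integral of |f o phi|^2 over the set where a component of [phi] is near the circle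
    by the square norm of [f] times the area of a thin annulus ([tail_estimate]).
    On the rest of the bidisc only the values of [f] on a compact polydisc matter.
    So [composition_estimate]: the square norm of [f o phi] is at most e times that of
    [f] plus a multiple of the supremum of |f|^2 on a compact polydisc. Since bounded
    sequences converge locally uniformly along an ultrafilter ([montel]), their images
    converge in norm ([composition_compact]).

    All the function theory rests on one mean value property, with the truncated
    paraboloid (rho - |z - a|^2)_+ as weight ([mean_value]). Holomorphic means
    differentiable, with no continuity of the derivative, so the divergence theorem
    behind it is proved by Goursat's bisection ([divergence_square]). Sub-mean
    values, the Lipschitz form of Cauchy's estimate, the maximum principle and the
    area estimate all come from comparing such weights. *)

Set Implicit Arguments.
Unset Strict Implicit.
Unset Printing Implicit Defensive.

Import Order.TTheory GRing.Theory Num.Theory.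
Import numFieldNormedType.Exports.
Local Open Scope classical_set_scope.
Local Open Scope ring_scope.

(** * Bisection of squares *)

Section Bisection.
Variable R : realType.
Variable J : R -> R -> R -> R.
Hypothesis J_split : forall a c s, 0 < s ->
  J a c s = J a c (s / 2) + J (a + s / 2) c (s / 2)
          + J a (c + s / 2) (s / 2) + J (a + s / 2) (c + s / 2) (s / 2).
Hypothesis J_small : forall x y e, 0 < e -> exists2 d, 0 < d &
  forall a c s, 0 < s <= d -> a <= x <= a + s -> c <= y <= c + s ->
  `|J a c s| <= e * s ^+ 2.

(** Goursat's argument: a defect that does not vanish on some square is, by
    additivity, of order at least the area on one quarter of it, then on a
    quarter of that, and so on; at the common point of these nested squares
    this contradicts smallness relative to the area. *)
Lemma bisection_zero a c s : 0 < s -> J a c s = 0.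
Proof.
move=> s0; apply/eqP; apply: contraT => J0.
pose e := `|J a c s| / (2 * s ^+ 2).
have Jgt0 : 0 < `|J a c s| by rewrite normr_gt0.
have s20 : 0 < 2 * s ^+ 2 by rewrite mulr_gt0// exprn_gt0.
have e0 : 0 < e by rewrite divr_gt0.
(* a square is bad when its defect is large relative to its area; badness passes to a quarter *)
pose bad (q : R * R) t := e * t ^+ 2 < `|J q.1 q.2 t|.
have bad0 : bad (a, c) s.
  rewrite /bad/= /e.
  have -> : `|J a c s| / (2 * s ^+ 2) * s ^+ 2 = `|J a c s| / 2.
    by field; rewrite gt_eqF.
  lra.
pose child (q q' : R * R) t :=
  (q'.1 = q.1 \/ q'.1 = q.1 + t / 2) /\ (q'.2 = q.2 \/ q'.2 = q.2 + t / 2).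
have step q t : 0 < t -> bad q t -> exists q', child q q' t /\ bad q' (t / 2).
  move=> t0 bq; apply: contrapT => /forallNP no.
  have small q' : child q q' t -> `|J q'.1 q'.2 (t / 2)| <= e * (t / 2) ^+ 2.
    by move=> cq; rewrite leNgt; apply/negP => bq'; apply: (no q').
  move: bq; rewrite /bad ltNge => /negP; apply.
  rewrite J_split//.
  have := small (q.1, q.2) (conj (or_introl erefl) (or_introl erefl)).
  have := small (q.1 + t / 2, q.2) (conj (or_intror erefl) (or_introl erefl)).
  have := small (q.1, q.2 + t / 2) (conj (or_introl erefl) (or_intror erefl)).
  have := small (q.1 + t / 2, q.2 + t / 2) (conj (or_intror erefl) (or_intror erefl)).
  move=> /= h1 h2 h3 h4.
  apply: le_trans (ler_normD _ _) _; rewrite -lerBrDr.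
  apply: le_trans (ler_normD _ _) _; rewrite -lerBrDr.
  apply: le_trans (ler_normD _ _) _.
  nra.
pose next q t := xget q [set q' | child q q' t /\ bad q' (t / 2)].
have nextP q t : 0 < t -> bad q t -> child q (next q t) t /\ bad (next q t) (t / 2).
  move=> t0 bq; rewrite /next; case: xgetP => [q' _ []//|].
  by move=> no; have [q' hq'] := step q t t0 bq; case: (no q').
pose t n := s / 2 ^+ n.
have t0 n : 0 < t n by rewrite divr_gt0// exprn_gt0.
have tS n : t n.+1 = t n / 2.
  by rewrite /t exprS; field; rewrite expf_neq0.
pose fix q n := if n is m.+1 then next (q m) (t m) else (a, c).
have qbad n : bad (q n) (t n).
  elim: n => [|n IH]; first by rewrite /t expr0 divr1.
  by rewrite tS/=; exact: (nextP _ _ (t0 n) IH).2.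
have qchild n : child (q n) (q n.+1) (t n) by exact: (nextP _ _ (t0 n) (qbad n)).1.
have nested (u : nat -> R) :
    (forall n, u n.+1 = u n \/ u n.+1 = u n + t n / 2) ->
    exists x, forall n, u n <= x <= u n + t n.
  move=> hu.
  have uS n : u n <= u n.+1 <= u n + t n / 2.
    by have := t0 n; case: (hu n) => ->; lra.
  have mono n m : u n <= u (n + m)%N.
    elim: m => [|m IH]; first by rewrite addn0.
    by rewrite addnS; apply: le_trans IH _; have /andP[] := uS (n + m)%N.
  have anti n m : u (n + m)%N + t (n + m)%N <= u n + t n.
    elim: m => [|m IH]; first by rewrite addn0.
    rewrite addnS; apply: le_trans IH; rewrite tS.
    have := uS (n + m)%N; lra.
  have ub n m : u m <= u n + t n.
    have [nm|mn] := leqP n m.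
      rewrite -(subnKC nm); apply: le_trans (anti n (m - n)%N).
      by rewrite lerDl ltW.
    have := mono m (n - m)%N; rewrite subnKC ?(ltnW mn)// => h.
    by apply: le_trans h _; rewrite lerDl ltW.
  have hs : has_sup (range u).
    split; first by exists (u 0%N), 0%N.
    by exists (u 0%N + t 0%N) => _ [m _ <-]; exact: ub.
  exists (sup (range u)) => n; apply/andP; split.
    by apply: ub_le_sup; [exact: hs.2|exists n].
  by apply: ge_sup; [exact: hs.1|move=> _ [m _ <-]; exact: ub].
have [x hx] := nested (fun n => (q n).1) (fun n => (qchild n).1).
have [y hy] := nested (fun n => (q n).2) (fun n => (qchild n).2).
have [d d0 hd] := J_small x y e0.
have [n hn] : exists n, t n <= d.
  have sd0 : 0 <= s / d by rewrite divr_ge0// ltW.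
  exists (Num.bound (s / d)); rewrite /t ler_pdivrMr ?exprn_gt0//.
  rewrite -ler_pdivrMl// mulrC.
  apply: le_trans (ltW (archi_boundP sd0)) _.
  by rewrite -natrX ler_nat ltnW// ltn_expl.
have := qbad n; rewrite /bad ltNge => /negP; case.
by apply: hd => //; rewrite t0.
Qed.
End Bisection.

(** * Measurability of continuous functions *)

Lemma measurable_of_countable_base d (T : measurableType d) (I : countType)
    (B : I -> set T) (O : set T) : (forall i, measurable (B i)) ->
  (forall p, O p -> exists i, B i p /\ B i `<=` O) -> measurable O.
Proof.
move=> mB hO.
pose C n := if unpickle n is Some i then
  (if `[< B i `<=` O >] then B i else set0) else set0.
have -> : O = \bigcup_n C n.
  apply/seteqP; split => [p /hO[i [Bp BO]]|p [n _]].
    by exists (pickle i) => //; rewrite /C pickleK; case: asboolP.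
  by rewrite /C; case: unpickle => //= i; case: asboolP => // BO /BO.
apply: bigcupT_measurable => n; rewrite /C; case: (unpickle n) => [i|]; last exact: measurable0.
by case: asboolP => _; [exact: mB|exact: measurable0].
Qed.

Section PlaneMeasure.
Variable R : realType.
Local Notation R1 := (measurableTypeR R).
Local Notation R2 := (R1 * R1)%type.

Lemma rational_interval (x d : R) : 0 < d ->
  exists q : rat * rat, ratr q.1 < x < ratr q.2 /\
   forall z, ratr q.1 < z < ratr q.2 -> `|z - x| <= d.
Proof.
move=> d0.
have [q1] := @rat_in_itvoo R (x - d) x ltac:(lra).
have [q2] := @rat_in_itvoo R x (x + d) ltac:(lra).
rewrite !in_itv/= => h2 h1; exists (q1, q2); split => /=; first lra.
by move=> z hz; rewrite ler_norml; lra.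
Qed.

Definition open2 (O : set R2) := forall p, O p -> exists2 d : R, 0 < d &
  forall q : R2, `|q.1 - p.1| <= d -> `|q.2 - p.2| <= d -> O q.

Definition rational_box (i : (rat * rat) * (rat * rat)) : set R2 :=
  `]ratr i.1.1, ratr i.1.2[%classic `*` `]ratr i.2.1, ratr i.2.2[%classic.

Lemma measurable_rational_box i : measurable (rational_box i).
Proof. by apply: measurableX; exact: measurable_itv. Qed.

(** Boxes with rational end points belong to the product sigma-algebra, and every
    open set is a countable union of them. *)
Lemma open2_measurable (O : set R2) : open2 O -> measurable O.
Proof.
move=> oO.
apply: (measurable_of_countable_base measurable_rational_box).
move=> p /oO[d d0 hd].
have [q1 [h1 k1]] := rational_interval p.1 d0.
have [q2 [h2 k2]] := rational_interval p.2 d0.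
exists (q1, q2); split; first by split; rewrite /= in_itv.
by move=> q [/=]; rewrite !in_itv/= => /k1 g1 /k2 g2; exact: hd.
Qed.

Lemma open4_measurable (O : set (R2 * R2)) : (forall p, O p -> exists2 d : R, 0 < d &
  forall q : R2 * R2, `|q.1.1 - p.1.1| <= d -> `|q.1.2 - p.1.2| <= d ->
    `|q.2.1 - p.2.1| <= d -> `|q.2.2 - p.2.2| <= d -> O q) -> measurable O.
Proof.
move=> oO.
have mB i : measurable (rational_box i.1 `*` rational_box i.2).
  by apply: measurableX; exact: measurable_rational_box.
apply: (measurable_of_countable_base mB).
move=> p /oO[d d0 hd].
have [q1 [h1 k1]] := rational_interval p.1.1 d0.
have [q2 [h2 k2]] := rational_interval p.1.2 d0.
have [q3 [h3 k3]] := rational_interval p.2.1 d0.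
have [q4 [h4 k4]] := rational_interval p.2.2 d0.
exists ((q1, q2), (q3, q4)); split; first by split; split; rewrite /= in_itv.
move=> q [] [] /=; rewrite !in_itv/= => /k1 g1 /k2 g2 [] /=.
by rewrite !in_itv/= => /k3 g3 /k4 g4; exact: hd.
Qed.

(** Continuity at a point, in a form that composes with difference estimates. *)
Definition cont2 (F : R -> R -> R) x y := forall e : R, 0 < e ->
  exists2 d, 0 < d & forall h k, `|h| <= d -> `|k| <= d ->
  `|F (x + h) (y + k) - F x y| <= e.

Lemma cont2_measurable (F : R -> R -> R) : (forall x y, cont2 F x y) ->
  measurable_fun [set: R2] (fun p : R2 => F p.1 p.2 : R1).
Proof.
move=> cF mD; apply: (measurability _ (RGenOInfty.measurableE R)) => //.
move=> _ [_ [a ->] <-]; rewrite setTI; apply: open2_measurable.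
move=> p /=; rewrite in_itv/= andbT => ap.
have [|d d0 hd] := cF p.1 p.2 ((F p.1 p.2 - a) / 2).
  by rewrite divr_gt0// subr_gt0.
exists d => // q h1 h2; rewrite /= in_itv/= andbT.
have := hd _ _ h1 h2; rewrite !subrKC ler_norml; lra.
Qed.

Lemma cont2_section1 (F : R -> R -> R) x : (forall y, cont2 F x y) ->
  measurable_fun setT (F x : R1 -> R1).
Proof.
move=> cF; apply: continuous_measurable_fun => y.
apply/cvgrPdist_le => e /(cF y)[d d0 hd].
near=> z; rewrite distrC.
have := hd 0 (z - y); rewrite addr0 subrKC normr0; apply; first exact: ltW.
rewrite distrC; near: z; exact: cvgr_dist_le.
Unshelve. all: by end_near.
Qed.

Lemma cont2_section2 (F : R -> R -> R) y : (forall x, cont2 F x y) ->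
  measurable_fun setT ((fun x => F x y) : R1 -> R1).
Proof.
move=> cF; apply: (@cont2_section1 (fun a b => F b a)) => x e /(cF x)[d d0 hd].
by exists d => // h k hh kk; exact: hd.
Qed.

Section BoundedIntegrals.
Context d (T : measurableType d) (mu : {measure set T -> \bar R}).
Variables (A : set T) (mA : measurable A) (Afin : (mu A < +oo)%E).

Lemma bounded_measurable_integrable (f : T -> R) M : measurable_fun setT f ->
  (forall x, A x -> `|f x| <= M) -> mu.-integrable A (EFin \o f).
Proof.
move=> mf fM; apply: measurable_bounded_integrable => //.
  exact: measurable_funTS.
exists M; split; first exact: num_real.
move=> r Mr x Ax; exact: le_trans (fM x Ax) (ltW Mr).
Qed.

(** The integral over a set of mass m of a function within e of k is within
    e m of k m; this is how integrals over small squares are localized. *)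
Lemma Rintegral_near_cst (f : T -> R) k e m : mu A = m%:E ->
  mu.-integrable A (EFin \o f) -> (forall x, A x -> `|f x - k| <= e) ->
  `|\int[mu]_(x in A) f x - k * m| <= e * m.
Proof.
move=> mAE; have -> : m = fine (mu A) by rewrite mAE.
move=> fi hf.
have ci' r : mu.-integrable A (EFin \o (fun _ : T => r)).
  by apply: (@bounded_measurable_integrable _ `|r|); [exact: measurable_cst|].
have := le_Rintegral mA (ci' (k - e)) fi; have := le_Rintegral mA fi (ci' (k + e)).
rewrite !Rintegral_cst// => h1 h2.
have {}h1 := h1 (fun x Ax => ltac:(have := hf x Ax; rewrite ler_norml; lra)).
have {}h2 := h2 (fun x Ax => ltac:(have := hf x Ax; rewrite ler_norml; lra)).
rewrite ler_norml; lra.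
Qed.
End BoundedIntegrals.
End PlaneMeasure.

(** * The divergence theorem on a square *)

Section Divergence.
Variable R : realType.
Local Notation R1 := (measurableTypeR R).
Local Notation R2 := (R1 * R1)%type.
Local Notation lam1 := (@lebesgue_measure R).
Local Notation lam2 := (@lebesgue2 R).

(** Differentiability of a function of two real variables at one point; nothing
    is assumed on the regularity of the gradient (a, b). *)
Definition expansion2 (F : R -> R -> R) (x y a b : R) :=
  forall e, 0 < e -> exists2 d, 0 < d & forall h k, `|h| <= d -> `|k| <= d ->
  `|F (x + h) (y + k) - F x y - a * h - b * k| <= e * (`|h| + `|k|).

Lemma expansion2_cont2 F x y a b : expansion2 F x y a b -> cont2 F x y.
Proof.
move=> xF e e0; have [d d0 hd] := xF 1 ltr01.
pose K := 1 + `|a| + `|b|.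
have K0 : 0 < K by rewrite /K; have := normr_ge0 a; have := normr_ge0 b; lra.
exists (Num.min d (e / (2 * K))).
  by rewrite lt_min d0 divr_gt0// mulr_gt0.
move=> h k; rewrite !le_min => /andP[hh hh'] /andP[kk kk'].
have := hd _ _ hh kk; rewrite mul1r => hF.
have hK : K * `|h| <= e / 2.
  apply: le_trans (ler_wpM2l (ltW K0) hh') _.
  by rewrite le_eqVlt; apply/orP; left; apply/eqP; field; rewrite gt_eqF.
have kK : K * `|k| <= e / 2.
  apply: le_trans (ler_wpM2l (ltW K0) kk') _.
  by rewrite le_eqVlt; apply/orP; left; apply/eqP; field; rewrite gt_eqF.
have -> : F (x + h) (y + k) - F x y =
  (F (x + h) (y + k) - F x y - a * h - b * k) + (a * h + b * k) by ring.
apply: le_trans (ler_normD _ _) _.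
have h2 : `|a * h + b * k| <= `|a| * `|h| + `|b| * `|k|.
  by rewrite -!normrM; exact: ler_normD.
have a0 := normr_ge0 a; have b0 := normr_ge0 b.
have h0 := normr_ge0 h; have k0 := normr_ge0 k.
rewrite /K in hK kK; nra.
Qed.

(** Half-open segments, so that halving a square gives a partition. *)
Definition seg (a s : R) : set R1 := `]a, a + s]%classic.
Definition square (a c s : R) : set R2 := seg a s `*` seg c s.

Lemma measurable_seg a s : measurable (seg a s).
Proof. exact: measurable_itv. Qed.

Lemma measurable_square a c s : measurable (square a c s).
Proof. by apply: measurableX; exact: measurable_seg. Qed.

Lemma lam1_seg a s : 0 < s -> lam1 (seg a s) = s%:E.
Proof.
move=> s0; rewrite lebesgue_measure_itv/= lte_fin ltrDl s0.
by rewrite -EFinD; congr EFin; lra.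
Qed.

Lemma lam2_square a c s : 0 < s -> lam2 (square a c s) = (s ^+ 2)%:E.
Proof.
move=> s0; rewrite expr2 EFinM -{1}(lam1_seg a s0) -(lam1_seg c s0).
by apply: product_measure1E; exact: measurable_seg.
Qed.

Lemma lam1_seg_lty a s : 0 < s -> (lam1 (seg a s) < +oo)%E.
Proof. by move=> s0; rewrite lam1_seg// ltry. Qed.

Lemma lam2_square_lty a c s : 0 < s -> (lam2 (square a c s) < +oo)%E.
Proof. by move=> s0; rewrite lam2_square// ltry. Qed.

Lemma segU a s : 0 < s -> seg a s = seg a (s / 2) `|` seg (a + s / 2) (s / 2).
Proof.
move=> s0; apply/seteqP; split => x; rewrite /seg/= !in_itv/=.
  by move=> hx; have [h|h] := leP x (a + s / 2); [left|right]; lra.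
by case; lra.
Qed.

Lemma seg_disj a s : 0 < s -> [disjoint seg a (s / 2) & seg (a + s / 2) (s / 2)].
Proof.
move=> s0; apply/disj_setPLR => x; rewrite /seg/= !in_itv/= => h1.
by apply/negP; lra.
Qed.

Lemma squareU a c s : 0 < s -> square a c s =
  (square a c (s / 2) `|` square (a + s / 2) c (s / 2)) `|`
  (square a (c + s / 2) (s / 2) `|` square (a + s / 2) (c + s / 2) (s / 2)).
Proof.
move=> s0.
have E b x : seg b s x <-> seg b (s / 2) x \/ seg (b + s / 2) (s / 2) x.
  by rewrite (segU b s0).
apply/seteqP; split => -[x y]; rewrite /square /=.
  by move=> [/E[] hx /E[] hy]; tauto.
by have := E a x; have := E c y; tauto.
Qed.

Variables (P S g : R -> R -> R) (M : R).
Hypothesis PS_expansion : forall x y, exists a b c d,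
  [/\ expansion2 P x y a b, expansion2 S x y c d & a + d = g x y].
Hypothesis g_cont : forall x y, cont2 g x y.
Hypothesis P_bound : forall x y, `|P x y| <= M.
Hypothesis S_bound : forall x y, `|S x y| <= M.
Hypothesis g_bound : forall x y, `|g x y| <= M.

Let segint (f : R -> R) a s := \int[lam1]_(y in seg a s) f y.

Lemma segint_split (f : R1 -> R1) a s : 0 < s -> measurable_fun setT f ->
  (forall x, `|f x| <= M) ->
  segint f a s = segint f a (s / 2) + segint f (a + s / 2) (s / 2).
Proof.
move=> s0 mf fM; rewrite /segint {1}(segU a s0) Rintegral_setU//.
- exact: measurable_seg.
- exact: measurable_seg.
- rewrite -(segU a s0).
  apply: (@bounded_measurable_integrable _ _ _ _ _ _ _ _ M) => //.
    exact: measurable_seg.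
  exact: lam1_seg_lty.
- exact: seg_disj.
Qed.

Let P_cont x y : cont2 P x y.
Proof. by have [a [b [c [d [h _ _]]]]] := PS_expansion x y; exact: expansion2_cont2 h. Qed.
Let S_cont x y : cont2 S x y.
Proof. by have [a [b [c [d [_ h _]]]]] := PS_expansion x y; exact: expansion2_cont2 h. Qed.

Let mP x : measurable_fun setT (P x : R1 -> R1).
Proof. by apply: cont2_section1. Qed.
Let mS y : measurable_fun setT ((fun x => S x y) : R1 -> R1).
Proof. by apply: cont2_section2. Qed.
Let mg : measurable_fun setT (fun p : R2 => g p.1 p.2 : R1).
Proof. exact: cont2_measurable. Qed.

Let flux a c s := segint (P (a + s)) c s - segint (P a) c s
  + segint (fun x => S x (c + s)) a s - segint (fun x => S x c) a s.
Let gint a c s := \int[lam2]_(p in square a c s) g p.1 p.2.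

Let g_integrable a c s : 0 < s ->
  lam2.-integrable (square a c s) (EFin \o (fun p : R2 => g p.1 p.2)).
Proof.
move=> s0; apply: (@bounded_measurable_integrable _ _ _ _ _ _ _ _ M) => //.
  exact: measurable_square.
exact: lam2_square_lty.
Qed.

Lemma gint_split a c s : 0 < s -> gint a c s =
  gint a c (s / 2) + gint (a + s / 2) c (s / 2)
  + gint a (c + s / 2) (s / 2) + gint (a + s / 2) (c + s / 2) (s / 2).
Proof.
move=> s0; have mq b e t := measurable_square b e t.
have gi := @g_integrable a c s s0.
have fs := segU c s0; have fa := segU a s0.
have dx := seg_disj a s0; have dy := seg_disj c s0.
rewrite /gint {1}(squareU a c s0); rewrite (squareU a c s0) in gi.
have mA : measurable (square a c (s / 2) `|` square (a + s / 2) c (s / 2)).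
  exact: measurableU.
have mB : measurable (square a (c + s / 2) (s / 2) `|`
    square (a + s / 2) (c + s / 2) (s / 2)) by exact: measurableU.
have dX e : [disjoint square a e (s / 2) & square (a + s / 2) e (s / 2)].
  apply/disj_setPLR => -[x y] [/= hx hy] [/= hx' _].
  by have /disj_setPLR/(_ _ hx) := dx.
rewrite Rintegral_setU//; last first.
  apply/disj_setPLR => -[x y] /= h [] [/= _ hy];
    by case: h => -[/= _ hy']; have /disj_setPLR/(_ _ hy') := dy.
have giA := integrableS (measurableU _ _ mA mB) mA (@subsetUl _ _ _) gi.
have giB := integrableS (measurableU _ _ mA mB) mB (@subsetUr _ _ _) gi.
by rewrite Rintegral_setU// Rintegral_setU// addrA.
Qed.

Lemma flux_split a c s : 0 < s -> flux a c s =
  flux a c (s / 2) + flux (a + s / 2) c (s / 2)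
  + flux a (c + s / 2) (s / 2) + flux (a + s / 2) (c + s / 2) (s / 2).
Proof.
move=> s0; rewrite /flux.
rewrite (segint_split _ s0 (mP (a + s)))// (segint_split _ s0 (mP a))//.
rewrite (segint_split _ s0 (mS (c + s)))// (segint_split _ s0 (mS c))//.
have h x : x + s / 2 + s / 2 = x + s by lra.
rewrite !h; lra.
Qed.

Lemma segint_sub f1 f2 a s k e : 0 < s ->
  measurable_fun setT (f1 : R1 -> R1) -> measurable_fun setT (f2 : R1 -> R1) ->
  (forall x, `|f1 x| <= M) -> (forall x, `|f2 x| <= M) ->
  (forall x, seg a s x -> `|f1 x - f2 x - k| <= e) ->
  `|segint f1 a s - segint f2 a s - k * s| <= e * s.
Proof.
move=> s0 m1 m2 b1 b2 h; rewrite /segint.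
have mA := measurable_seg a s; have Af := lam1_seg_lty a s0.
have i1 : lam1.-integrable (seg a s) (EFin \o f1).
  by apply: (@bounded_measurable_integrable _ _ _ _ _ _ _ _ M).
have i2 : lam1.-integrable (seg a s) (EFin \o f2).
  by apply: (@bounded_measurable_integrable _ _ _ _ _ _ _ _ M).
rewrite -RintegralB//.
apply: (@Rintegral_near_cst _ _ _ lam1 _ mA Af (f1 \- f2) k e s) => //.
  exact: lam1_seg.
exact: (integrableB mA i1 i2).
Qed.

(** At a point of differentiability the flux through a small square around it
    is the divergence times the area, up to a small multiple of the area. *)
Lemma flux_small x y e : 0 < e -> exists2 d, 0 < d &
  forall a c s, 0 < s <= d -> a <= x <= a + s -> c <= y <= c + s ->
  `|flux a c s - gint a c s| <= e * s ^+ 2.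
Proof.
move=> e0; have [al [be [ga [de [hP hS hg]]]]] := PS_expansion x y.
have e9 : 0 < e / 9 by rewrite divr_gt0.
have [d1 d10 {}hP] := hP _ e9; have [d2 d20 {}hS] := hS _ e9.
have [d3 d30 hG] := g_cont x y e9.
exists (Num.min d1 (Num.min d2 d3)); first by rewrite !lt_min d10 d20.
move=> a c s; rewrite !le_min => /andP[s0 /and3P[s1 s2 s3]] hx hy.
have X : `|segint (P (a + s)) c s - segint (P a) c s - al * s * s| <= 4 * (e / 9) * s * s.
  apply: segint_sub => // z; rewrite /seg/= in_itv/= => hz.
  have k1 : `|z - y| <= s by rewrite ler_norml; lra.
  have k2 : `|a + s - x| <= s by rewrite ler_norml; lra.
  have k3 : `|a - x| <= s by rewrite ler_norml; lra.
  have := hP _ _ (le_trans k2 s1) (le_trans k1 s1).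
  have := hP _ _ (le_trans k3 s1) (le_trans k1 s1).
  rewrite !subrKC => u1 u2.
  have -> : P (a + s) z - P a z - al * s =
    (P (a + s) z - P x y - al * (a + s - x) - be * (z - y))
    - (P a z - P x y - al * (a - x) - be * (z - y)) by ring.
  apply: le_trans (ler_normB _ _) _; nra.
have Y : `|segint (fun x => S x (c + s)) a s - segint (fun x => S x c) a s - de * s * s|
    <= 4 * (e / 9) * s * s.
  apply: segint_sub => // z; rewrite /seg/= in_itv/= => hz.
  have k1 : `|z - x| <= s by rewrite ler_norml; lra.
  have k2 : `|c + s - y| <= s by rewrite ler_norml; lra.
  have k3 : `|c - y| <= s by rewrite ler_norml; lra.
  have := hS _ _ (le_trans k1 s2) (le_trans k2 s2).
  have := hS _ _ (le_trans k1 s2) (le_trans k3 s2).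
  rewrite !subrKC => u1 u2.
  have -> : S z (c + s) - S z c - de * s =
    (S z (c + s) - S x y - ga * (z - x) - de * (c + s - y))
    - (S z c - S x y - ga * (z - x) - de * (c - y)) by ring.
  apply: le_trans (ler_normB _ _) _; nra.
have Z : `|gint a c s - g x y * s ^+ 2| <= e / 9 * s ^+ 2.
  apply: (@Rintegral_near_cst _ _ _ lam2 _ (measurable_square a c s)
    (lam2_square_lty a c s0) (fun p : R2 => g p.1 p.2)).
  - exact: lam2_square.
  - exact: g_integrable.
  move=> [u v] []; rewrite /seg/= !in_itv/= => hu hv.
  have := hG (u - x) (v - y); rewrite !subrKC; apply.
    by apply: le_trans s3; rewrite ler_norml; lra.
  by apply: le_trans s3; rewrite ler_norml; lra.
have -> : flux a c s - gint a c s =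
  (segint (P (a + s)) c s - segint (P a) c s - al * s * s)
  + (segint (fun x => S x (c + s)) a s - segint (fun x => S x c) a s - de * s * s)
  - (gint a c s - g x y * s ^+ 2) by rewrite /flux -hg; ring.
apply: le_trans (ler_normB _ _) _.
have := ler_normD (segint (P (a + s)) c s - segint (P a) c s - al * s * s)
 (segint (fun x => S x (c + s)) a s - segint (fun x => S x c) a s - de * s * s).
nra.
Qed.

(** The divergence theorem for a field (P, S) that is merely differentiable:
    flux minus integral of the divergence is additive under bisection and
    small at every point, hence zero. Continuity is asked of the divergence only,
    which is what a merely differentiable holomorphic function provides. *)
Theorem divergence_square a c s : 0 < s ->
  \int[lam1]_(y in seg c s) P (a + s) y - \int[lam1]_(y in seg c s) P a y
  + \int[lam1]_(x in seg a s) S x (c + s) - \int[lam1]_(x in seg a s) S x c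
  = \int[lam2]_(p in square a c s) g p.1 p.2.
Proof.
move=> s0; apply/eqP; rewrite -subr_eq0; apply/eqP.
apply: (@bisection_zero R (fun a c s => flux a c s - gint a c s)) => //.
- by move=> {s0}a {}c {}s s0; rewrite (flux_split a c s0) (gint_split a c s0); ring.
- exact: flux_small.
Qed.
End Divergence.

(** * First-order expansions and the tent weight *)

Section Expansions.
Variable R : realType.
Implicit Types (F G : R -> R -> R) (phi : R -> R).

Definition expansion1 phi (s d : R) := forall e, 0 < e ->
  exists2 r, 0 < r & forall h, `|h| <= r -> `|phi (s + h) - phi s - d * h| <= e * `|h|.

Lemma expansion2_lip F x y a b : expansion2 F x y a b ->
  exists K, 0 < K /\ exists2 d, 0 < d & forall h k, `|h| <= d -> `|k| <= d ->
    `|F (x + h) (y + k) - F x y| <= K * (`|h| + `|k|).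
Proof.
move=> hF; have [d d0 hd] := hF 1 ltr01.
exists (1 + `|a| + `|b|); split.
  by have := normr_ge0 a; have := normr_ge0 b; lra.
exists d => // h k hh kk; have {hd} := hd _ _ hh kk; rewrite mul1r => hd.
have -> : F (x + h) (y + k) - F x y =
  (F (x + h) (y + k) - F x y - a * h - b * k) + (a * h + b * k) by ring.
apply: le_trans (ler_normD _ _) _.
have h2 : `|a * h + b * k| <= `|a| * `|h| + `|b| * `|k|.
  by rewrite -!normrM; exact: ler_normD.
have a0 := normr_ge0 a; have b0 := normr_ge0 b.
have h0 := normr_ge0 h; have k0 := normr_ge0 k.
nra.
Qed.

Lemma expansion2_cst (c x y : R) : expansion2 (fun _ _ => c) x y 0 0.
Proof.
move=> e e0; exists 1 => // h k _ _.
by rewrite subrr !mul0r !subr0 normr0 mulr_ge0 ?(ltW e0)// addr_ge0.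
Qed.

Lemma expansion2_fst (c x y : R) : expansion2 (fun x _ => x - c) x y 1 0.
Proof.
move=> e e0; exists 1 => // h k _ _.
have -> : x + h - c - (x - c) - 1 * h - 0 * k = 0 by ring.
by rewrite normr0 mulr_ge0 ?(ltW e0)// addr_ge0.
Qed.

Lemma expansion2_snd (c x y : R) : expansion2 (fun _ y => y - c) x y 0 1.
Proof.
move=> e e0; exists 1 => // h k _ _.
have -> : y + k - c - (y - c) - 0 * h - 1 * k = 0 by ring.
by rewrite normr0 mulr_ge0 ?(ltW e0)// addr_ge0.
Qed.

Lemma expansion2_add F G x y a b c d : expansion2 F x y a b ->
  expansion2 G x y c d ->
  expansion2 (fun x y => F x y + G x y) x y (a + c) (b + d).
Proof.
move=> hF hG e e0; have e2 : 0 < e / 2 by rewrite divr_gt0.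
have [r r0 {}hF] := hF _ e2; have [s s0 {}hG] := hG _ e2.
exists (Num.min r s); first by rewrite lt_min r0.
move=> h k; rewrite !le_min => /andP[h1 h2] /andP[k1 k2].
have {}hF := hF _ _ h1 k1; have {}hG := hG _ _ h2 k2.
have -> : F (x + h) (y + k) + G (x + h) (y + k) - (F x y + G x y) -
    (a + c) * h - (b + d) * k =
  (F (x + h) (y + k) - F x y - a * h - b * k)
  + (G (x + h) (y + k) - G x y - c * h - d * k) by ring.
by apply: le_trans (ler_normD _ _) _; lra.
Qed.

Lemma expansion2_opp F x y a b : expansion2 F x y a b ->
  expansion2 (fun x y => - F x y) x y (- a) (- b).
Proof.
move=> hF e e0; have [r r0 {}hF] := hF _ e0.
exists r => // h k h1 k1; rewrite -normrN.
suff -> : - (- F (x + h) (y + k) - - F x y - - a * h - - b * k) =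
  F (x + h) (y + k) - F x y - a * h - b * k by exact: hF.
by ring.
Qed.

Lemma expansion2_mul F G x y a b c d : expansion2 F x y a b ->
  expansion2 G x y c d -> expansion2 (fun x y => F x y * G x y) x y
    (a * G x y + F x y * c) (b * G x y + F x y * d).
Proof.
move=> hF hG e e0.
have [K [K0 [r3 r30 lF]]] := expansion2_lip hF.
pose L := 1 + `|F x y| + `|G x y|.
have L0 : 0 < L by rewrite /L; have := normr_ge0 (F x y); have := normr_ge0 (G x y); lra.
have e1 : 0 < e / (2 * L) by rewrite divr_gt0 ?mulr_gt0.
have e2 : 0 < e / (2 * K) by rewrite divr_gt0 ?mulr_gt0.
have [r4 r40 cG] := expansion2_cont2 hG e2.
have [r r0 {}hF] := hF _ e1; have [s s0 {}hG] := hG _ e1.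
exists (Num.min (Num.min r s) (Num.min r3 r4)).
  by rewrite !lt_min r0 s0 r30.
move=> h k; rewrite !le_min.
move=> /andP[/andP[h1 h2] /andP[h3 h4]] /andP[/andP[k1 k2] /andP[k3 k4]].
have {}hF := hF _ _ h1 k1; have {}hG := hG _ _ h2 k2.
have {}lF := lF _ _ h3 k3; have {}cG := cG _ _ h4 k4.
set F' := F (x + h) (y + k) in hF lF *; set G' := G (x + h) (y + k) in hG cG *.
have -> : F' * G' - F x y * G x y - (a * G x y + F x y * c) * h
   - (b * G x y + F x y * d) * k =
  (F x y * (G' - G x y - c * h - d * k) + G x y * (F' - F x y - a * h - b * k))
  + (F' - F x y) * (G' - G x y) by ring.
have t0 : 0 <= `|h| + `|k| by rewrite addr_ge0.
set t := `|h| + `|k| in hF hG lF t0 *.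
have p1 : `|F x y * (G' - G x y - c * h - d * k)| <= `|F x y| * (e / (2 * L) * t).
  by rewrite normrM ler_wpM2l.
have p2 : `|G x y * (F' - F x y - a * h - b * k)| <= `|G x y| * (e / (2 * L) * t).
  by rewrite normrM ler_wpM2l.
have p3 : `|(F' - F x y) * (G' - G x y)| <= (K * t) * (e / (2 * K)).
  by rewrite normrM ler_pM.
have q3 : (K * t) * (e / (2 * K)) = e / 2 * t by field; rewrite gt_eqF.
have q1 : (`|F x y| + `|G x y|) * (e / (2 * L) * t) <= e / 2 * t.
  have -> : e / 2 * t = L * (e / (2 * L) * t) by field; rewrite gt_eqF.
  apply: ler_wpM2r; first by rewrite mulr_ge0// ltW.
  by rewrite /L; lra.
apply: le_trans (ler_normD _ _) _.
have := ler_normD (F x y * (G' - G x y - c * h - d * k))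
  (G x y * (F' - F x y - a * h - b * k)).
lra.
Qed.

Lemma expansion2_comp phi F x y a b d : expansion2 F x y a b ->
  expansion1 phi (F x y) d -> expansion2 (fun x y => phi (F x y)) x y (d * a) (d * b).
Proof.
move=> hF hphi e e0.
have [K [K0 [r3 r30 lF]]] := expansion2_lip hF.
have e2 : 0 < e / (2 * K) by rewrite divr_gt0 ?mulr_gt0.
have [s s0 {}hphi] := hphi _ e2.
have [r4 r40 cF] := expansion2_cont2 hF s0.
pose L := 1 + `|d|.
have L0 : 0 < L by rewrite /L; have := normr_ge0 d; lra.
have e1 : 0 < e / (2 * L) by rewrite divr_gt0 ?mulr_gt0.
have [r r0 {}hF] := hF _ e1.
exists (Num.min r (Num.min r3 r4)).
  by rewrite !lt_min r0 r30.
move=> h k; rewrite !le_min.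
move=> /and3P[h1 h3 h4] /and3P[k1 k3 k4].
have {}hF := hF _ _ h1 k1.
have {}lF := lF _ _ h3 k3; have {}cF := cF _ _ h4 k4.
have := hphi _ cF; rewrite subrKC.
set F' := F (x + h) (y + k) in hF lF cF *.
move=> hp.
have t0 : 0 <= `|h| + `|k| by rewrite addr_ge0.
set t := `|h| + `|k| in hF lF t0 *.
have -> : phi F' - phi (F x y) - d * a * h - d * b * k =
  (phi F' - phi (F x y) - d * (F' - F x y)) + d * (F' - F x y - a * h - b * k) by ring.
have p1 : e / (2 * K) * `|F' - F x y| <= e / 2 * t.
  have -> : e / 2 * t = e / (2 * K) * (K * t) by field; rewrite gt_eqF.
  by rewrite ler_wpM2l// ltW.
have p2 : `|d * (F' - F x y - a * h - b * k)| <= `|d| * (e / (2 * L) * t).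
  by rewrite normrM ler_wpM2l.
have p3 : `|d| * (e / (2 * L) * t) <= e / 2 * t.
  have -> : e / 2 * t = L * (e / (2 * L) * t) by field; rewrite gt_eqF.
  apply: ler_wpM2r; first by rewrite mulr_ge0// ltW.
  by rewrite /L; lra.
by apply: le_trans (ler_normD _ _) _; lra.
Qed.

Lemma expansion2_eq F G x y a b r : 0 < r ->
  (forall h k, `|h| <= r -> `|k| <= r -> F (x + h) (y + k) = G (x + h) (y + k)) ->
  expansion2 F x y a b -> expansion2 G x y a b.
Proof.
move=> r0 FG hF e e0; have [d d0 hd] := hF e e0.
exists (Num.min r d); first by rewrite lt_min r0.
move=> h k; rewrite !le_min => /andP[h1 h2] /andP[k1 k2].
have := FG 0 0; rewrite normr0 !addr0 => <-; [|exact: ltW..].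
by rewrite -FG//; exact: hd.
Qed.

(** The weight of all mean values below, evaluated at a squared distance s:
    the truncated paraboloid, supported in the disc of squared radius rho. *)
Definition tent (rho s : R) := Num.max 0 (rho - s).
(** The function q with (s q(s))' = tent rho s / rho^2, regular at 0. Outside
    the support it equals 1/(2s) whatever rho is, so that the difference of two
    of these functions has bounded support. *)
Definition tentq (rho s : R) :=
  if s <= rho then (1 - s / (2 * rho)) / rho else (2 * s)^-1.
Definition tentq' (rho s : R) :=
  if s <= rho then - (2 * rho ^+ 2)^-1 else - (2 * s ^+ 2)^-1.

Lemma tentqE (rho s : R) : 0 < rho -> tentq rho s + s * tentq' rho s = tent rho s / rho ^+ 2.
Proof.
move=> r0; rewrite /tentq /tentq' /tent; case: ifPn => [sr|].
  by rewrite max_r ?subr_ge0//; field; rewrite gt_eqF.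
rewrite -ltNge => sr; rewrite max_l ?subr_le0 ?ltW//.
have s0 : 0 < s by lra.
by field; rewrite !gt_eqF.
Qed.

(** The two branches of q meet with the same value and the same slope at
    s = rho, which makes q differentiable there. *)
Lemma tentq_expansion rho s : 0 < rho -> expansion1 (tentq rho) s (tentq' rho s).
Proof.
move=> r0 e e0.
have [sr|sr] := leP s rho.
  exists (e * (2 * rho ^+ 3)); first by rewrite mulr_gt0// mulr_gt0// exprn_gt0.
  move=> h hr; rewrite /tentq /tentq' sr.
  case: ifPn => [hs|].
    have -> : (1 - (s + h) / (2 * rho)) / rho - (1 - s / (2 * rho)) / rho
      - - (2 * rho ^+ 2)^-1 * h = 0 by field; rewrite gt_eqF.
    by rewrite normr0 mulr_ge0// ltW.
  rewrite -ltNge => hs.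
  have t0 : 0 < s + h by lra.
  have -> : (2 * (s + h))^-1 - (1 - s / (2 * rho)) / rho - - (2 * rho ^+ 2)^-1 * h
    = (s + h - rho) ^+ 2 / (2 * (s + h) * rho ^+ 2).
    by field; rewrite !gt_eqF.
  rewrite ger0_norm; last first.
    by rewrite divr_ge0// ?sqr_ge0// ltW// !mulr_gt0// exprn_gt0.
  rewrite ler_pdivrMr; last by rewrite !mulr_gt0// exprn_gt0.
  have h0 : 0 < h by lra.
  rewrite gtr0_norm// in hr *.
  have : (s + h - rho) ^+ 2 <= h * h by rewrite expr2; nra.
  move=> /le_trans; apply.
  apply: (le_trans (ler_wpM2l (ltW h0) hr)).
  have r2 : 0 < rho ^+ 2 by rewrite exprn_gt0.
  have -> : e * h * (2 * (s + h) * rho ^+ 2) = h * (e * (2 * ((s + h) * rho ^+ 2))).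
    by ring.
  by rewrite exprS !ler_pM2l// ler_pM2r// ltW.
have s0 : 0 < s by lra.
exists (Num.min ((s - rho) / 2) (e * (2 * s ^+ 2 * rho))).
  by rewrite lt_min !divr_gt0 ?subr_gt0// !mulr_gt0// exprn_gt0.
move=> h; rewrite le_min => /andP[h1 h2].
have sh : rho < s + h by move: h1; rewrite ler_norml; lra.
have t0 : 0 < s + h by lra.
rewrite /tentq /tentq' [s <= _]leNgt sr/= [_ <= rho]leNgt sh/=.
have -> : (2 * (s + h))^-1 - (2 * s)^-1 - - (2 * s ^+ 2)^-1 * h
    = h ^+ 2 / (2 * s ^+ 2 * (s + h)).
  by field; rewrite !gt_eqF.
rewrite normrM normfV normrX [`|2 * _ * _|]gtr0_norm; last first.
  by rewrite !mulr_gt0// exprn_gt0.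
rewrite ler_pdivrMr; last by rewrite !mulr_gt0// exprn_gt0.
have c0 : 0 < 2 * s ^+ 2 by rewrite mulr_gt0// exprn_gt0.
have -> : e * `|h| * (2 * s ^+ 2 * (s + h)) = `|h| * (e * (2 * s ^+ 2 * (s + h))).
  by ring.
rewrite expr2 ler_wpM2l//; apply: le_trans h2 _.
by rewrite !ler_pM2l// ltW.
Qed.

Lemma tent_ge0 (rho s : R) : 0 <= tent rho s.
Proof. by rewrite /tent le_max lexx. Qed.

Lemma tent_lip (rho s t : R) : `|tent rho s - tent rho t| <= `|s - t|.
Proof.
rewrite /tent; case: (leP 0 (rho - s)) => h1; case: (leP 0 (rho - t)) => h2;
  rewrite ?ler_norml; have := ler_norm (s - t); have := ler_norm (t - s);
  rewrite distrC; lra.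
Qed.

Lemma tentq_far (rho eps s : R) : 0 < eps <= rho -> rho <= s -> tentq rho s = tentq eps s.
Proof.
move=> /andP[e0 er] rs; rewrite /tentq.
have [sr|sr] := leP s rho; last by rewrite leNgt (le_lt_trans er sr).
have -> : s = rho by apply/eqP; rewrite eq_le sr.
have [re|re] := leP rho eps; last by field; rewrite gt_eqF//; lra.
by have -> : eps = rho by apply/eqP; rewrite eq_le er.
Qed.
End Expansions.

(** * Tent averages of holomorphic functions *)

Section Cont2.
Variable R : realType.
Implicit Types F G : R -> R -> R.

Lemma cont2_mul F G x y : cont2 F x y -> cont2 G x y ->
  cont2 (fun x y => F x y * G x y) x y.
Proof.
move=> hF hG e e0.
pose L := 1 + `|F x y| + `|G x y|.
have f0 := normr_ge0 (F x y); have g0 := normr_ge0 (G x y).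
have L0 : 0 < L by rewrite /L; lra.
pose t := Num.min 1 (e / (2 * L)).
have t0 : 0 < t by rewrite /t lt_min ltr01 divr_gt0// mulr_gt0.
have t1 : t <= 1 by rewrite /t ge_min lexx.
have tL : t * L <= e / 2.
  have : t <= e / (2 * L) by rewrite /t ge_min lexx orbT.
  move=> h; apply: (le_trans (ler_wpM2r (ltW L0) h)).
  by rewrite le_eqVlt; apply/orP; left; apply/eqP; field; rewrite gt_eqF.
have [r r0 {}hF] := hF _ t0; have [s s0 {}hG] := hG _ t0.
exists (Num.min r s); first by rewrite lt_min r0.
move=> h k; rewrite !le_min => /andP[h1 h2] /andP[k1 k2].
have {}hF := hF _ _ h1 k1; have {}hG := hG _ _ h2 k2.
set F' := F (x + h) (y + k) in hF *; set G' := G (x + h) (y + k) in hG *.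
have -> : F' * G' - F x y * G x y = (F x y * (G' - G x y)
  + G x y * (F' - F x y)) + (F' - F x y) * (G' - G x y) by ring.
have p1 : `|F x y * (G' - G x y)| <= `|F x y| * t by rewrite normrM ler_wpM2l.
have p2 : `|G x y * (F' - F x y)| <= `|G x y| * t by rewrite normrM ler_wpM2l.
have p3 : `|(F' - F x y) * (G' - G x y)| <= t * t by rewrite normrM ler_pM.
apply: le_trans (ler_normD _ _) _.
have := ler_normD (F x y * (G' - G x y)) (G x y * (F' - F x y)).
rewrite /L in tL; nra.
Qed.

Lemma cont2_lin F G c d x y : cont2 F x y -> cont2 G x y ->
  cont2 (fun x y => c * F x y + d * G x y) x y.
Proof.
move=> hF hG e e0.
pose L := 1 + `|c| + `|d|.
have c0 := normr_ge0 c; have d0 := normr_ge0 d.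
have L0 : 0 < L by rewrite /L; lra.
have t0 : 0 < e / L by rewrite divr_gt0.
have [r r0 {}hF] := hF _ t0; have [s s0 {}hG] := hG _ t0.
exists (Num.min r s); first by rewrite lt_min r0.
move=> h k; rewrite !le_min => /andP[h1 h2] /andP[k1 k2].
have {}hF := hF _ _ h1 k1; have {}hG := hG _ _ h2 k2.
set F' := F (x + h) (y + k) in hF *; set G' := G (x + h) (y + k) in hG *.
have -> : c * F' + d * G' - (c * F x y + d * G x y) =
  c * (F' - F x y) + d * (G' - G x y) by ring.
have p1 : `|c * (F' - F x y)| <= `|c| * (e / L) by rewrite normrM ler_wpM2l.
have p2 : `|d * (G' - G x y)| <= `|d| * (e / L) by rewrite normrM ler_wpM2l.
apply: le_trans (ler_normD _ _) _.
have eE : e = L * (e / L) by field; rewrite gt_eqF.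
set q := e / L in t0 p1 p2 eE; rewrite eE /L.
have := lerD p1 p2; lra.
Qed.

Lemma cont2_lip_comp (phi : R -> R) F x y : (forall s t, `|phi s - phi t| <= `|s - t|) ->
  cont2 F x y -> cont2 (fun x y => phi (F x y)) x y.
Proof.
move=> lphi hF e e0; have [r r0 {}hF] := hF _ e0; exists r => // h k h1 k1.
exact: le_trans (lphi _ _) (hF _ _ h1 k1).
Qed.

Lemma cont2_eq F G x y r : 0 < r ->
  (forall h k, `|h| <= r -> `|k| <= r -> F (x + h) (y + k) = G (x + h) (y + k)) ->
  cont2 F x y -> cont2 G x y.
Proof.
move=> r0 FG hF e e0; have [d d0 hd] := hF e e0.
exists (Num.min r d); first by rewrite lt_min r0.
move=> h k; rewrite !le_min => /andP[h1 h2] /andP[k1 k2].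
have := FG 0 0; rewrite normr0 !addr0 => <-; [|exact: ltW..].
by rewrite -FG//; exact: hd.
Qed.
End Cont2.

Section MeanValue.
Variable R : realType.
Local Notation R1 := (measurableTypeR R).
Local Notation R2 := (R1 * R1)%type.
Local Notation lam1 := (@lebesgue_measure R).
Local Notation lam2 := (@lebesgue2 R).

Definition sqd (a1 a2 x y : R) : R := (x - a1) ^+ 2 + (y - a2) ^+ 2.

Lemma sqd_ge0 a1 a2 x y : 0 <= sqd a1 a2 x y.
Proof. by rewrite addr_ge0// sqr_ge0. Qed.

Lemma sqd_expansion a1 a2 x y :
  expansion2 (sqd a1 a2) x y (2 * (x - a1)) (2 * (y - a2)).
Proof.
have h1 := expansion2_fst a1 x y; have h2 := expansion2_snd a2 x y.
have -> : sqd a1 a2 = (fun x y => (x - a1) * (x - a1) + (y - a2) * (y - a2)).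
  by apply/funext => x'; apply/funext => y'; rewrite /sqd !expr2.
have := expansion2_add (expansion2_mul h1 h1) (expansion2_mul h2 h2).
by congr (expansion2 _ _ _ _ _); ring.
Qed.

Lemma sqd_cont a1 a2 x y : cont2 (sqd a1 a2) x y.
Proof. exact: expansion2_cont2 (sqd_expansion a1 a2 x y). Qed.

Lemma sqd_far a1 a2 rho x y : rho < sqd a1 a2 x y -> exists2 r, 0 < r &
  forall h k, `|h| <= r -> `|k| <= r -> rho <= sqd a1 a2 (x + h) (y + k).
Proof.
move=> hs; have e0 : 0 < sqd a1 a2 x y - rho by rewrite subr_gt0.
have [r r0 hr] := @sqd_cont a1 a2 x y _ e0.
by exists r => // h k h1 k1; have := hr _ _ h1 k1; rewrite ler_norml; lra.
Qed.

Lemma sqd_near a1 a2 rho x y : sqd a1 a2 x y <= rho ->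
  `|x - a1| <= 1 + rho /\ `|y - a2| <= 1 + rho.
Proof.
rewrite /sqd => h; have := sqr_ge0 (x - a1); have := sqr_ge0 (y - a2).
rewrite !ler_norml; nra.
Qed.

Lemma restrict_supp (T : Type) (A : set T) (f : T -> R) :
  (forall p, ~ A p -> f p = 0) -> f \_ A = f.
Proof.
by move=> h; apply/funext => p; rewrite /patch; case: ifPn => //; rewrite notin_setE => /h.
Qed.

Lemma integrable_supp (f : R2 -> R) M a c s : 0 < s ->
  measurable_fun setT (f : R2 -> R1) -> (forall p, `|f p| <= M) ->
  (forall p, ~ square a c s p -> f p = 0) -> lam2.-integrable setT (EFin \o f).
Proof.
move=> s0 mf fM f0.
have mS := measurable_square a c s.
have := @bounded_measurable_integrable _ _ _ lam2 _ mS (lam2_square_lty a c s0) f M mf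
  (fun p _ => fM p).
move=> /(integrable_mkcond _ mS).
by rewrite restrict_EFin restrict_supp.
Qed.

Section Tent.
Variables (u v : R -> R -> R) (a1 a2 rho0 : R).
Hypothesis CR : forall x y, sqd a1 a2 x y < rho0 -> exists al be,
  expansion2 u x y al (- be) /\ expansion2 v x y be al.

Let X (x y : R) := x - a1.
Let Y (x y : R) := y - a2.
Variables (eps rho M : R).
Hypothesis eps_gt0 : 0 < eps.
Hypothesis eps_rho : eps <= rho.
Hypothesis rho_rho0 : rho < rho0.
Hypothesis uM : forall x y, sqd a1 a2 x y <= rho -> `|u x y| <= M.
Hypothesis vM : forall x y, sqd a1 a2 x y <= rho -> `|v x y| <= M.
Let rho_gt0 : 0 < rho. Proof. exact: lt_le_trans eps_gt0 eps_rho. Qed.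
Let M_ge0 : 0 <= M.
Proof.
apply: le_trans (normr_ge0 (u a1 a2)) (uM _).
by rewrite /sqd !subrr expr0n/= addr0 ltW.
Qed.

Let Q (x y : R) := tentq rho (sqd a1 a2 x y) - tentq eps (sqd a1 a2 x y).
Let T (x y : R) := tent rho (sqd a1 a2 x y) / rho ^+ 2 - tent eps (sqd a1 a2 x y) / eps ^+ 2.
(* P + i S = Q (u - i v) (z - a) with Q radial: its divergence is 2 u (s Q)'(s) at
   s = |z - a|^2, since the Cauchy-Riemann equations cancel the derivatives of u
   and v; (s Q)' is the difference T of the two normalized tents. *)
Let P x y := (u x y * X x y + v x y * Y x y) * Q x y.
Let S x y := (u x y * Y x y - v x y * X x y) * Q x y.
Let g x y := 2 * u x y * T x y.

Let Q0 x y : rho <= sqd a1 a2 x y -> Q x y = 0.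
Proof. by move=> h; rewrite /Q (tentq_far (eps:=eps) _ h) ?subrr// eps_gt0. Qed.

Let T0 x y : rho <= sqd a1 a2 x y -> T x y = 0.
Proof.
move=> h; rewrite /T /tent !max_l ?mul0r ?subrr// subr_le0//.
exact: le_trans eps_rho h.
Qed.

Let PS_exp x y : exists a b c d,
  [/\ expansion2 P x y a b, expansion2 S x y c d & a + d = g x y].
Proof.
have [h|h] := ltP (sqd a1 a2 x y) rho0; last first.
  have [r r0 hr] := sqd_far (lt_le_trans rho_rho0 h).
  exists 0, 0, 0, 0; split.
  - apply: (expansion2_eq r0 _ (expansion2_cst 0 x y)) => h' k' hh kk.
    by rewrite /P Q0 ?mulr0//; exact: hr.
  - apply: (expansion2_eq r0 _ (expansion2_cst 0 x y)) => h' k' hh kk.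
    by rewrite /S Q0 ?mulr0//; exact: hr.
  - by rewrite /g T0 ?mulr0 ?addr0// ltW// (lt_le_trans rho_rho0 h).
have [al [be [hu hv]]] := CR h.
have hX := expansion2_fst a1 x y; have hY := expansion2_snd a2 x y.
have hQ := expansion2_add
  (expansion2_comp (sqd_expansion a1 a2 x y) (tentq_expansion _ rho_gt0))
  (expansion2_opp
  (expansion2_comp (sqd_expansion a1 a2 x y) (tentq_expansion _ eps_gt0))).
have hP := expansion2_mul (expansion2_add (expansion2_mul hu hX) (expansion2_mul hv hY)) hQ.
have hS := expansion2_mul (expansion2_add (expansion2_mul hu hY)
   (expansion2_opp (expansion2_mul hv hX))) hQ.
do 4 eexists; split; [exact: hP|exact: hS|].
rewrite /g /T -!tentqE//; rewrite /sqd; ring.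
Qed.

Let u_tent_cont r x y : r <= rho ->
  cont2 (fun x y => u x y * tent r (sqd a1 a2 x y)) x y.
Proof.
move=> rr; have [h|h] := ltP (sqd a1 a2 x y) rho0.
  have [al [be [hu hv]]] := CR h.
  apply: cont2_mul; first exact: expansion2_cont2 hu.
  by apply: cont2_lip_comp; [exact: tent_lip|exact: sqd_cont].
have [d d0 hd] := sqd_far (lt_le_trans rho_rho0 h).
apply: (cont2_eq d0 _ (expansion2_cont2 (expansion2_cst 0 x y))) => h' k' hh kk.
rewrite /tent max_l ?mulr0// subr_le0.
exact: le_trans rr (hd _ _ hh kk).
Qed.

Let u_tent_bound r x y : 0 < r <= rho -> `|u x y * tent r (sqd a1 a2 x y)| <= M * rho.
Proof.
move=> /andP[r0 rr]; have s0 := sqd_ge0 a1 a2 x y.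
have [h|h] := leP (sqd a1 a2 x y) rho.
  rewrite normrM ler_pM//; first exact: uM.
  rewrite ger0_norm ?tent_ge0// /tent ge_max (ltW rho_gt0)/=; lra.
rewrite /tent max_l ?mulr0 ?normr0 ?mulr_ge0 ?(ltW rho_gt0)//; lra.
Qed.

Let N := 1 + rho.
Let sq := square (a1 - N) (a2 - N) (2 * N).
Let N0 : 0 < 2 * N. Proof. rewrite /N; have := rho_gt0; lra. Qed.

Let out_sq (p : R2) : ~ sq p -> rho <= sqd a1 a2 p.1 p.2.
Proof.
case: p => x y /= h; rewrite leNgt; apply/negP => hs; apply: h.
have := sqr_ge0 (x - a1); have := sqr_ge0 (y - a2); move: hs; rewrite /sqd => hs h1 h2.
rewrite /sq /square /seg /= !in_itv/= /N.
have r0 := rho_gt0.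
split; nra.
Qed.

Lemma tent_integrable r : 0 < r <= rho -> lam2.-integrable setT
  (EFin \o (fun p : R2 => u p.1 p.2 * tent r (sqd a1 a2 p.1 p.2))).
Proof.
move=> /andP[r0 rr]; apply: (@integrable_supp _ (M * rho) (a1 - N) (a2 - N) (2 * N)) => //.
- apply: (@cont2_measurable R (fun x y => u x y * tent r (sqd a1 a2 x y))).
  by move=> x y; exact: u_tent_cont.
- by move=> p; apply: u_tent_bound; rewrite r0.
- move=> p /out_sq h; rewrite /tent max_l ?mulr0// subr_le0.
  exact: le_trans rr h.
Qed.

(** The tent average of u over a disc does not depend on the radius: the field
    above has compact support, so its divergence integrates to zero, and this
    divergence is the difference of the two normalized averages. *)
Lemma tent_scale_integral :
  eps ^+ 2 * \int[lam2]_p (u p.1 p.2 * tent rho (sqd a1 a2 p.1 p.2)) =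
  rho ^+ 2 * \int[lam2]_p (u p.1 p.2 * tent eps (sqd a1 a2 p.1 p.2)).
Proof.
have er : 0 < eps <= rho by rewrite eps_gt0.
have rr : 0 < rho <= rho by rewrite rho_gt0 lexx.
pose K := 4 * M * (1 + rho) * (rho^-1 + eps^-1).
have Qb x y : sqd a1 a2 x y <= rho -> `|Q x y| <= rho^-1 + eps^-1.
  move=> h; have b (r t : R) : 0 < r -> 0 <= t -> 0 <= tentq r t <= r^-1.
    move=> r0 t0; rewrite /tentq; case: ifPn => [tr|]; last first.
      rewrite -ltNge => tr; have t1 : 0 < t by exact: lt_trans tr.
      rewrite invr_ge0 lef_pV2 ?posrE ?mulr_gt0//; lra.
    have h2 : 0 <= t / (2 * r) <= 1.
      by rewrite divr_ge0 ?mulr_ge0 ?(ltW r0)//= ler_pdivrMr ?mulr_gt0//; lra.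
    by rewrite divr_ge0 ?(ltW r0)//= ?ler_pdivrMr// ?mulVf ?gt_eqF//; lra.
  have := b rho _ rho_gt0 (sqd_ge0 a1 a2 x y).
  have := b eps _ eps_gt0 (sqd_ge0 a1 a2 x y).
  rewrite /Q ler_norml; lra.
have PSb w z x y : `|w| <= M -> `|z| <= M -> sqd a1 a2 x y <= rho ->
   `|(w * X x y + z * Y x y) * Q x y| <= K.
  move=> hw hz hs; have [hX hY] := sqd_near hs.
  have -> : K = (M * (1 + rho) + M * (1 + rho)) * (2 * (rho^-1 + eps^-1)) by rewrite /K; ring.
  rewrite normrM ler_pM//.
    by apply: le_trans (ler_normD _ _) _; rewrite !normrM lerD// ler_pM.
  have := Qb _ _ hs; have := normr_ge0 (Q x y); lra.
have K0 : 0 <= K.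
  have r0 := rho_gt0; have i1 : 0 < rho^-1 by rewrite invr_gt0.
  have i2 : 0 < eps^-1 by rewrite invr_gt0.
  by rewrite /K !mulr_ge0//; have := M_ge0; lra.
have Pb x y : `|P x y| <= K.
  have [h|h] := leP (sqd a1 a2 x y) rho.
    by apply: PSb => //; [exact: uM|exact: vM].
  by rewrite /P (Q0 (ltW h)) mulr0 normr0.
have Sb x y : `|S x y| <= K.
  have [h|h] := leP (sqd a1 a2 x y) rho; last by rewrite /S (Q0 (ltW h)) mulr0 normr0.
  have hv : `|- v x y| <= M by rewrite normrN; exact: vM.
  have := PSb _ _ _ _ hv (uM h) h.
  by congr (`|_ * _| <= _); ring.
pose L := 2 * (M * rho / rho ^+ 2 + M * rho / eps ^+ 2).
have gE x y : g x y = 2 * (u x y * tent rho (sqd a1 a2 x y) / rho ^+ 2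
   - u x y * tent eps (sqd a1 a2 x y) / eps ^+ 2) by rewrite /g /T; ring.
have gb x y : `|g x y| <= L.
  rewrite gE normrM gtr0_norm// /L ler_wpM2l//.
  have aux (w t : R) : `|w| <= M * rho -> 0 < t -> `|w / t| <= M * rho / t.
    by move=> hw ht; rewrite normrM (gtr0_norm (_ : 0 < t^-1)) ?invr_gt0// ler_pM2r ?invr_gt0.
  apply: le_trans (ler_normB _ _) _.
  by apply: lerD; apply: aux; rewrite ?exprn_gt0//; exact: u_tent_bound.
have gc x y : cont2 g x y.
  have -> : g = fun x y => (2 / rho ^+ 2) * (u x y * tent rho (sqd a1 a2 x y))
      + (- 2 / eps ^+ 2) * (u x y * tent eps (sqd a1 a2 x y)).
    by apply/funext => x'; apply/funext => y'; rewrite gE; ring.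
  by apply: cont2_lin; apply: u_tent_cont.
have L0 : 0 <= L by apply: le_trans (normr_ge0 _) (gb 0 0).
have PbL x y : `|P x y| <= K + L by rewrite (le_trans (Pb x y))// lerDl.
have SbL x y : `|S x y| <= K + L by rewrite (le_trans (Sb x y))// lerDl.
have gbL x y : `|g x y| <= K + L by rewrite (le_trans (gb x y))// lerDr.
have := divergence_square PS_exp gc PbL SbL gbL (a1 - N) (a2 - N) N0.
have zero (f : R -> R) c s : (forall x, f x = 0) -> \int[lam1]_(x in seg c s) f x = 0.
  move=> h; have -> : f = fun=> 0 by apply/funext.
  by rewrite Rintegral_cst ?mul0r//; exact: measurable_seg.
(* on the boundary of the square the field vanishes, so that there is no flux *)
have far1 x y : (x - a1) ^+ 2 = N ^+ 2 -> rho <= sqd a1 a2 x y.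
  by move=> e; rewrite /sqd e /N; have := sqr_ge0 (y - a2); have := rho_gt0; nra.
have far2 x y : (y - a2) ^+ 2 = N ^+ 2 -> rho <= sqd a1 a2 x y.
  by move=> e; rewrite /sqd e /N; have := sqr_ge0 (x - a1); have := rho_gt0; nra.
rewrite !zero ?subrr ?addr0.
- have -> : \int[lam2]_(p in square (a1 - N) (a2 - N) (2 * N)) g p.1 p.2 =
      \int[lam2]_p (2 / rho ^+ 2 * (u p.1 p.2 * tent rho (sqd a1 a2 p.1 p.2))
      - 2 / eps ^+ 2 * (u p.1 p.2 * tent eps (sqd a1 a2 p.1 p.2))).
    rewrite Rintegral_mkcond restrict_supp.
      by apply: eq_Rintegral => p _; rewrite gE; ring.
    by move=> p /out_sq h; rewrite /g T0 ?mulr0.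
  have i1 := tent_integrable rr; have i2 := tent_integrable er.
  rewrite RintegralB//; last 2 first.
  - exact: (integrableZl _ _ i1).
  - exact: (integrableZl _ _ i2).
  rewrite !RintegralZl// => h.
  have r2 : rho ^+ 2 != 0 by rewrite gt_eqF// exprn_gt0.
  have e2 : eps ^+ 2 != 0 by rewrite gt_eqF// exprn_gt0.
  set I1 := (\int[lam2]_p (u p.1 p.2 * tent rho _)) in h *.
  set I2 := (\int[lam2]_p (u p.1 p.2 * tent eps _)) in h *.
  have : eps ^+ 2 * rho ^+ 2 * (2 / rho ^+ 2 * I1 - 2 / eps ^+ 2 * I2) = 0 by rewrite -h subrr mulr0.
  have -> : eps ^+ 2 * rho ^+ 2 * (2 / rho ^+ 2 * I1 - 2 / eps ^+ 2 * I2) =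
    2 * (eps ^+ 2 * I1 - rho ^+ 2 * I2) by field; rewrite (gt_eqF eps_gt0) (gt_eqF rho_gt0).
  lra.
- by move=> x; rewrite /S Q0 ?mulr0//; apply: far2; ring.
- by move=> x; rewrite /S Q0 ?mulr0//; apply: far2; ring.
- by move=> x; rewrite /P Q0 ?mulr0//; apply: far1; ring.
- by move=> x; rewrite /P Q0 ?mulr0//; apply: far1; ring.
Qed.
End Tent.
End MeanValue.

(** * The mean value property *)

Section TentConstant.
Variable R : realType.
Local Notation R1 := (measurableTypeR R).
Local Notation R2 := (R1 * R1)%type.
Local Notation lam2 := (@lebesgue2 R).

Let one (x y : R) : R := 1.
Let zero (x y : R) : R := 0.
Let oneCR a1 a2 rho x y : sqd a1 a2 x y < rho -> exists al be,
  expansion2 one x y al (- be) /\ expansion2 zero x y be al.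
Proof.
by exists 0, 0; rewrite oppr0; split; exact: expansion2_cst.
Qed.

Lemma tent1_integrable (a1 a2 rho : R) : 0 < rho -> lam2.-integrable setT
  (EFin \o (fun p : R2 => tent rho (sqd a1 a2 p.1 p.2))).
Proof.
move=> r0; have rr : 0 < rho <= rho by rewrite r0 lexx.
have r1 : rho < rho + 1 by lra.
have -> : (fun p : R2 => tent rho (sqd a1 a2 p.1 p.2)) =
    (fun p : R2 => one p.1 p.2 * tent rho (sqd a1 a2 p.1 p.2)).
  by apply/funext => p; rewrite /one mul1r.
exact: (@tent_integrable R one zero a1 a2 (rho + 1) (@oneCR a1 a2 (rho + 1)) rho rho 1
  r0 (lexx _) r1 (fun x y _ => ltac:(by rewrite normr1))).
Qed.

Definition tentI a1 a2 rho : R := \int[lam2]_p (tent rho (sqd a1 a2 p.1 p.2)).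

(** The independence of the radius, for the constant function 1. *)
Lemma tentI_scale a1 a2 rho : 0 < rho -> tentI a1 a2 rho = rho ^+ 2 * tentI a1 a2 1.
Proof.
have key e r : 0 < e -> e <= r -> e ^+ 2 * tentI a1 a2 r = r ^+ 2 * tentI a1 a2 e.
  move=> e0 er; have r1 : r < r + 1 by lra.
  have := @tent_scale_integral R one zero a1 a2 (r + 1) (@oneCR a1 a2 (r + 1)) e r 1
    e0 er r1 (fun x y _ => ltac:(by rewrite normr1))
    (fun x y _ => ltac:(by rewrite normr0)).
  rewrite /one /tentI.
  by under eq_Rintegral do rewrite mul1r; under [in RHS]eq_Rintegral do rewrite mul1r.
move=> r0; have [h|h] := leP 1 rho.
  by have := key _ _ ltr01 h; rewrite expr1n mul1r.
by have := key _ _ r0 (ltW h); rewrite expr1n mul1r.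
Qed.

Lemma tentI_ge0 a1 a2 rho : 0 <= tentI a1 a2 rho.
Proof. by apply: Rintegral_ge0 => p _; exact: tent_ge0. Qed.

(** Independence of the centre without a change of variables: seen at a large
    radius two centres are at negligible distance, and the scaling law brings the
    comparison back to radius 1. *)
Lemma tentI_shift_le a1 a2 b1 b2 : tentI b1 b2 1 <= tentI a1 a2 1.
Proof.
set A := tentI a1 a2 1; set B := tentI b1 b2 1.
have A0 : 0 <= A by exact: tentI_ge0.
have B0 : 0 <= B by exact: tentI_ge0.
pose D := sqd a1 a2 b1 b2; have D0 : 0 <= D by exact: sqd_ge0.
have key t : 0 < t -> t < 1 -> B * (1 - t) ^+ 2 <= A * (1 + t).
  move=> t0 t1.
  (* |x - a|^2 <= (1 + t) |x - b|^2 + (1 + 1/t) |b - a|^2 bounds one tent by the other *)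
  pose C := (1 + t^-1) * D.
  have C0 : 0 <= C by rewrite mulr_ge0// addr_ge0// invr_ge0 ltW.
  pose rho := (C + 1) / t.
  have rho0 : 0 < rho by rewrite divr_gt0//; lra.
  pose sg := (rho - C) / (1 + t).
  have rt : rho * t = C + 1 by rewrite /rho divfK// gt_eqF.
  have rC : 0 < rho - C by nra.
  have sg0 : 0 < sg by rewrite divr_gt0//; lra.
  have pw (p : R2) : (1 + t) * tent sg (sqd b1 b2 p.1 p.2) <= tent rho (sqd a1 a2 p.1 p.2).
    have hd : sqd a1 a2 p.1 p.2 <= (1 + t) * sqd b1 b2 p.1 p.2 + C.
      have one_dim (x a b : R) :
         (x - a) ^+ 2 <= (1 + t) * (x - b) ^+ 2 + (1 + t^-1) * (b - a) ^+ 2.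
        have -> : (x - a) ^+ 2 = (1 + t) * (x - b) ^+ 2 + (1 + t^-1) * (b - a) ^+ 2
            - t^-1 * (t * (x - b) - (b - a)) ^+ 2 by field; rewrite gt_eqF.
        by rewrite lerBlDr lerDl mulr_ge0 ?sqr_ge0// invr_ge0 ltW.
      have := one_dim p.1 a1 b1; have := one_dim p.2 a2 b2.
      rewrite /C /D /sqd; lra.
    have sgE : (1 + t) * sg = rho - C by rewrite /sg mulrC divfK// gt_eqF//; lra.
    rewrite /tent; case: (leP 0 (sg - sqd b1 b2 p.1 p.2)) => h.
      rewrite le_max; apply/orP; right; rewrite mulrBr sgE; lra.
    by rewrite mulr0 le_max lexx.
  have : (1 + t) * tentI b1 b2 sg <= tentI a1 a2 rho.
    have ib := tent1_integrable b1 b2 sg0; have ia := tent1_integrable a1 a2 rho0.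
    rewrite /tentI -RintegralZl//; apply: le_Rintegral => //.
    exact: (integrableZl _ _ ib).
  rewrite (tentI_scale b1 b2 sg0) (tentI_scale a1 a2 rho0) -/A -/B => h.
  have sgE : (1 + t) * (sg ^+ 2 * B) = (rho - C) ^+ 2 * B / (1 + t).
    by rewrite /sg; field; lra.
  rewrite sgE ler_pdivrMr in h; last lra.
  have r1 : rho * (1 - t) <= rho - C by lra.
  have : (rho * (1 - t)) ^+ 2 * B <= rho ^+ 2 * A * (1 + t).
    apply: le_trans h; apply: ler_wpM2r => //.
    have k0 : 0 <= rho * (1 - t) by rewrite mulr_ge0 ?ltW//; lra.
    by rewrite ler_pXn2r// nnegrE ltW.
  have -> : (rho * (1 - t)) ^+ 2 * B = rho ^+ 2 * (B * (1 - t) ^+ 2) by ring.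
  have -> : rho ^+ 2 * A * (1 + t) = rho ^+ 2 * (A * (1 + t)) by ring.
  by rewrite ler_pM2l ?exprn_gt0.
rewrite leNgt; apply/negP => AB.
have Bp : 0 < B by exact: le_lt_trans AB.
pose t := (B - A) / (4 * B).
have tB : t * (4 * B) = B - A by rewrite /t divfK// gt_eqF// mulr_gt0.
have t0 : 0 < t by rewrite divr_gt0 ?subr_gt0// mulr_gt0.
have t1 : t < 1 by nra.
have := key t t0 t1; nra.
Qed.

(** This number is pi / 2. *)
Definition tentc : R := tentI 0 0 1.

Lemma tentIE a1 a2 rho : 0 < rho -> tentI a1 a2 rho = rho ^+ 2 * tentc.
Proof.
move=> r0; rewrite tentI_scale//; congr (_ * _); apply/eqP.
by rewrite eq_le !tentI_shift_le.
Qed.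

Lemma tentc_gt0 : 0 < tentc.
Proof.
have s0 : 0 < (1 : R) by [].
have mS := measurable_square (- 2^-1 : R) (- 2^-1) 1.
have fS := lam2_square_lty (- 2^-1 : R) (- 2^-1) s0.
have ti := tent1_integrable 0 0 (ltr01 : 0 < (1 : R)).
have h1 : `|\int[lam2]_(p in square (- 2^-1) (- 2^-1) 1) (tent 1 (sqd 0 0 p.1 p.2)) - 3 / 4 * 1| <= 1 / 4 * 1.
  apply: (@Rintegral_near_cst _ _ _ lam2 _ mS fS (fun p : R2 => tent 1 (sqd 0 0 p.1 p.2))).
  - by apply: etrans (lam2_square _ _ s0) _; rewrite expr1n.
  - exact: (integrableS measurableT mS (@subsetT _ _) ti).
  move=> [x y] []; rewrite /seg /= !in_itv/= => hx hy.
  have : 0 <= sqd 0 0 x y <= 2^-1 by rewrite sqd_ge0 /sqd !subr0; nra.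
  by move=> /andP[q1 q2]; rewrite /tent max_r ?ler_norml; lra.
suff : \int[lam2]_(p in square (- 2^-1) (- 2^-1) 1) (tent 1 (sqd 0 0 p.1 p.2)) <= tentc.
  by move: h1; rewrite ler_norml; lra.
rewrite Rintegral_mkcond /tentc /tentI; apply: le_Rintegral => //.
- rewrite -restrict_EFin.
  apply/(integrable_mkcond _ mS).
  exact: (integrableS measurableT mS (@subsetT _ _) ti).
- by move=> p _; rewrite /patch; case: ifPn => // _; exact: tent_ge0.
Qed.

Lemma tent_integral (a1 a2 rho : R) : 0 < rho ->
  (\int[lam2]_p (tent rho (sqd a1 a2 p.1 p.2))%:E)%E = (rho ^+ 2 * tentc)%:E.
Proof.
move=> r0; rewrite -(tentIE a1 a2 r0) /tentI /Rintegral fineK//.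
exact: (integrable_fin_num _ (tent1_integrable a1 a2 r0)).
Qed.
End TentConstant.

Section MeanValueProperty.
Variable R : realType.
Local Notation R1 := (measurableTypeR R).
Local Notation R2 := (R1 * R1)%type.
Local Notation lam2 := (@lebesgue2 R).
Variables (u v : R -> R -> R) (a1 a2 rho0 : R).
Hypothesis CR : forall x y, sqd a1 a2 x y < rho0 -> exists al be,
  expansion2 u x y al (- be) /\ expansion2 v x y be al.
Variables (rho M : R).
Hypothesis rho_gt0 : 0 < rho.
Hypothesis rho_rho0 : rho < rho0.
Hypothesis uM : forall x y, sqd a1 a2 x y <= rho -> `|u x y| <= M.
Hypothesis vM : forall x y, sqd a1 a2 x y <= rho -> `|v x y| <= M.

(** The tent averages do not depend on the radius and tend to the value at the
    centre as the radius shrinks. *)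
Theorem mean_value : \int[lam2]_p (u p.1 p.2 * tent rho (sqd a1 a2 p.1 p.2)) =
  rho ^+ 2 * tentc R * u a1 a2.
Proof.
set I := LHS; pose c := tentc R; have c0 : 0 < c by exact: tentc_gt0.
have r2 : 0 < rho ^+ 2 by rewrite exprn_gt0.
have key e : 0 < e -> `|I - rho ^+ 2 * c * u a1 a2| <= e * (rho ^+ 2 * c).
  move=> e0.
  have aa : sqd a1 a2 a1 a2 < rho0.
    by rewrite /sqd !subrr expr0n/= addr0 (lt_trans rho_gt0).
  have [al [be [hu _]]] := CR aa.
  have [d d0 hd] := expansion2_cont2 hu e0.
  pose r := Num.min rho (d ^+ 2).
  have r0 : 0 < r by rewrite lt_min rho_gt0 exprn_gt0.
  have rr : r <= rho by rewrite ge_min lexx.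
  have rd : r <= d ^+ 2 by rewrite ge_min lexx orbT.
  have q0 : 0 < r ^+ 2 by rewrite exprn_gt0.
  have scale := tent_scale_integral CR r0 rr rho_rho0 uM vM.
  have ui : lam2.-integrable setT
      (EFin \o (fun p : R2 => u p.1 p.2 * tent r (sqd a1 a2 p.1 p.2))).
    by apply: (tent_integrable CR r0 rr rho_rho0 uM); rewrite r0.
  have ti := tent1_integrable a1 a2 r0.
  have near_a (p : R2) : `|(u p.1 p.2 - u a1 a2) * tent r (sqd a1 a2 p.1 p.2)|
       <= e * tent r (sqd a1 a2 p.1 p.2).
    have t0 := tent_ge0 r (sqd a1 a2 p.1 p.2).
    rewrite normrM (ger0_norm t0).
    have [h|h] := leP (sqd a1 a2 p.1 p.2) r; last first.
      by rewrite /tent max_l ?mulr0//; lra.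
    rewrite ler_wpM2r//.
    have := hd (p.1 - a1) (p.2 - a2); rewrite !subrKC; apply.
      rewrite -(ler_pXn2r (_ : 0 < 2)%N) ?nnegrE ?(ltW d0)// real_normK ?num_real//.
      have := sqr_ge0 (p.2 - a2); move: h; rewrite /sqd; lra.
    rewrite -(ler_pXn2r (_ : 0 < 2)%N) ?nnegrE ?(ltW d0)// real_normK ?num_real//.
    have := sqr_ge0 (p.1 - a1); move: h; rewrite /sqd; lra.
  pose I' := \int[lam2]_p (u p.1 p.2 * tent r (sqd a1 a2 p.1 p.2)).
  have : `|I' - r ^+ 2 * c * u a1 a2| <= e * (r ^+ 2 * c).
    rewrite -(tentIE a1 a2 r0) /tentI.
    have ti' k := integrableZl measurableT k ti.
    rewrite -RintegralZl// -RintegralZr//.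
    rewrite /I' -RintegralB//; last first.
      have := ti' (u a1 a2); congr (lebesgue_integrable.integrable _ _ _ = _).
      by apply/funext => p /=; rewrite mulrC.
    have di : lam2.-integrable setT (EFin \o (fun p : R2 =>
        u p.1 p.2 * tent r (sqd a1 a2 p.1 p.2) - tent r (sqd a1 a2 p.1 p.2) * u a1 a2)).
      have := integrableB measurableT ui (ti' (u a1 a2)).
      congr (lebesgue_integrable.integrable _ _ _ = _).
      by apply/funext => p /=; rewrite EFinB EFinM mulrC.
    apply: le_trans (le_normr_Rintegral measurableT di) _.
    apply: le_Rintegral => //.
    - exact: integrable_norm di.
    - exact: ti'.
    move=> p _; rewrite [tent r _ * u a1 a2]mulrC -mulrBl; exact: near_a.
  move=> h; rewrite -(ler_pM2l q0).
  have -> : r ^+ 2 * `|I - rho ^+ 2 * c * u a1 a2| =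
      rho ^+ 2 * `|I' - r ^+ 2 * c * u a1 a2|.
    transitivity `|r ^+ 2 * (I - rho ^+ 2 * c * u a1 a2)|.
      by rewrite normrM (gtr0_norm q0).
    have -> : r ^+ 2 * (I - rho ^+ 2 * c * u a1 a2) =
        rho ^+ 2 * (I' - r ^+ 2 * c * u a1 a2) by rewrite !mulrBr scale /I'; ring.
    by rewrite normrM (gtr0_norm r2).
  have -> : r ^+ 2 * (e * (rho ^+ 2 * c)) = rho ^+ 2 * (e * (r ^+ 2 * c)) by ring.
  by rewrite ler_pM2l.
apply/eqP; rewrite -subr_eq0 -normr_le0 leNgt; apply/negP => n0.
have k0 : 0 < rho ^+ 2 * c by rewrite mulr_gt0.
have := key (`|I - rho ^+ 2 * c * u a1 a2| / (2 * (rho ^+ 2 * c))).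
rewrite divr_gt0// ?mulr_gt0// => /(_ isT).
have -> : `|I - rho ^+ 2 * c * u a1 a2| / (2 * (rho ^+ 2 * c)) * (rho ^+ 2 * c)
  = `|I - rho ^+ 2 * c * u a1 a2| / 2.
  by field; rewrite !gt_eqF.
lra.
Qed.
End MeanValueProperty.

(** * Complex differentiability *)

Local Open Scope complex_scope.

Section ComplexBasics.
Variable R : realType.
Local Notation C := (CC R).
Local Notation C2 := (CC2 R).
Local Notation cRe := (@complex.Re R).
Local Notation cIm := (@complex.Im R).
Implicit Types z w h : C.

Lemma cnormE z : `|z| = (cabs z)%:C.
Proof. by []. Qed.

Lemma cabs_ge0 z : 0 <= cabs z.
Proof. by case: z => a b; exact: sqrtr_ge0. Qed.

Lemma cabsM z w : cabs (z * w) = cabs z * cabs w.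
Proof. exact: ComplexField.Normc.normcM. Qed.

Lemma cabs0 : cabs (0 : C) = 0.
Proof. exact: ComplexField.Normc.normc0. Qed.

Lemma cabs1 : cabs (1 : C) = 1.
Proof. exact: ComplexField.Normc.normc1. Qed.

Lemma cabs0_eq0 z : cabs z = 0 -> z = 0.
Proof. exact: ComplexField.Normc.eq0_normc. Qed.

Lemma cabsV z : cabs (z^-1) = (cabs z)^-1.
Proof. exact: ComplexField.Normc.normcV. Qed.

Lemma cabsX z n : cabs (z ^+ n) = cabs z ^+ n.
Proof. by elim: n => [|n IH]; [exact: cabs1|rewrite !exprS cabsM IH]. Qed.

Lemma cabsN z : cabs (- z) = cabs z.
Proof. exact: normcN. Qed.

Lemma cabsD z w : cabs (z + w) <= cabs z + cabs w.
Proof. exact: le_normcD. Qed.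

Lemma cabsB z w : cabs (z - w) <= cabs z + cabs w.
Proof. by rewrite -(cabsN w) cabsD. Qed.

Lemma cabs_conj z : cabs (z^*) = cabs z.
Proof. by case: z => x y; rewrite /cabs/= sqrrN. Qed.

Lemma cabs_distrC z w : cabs (z - w) = cabs (w - z).
Proof. by rewrite -cabsN opprB. Qed.

Lemma cabs_triangle z w : cabs z - cabs w <= cabs (z - w).
Proof. by rewrite lerBlDr -{1}(subrK w z) cabsD. Qed.

Lemma cabs_sqr z : cabs z ^+ 2 = cRe z ^+ 2 + cIm z ^+ 2.
Proof. by case: z => a b; rewrite /cabs/= sqr_sqrtr// addr_ge0 ?sqr_ge0. Qed.

Lemma Re_le_cabs z : `|cRe z| <= cabs z.
Proof.
rewrite -(ler_pXn2r (_ : 0 < 2)%N) ?nnegrE ?cabs_ge0// cabs_sqr real_normK ?num_real//.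
by rewrite lerDl sqr_ge0.
Qed.

Lemma Im_le_cabs z : `|cIm z| <= cabs z.
Proof.
rewrite -(ler_pXn2r (_ : 0 < 2)%N) ?nnegrE ?cabs_ge0// cabs_sqr real_normK ?num_real//.
by rewrite lerDr sqr_ge0.
Qed.

Lemma cabs_le z : cabs z <= `|cRe z| + `|cIm z|.
Proof.
rewrite -(ler_pXn2r (_ : 0 < 2)%N) ?nnegrE ?cabs_ge0 ?addr_ge0// cabs_sqr.
rewrite -(real_normK (num_real (cRe z))) -(real_normK (num_real (cIm z))) sqrrD.
by rewrite -addrA (addrC (_ *+ 2)) addrA lerDl mulrn_wge0// mulr_ge0.
Qed.

Lemma cabs_real (x : R) : cabs (x%:C : C) = `|x|.
Proof. by rewrite /cabs/= expr0n/= addr0 sqrtr_sqr. Qed.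

Lemma cabs_gt0 z : z != 0 -> 0 < cabs z.
Proof.
move=> z0; rewrite lt_neqAle cabs_ge0 andbT eq_sym.
by apply: contra_neq z0; exact: cabs0_eq0.
Qed.

Lemma pos_complexE (e : R[i]) : 0 < e -> e = (cRe e)%:C /\ 0 < cRe e.
Proof. by case: e => a b; rewrite ltcE/= => /andP[/eqP-> ?]. Qed.

Lemma ltc_cabs z (d : R) : (`|z| < d%:C) = (cabs z < d).
Proof. by rewrite cnormE ltcR. Qed.

Lemma norm_pairE (p : C2) : `|p| = (Num.max (cabs p.1) (cabs p.2))%:C.
Proof.
rewrite prod_normE !cnormE /Order.max ltcR.
by case: ifP.
Qed.

Lemma near0_C (P : C -> Prop) : nbhs (0 : C) P <->
  exists2 d : R, 0 < d & forall h, cabs h <= d -> P h.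
Proof.
split=> [/nbhs_norm0P[e /= e0 he]|[d d0 hd]].
  have [eE e1] := pos_complexE e0.
  exists (cRe e / 2); first by rewrite divr_gt0.
  by move=> h hh; apply: he => /=; rewrite eE ltc_cabs; lra.
apply/(@nbhs_norm0P _ C P); exists d%:C => /=; first by rewrite ltcR.
by move=> h /=; rewrite ltc_cabs => /ltW; exact: hd.
Qed.

Lemma near0_C2 (P : C2 -> Prop) : nbhs (0 : C2) P <->
  exists2 d : R, 0 < d & forall h : C2, cabs h.1 <= d -> cabs h.2 <= d -> P h.
Proof.
split=> [/nbhs_norm0P[e /= e0 he]|[d d0 hd]].
  have [eE e1] := pos_complexE e0.
  exists (cRe e / 2); first by rewrite divr_gt0.
  move=> h h1 h2; apply: he => /=.
  by rewrite eE norm_pairE ltcR gt_max; apply/andP; split; lra.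
apply/(@nbhs_norm0P _ C2 P); exists d%:C => /=; first by rewrite ltcR.
by move=> h /=; rewrite norm_pairE ltcR gt_max => /andP[/ltW + /ltW]; exact: hd.
Qed.

Definition cexpansion (f : C -> C) z a := forall e : R, 0 < e -> exists2 d, 0 < d &
  forall h, cabs h <= d -> cabs (f (z + h) - f z - a * h) <= e * cabs h.

(** Frechet differentiability over the complex scalars, spelled out with real
    epsilons so that quantitative estimates can feed it. *)
Definition cexpansion2 (f : C2 -> C) (z : C2) a b := forall e : R, 0 < e ->
  exists2 d, 0 < d & forall h k, cabs h <= d -> cabs k <= d ->
  cabs (f (z.1 + h, z.2 + k) - f z - a * h - b * k) <= e * (cabs h + cabs k).

Lemma differentiable_cexpansion f z : differentiable (f : C -> C) z ->
  exists a, cexpansion f z a.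
Proof.
move=> df; exists ('d f z (1 : C)) => e e0.
have /eqaddoP/(_ e%:C) := diff_locally df.
rewrite ltcR => /(_ e0)/near0_C[d d0 hd]; exists d => // h /hd H.
have {}H : `|f (h + z) - (f z + 'd f z h)| <= e%:C * `|h| by exact: H.
move: H; rewrite !cnormE -rmorphM lecR.
have -> : 'd f z h = 'd f z (1 : C) * h.
  have -> : 'd f z h = 'd f z (h *: (1 : C)) by congr ('d f z _); exact: (esym (mulr1 h)).
  by rewrite linearZ mulrC.
by rewrite [h + z]addrC opprD addrA.
Qed.

Lemma differentiable_cexpansion2 (f : C2 -> C) (z : C2) : differentiable (f : C2 -> C) z ->
  exists a b, cexpansion2 f z a b.
Proof.
move=> df; exists ('d f z ((1, 0) : C2)), ('d f z ((0, 1) : C2)) => e e0.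
have /eqaddoP/(_ e%:C) := diff_locally df.
rewrite ltcR => /(_ e0)/near0_C2[d d0 hd]; exists d => // h k hh kk.
have H : `|f ((h, k) + z) - (f z + 'd f z (h, k))| <= e%:C * `|((h, k) : C2)|.
  exact: (hd (h, k) hh kk).
move: H; rewrite norm_pairE !cnormE -rmorphM lecR /=.
have -> : ((h, k) + z : C2) = (z.1 + h, z.2 + k).
  by case: z {df hd} => z1 z2; congr pair; rewrite /= addrC.
have -> : 'd f z ((h, k) : C2) = 'd f z ((1, 0) : C2) * h + 'd f z ((0, 1) : C2) * k.
  have -> : ((h, k) : C2) = h *: ((1, 0) : C2) + k *: ((0, 1) : C2).
    congr pair; rewrite /= /GRing.scale /= ?mulr1 ?mulr0 ?addr0 ?add0r//.
  by rewrite linearD !linearZ; congr (_ + _); exact: mulrC.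
rewrite opprD addrA => H.
set A := 'd f z _ * h in H *; set B := 'd f z _ * k in H *.
have -> : f (z.1 + h, z.2 + k) - f z - A - B = f (z.1 + h, z.2 + k) - f z - (A + B).
  by rewrite opprD addrA.
apply: (le_trans H).
by rewrite ler_wpM2l ?(ltW e0)// ge_max lerDl lerDr !cabs_ge0.
Qed.

(** After subtracting the linear part the differential is zero, which spares the
    construction of a bounded linear map from the pair (a, b). *)
Lemma cexpansion2_differentiable (f : C2 -> C) (z : C2) a b :
  cexpansion2 f z a b -> differentiable (f : C2 -> C) z.
Proof.
move=> hf.
pose g (w : C2) : C := f w - (w.1 * a + w.2 * b).
have dg : differentiable g z.
  have S0 (e : R[i]) : 0 < e -> nbhs (0 : C2) (fun h : C2 =>
      `|(g \o shift z) h - (cst (g z) + (\0 : C2 -> C)) h| <= e * `|h|).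
    move=> e0; have [eE e1] := pos_complexE e0.
    have [d d0 hd] := hf (cRe e / 2) (divr_gt0 e1 (ltr0Sn _ 1)).
    apply/near0_C2; exists d => // h h1 h2.
    have := hd _ _ h1 h2.
    have zh : (z.1 + h.1, z.2 + h.2) = h + z by congr pair; rewrite addrC.
    rewrite zh => H.
    suff : `|g (h + z) - g z| <= e * `|h| by rewrite /= addr0.
    rewrite cnormE eE norm_pairE -rmorphM lecR.
    have -> : g (h + z) - g z = f (h + z) - f z - a * h.1 - b * h.2.
      rewrite /g /=; ring.
    apply: (le_trans H).
    have -> : cRe e / 2 * (cabs h.1 + cabs h.2) = cRe e * ((cabs h.1 + cabs h.2) / 2) by ring.
    rewrite ler_wpM2l ?(ltW e1)// le_max.
    by have [q|q] := leP (cabs h.1) (cabs h.2); apply/orP; [right|left]; lra.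
  have E : 'd g z = (\0 : C2 -> C) :> (C2 -> C).
    by apply: diff_unique; [exact: cst_continuous|apply/eqaddoP => e e0; exact: S0].
  apply/diff_locallyP; rewrite E; split; first exact: cst_continuous.
  by apply/eqaddoP => e e0; exact: S0.
have d1 : differentiable (fst : C2 -> C) z.
  by apply: linear_differentiable => ?; exact: cvg_fst.
have d2 : differentiable (snd : C2 -> C) z.
  by apply: linear_differentiable => ?; exact: cvg_snd.
have -> : f = g + ((fst : C2 -> C) * cst a + (snd : C2 -> C) * cst b).
  by apply/funext => w; rewrite /g /= subrK.
have da := differentiableM d1 (@differentiable_cst _ C2 C a z).
have db := differentiableM d2 (@differentiable_cst _ C2 C b z).
exact: (differentiableD dg (differentiableD da db)).
Qed.
End ComplexBasics.

(** * Compact sets in the complex plane squared *)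

Section ComplexCompactness.
Variable R : realType.
Local Notation C := (CC R).
Local Notation C2 := (CC2 R).

Lemma nbhs_C2 (z : C2) (P : C2 -> Prop) : nbhs z P <->
  exists2 d : R, 0 < d & forall w : C2, cabs (w.1 - z.1) <= d -> cabs (w.2 - z.2) <= d -> P w.
Proof.
have E : nbhs z P <-> nbhs (0 : C2) (fun h : C2 => P (h + z)).
  have := @near_shift _ C2 0 z P.
  by rewrite !nbhs_nearE subr0 => ->.
rewrite E near0_C2; split=> -[d d0 hd]; exists d => //.
  by move=> w h1 h2; rewrite -(subrK z w); exact: hd.
by move=> h h1 h2; apply: hd; rewrite /= addrK.
Qed.

(** One family of compact sets for all purposes: closed bidiscs (a = 0) and, with
    c = 0, closed annuli in the first variable. *)
Definition annulus_disc (a b c : R) : set C2 :=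
  [set z | a <= cabs z.1 <= b /\ cabs z.2 <= c].

Lemma closed_annulus_disc a b c : closed (annulus_disc a b c).
Proof.
move=> z cz; apply: contrapT => nz.
have lip (w1 w2 : C) d : cabs (w1 - w2) <= d -> `|cabs w1 - cabs w2| <= d.
  move=> h; rewrite ler_norml; have := cabs_triangle w1 w2.
  have := cabs_triangle w2 w1; rewrite (cabs_distrC w2); lra.
have [m m0 hm] : exists2 m, 0 < m &
    (cabs z.1 + m < a \/ b < cabs z.1 - m \/ c < cabs z.2 - m).
  have [h1|h1] := leP a (cabs z.1); last by exists ((a - cabs z.1) / 2); lra.
  have [h2|h2] := leP (cabs z.1) b; last by exists ((cabs z.1 - b) / 2); lra.
  have [h3|h3] := leP (cabs z.2) c; last by exists ((cabs z.2 - c) / 2); lra.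
  by exfalso; apply: nz; split => //; rewrite h1.
have [w [[/andP[w1 w2] w3] [e1 e2]]] := cz [set w | cabs (w.1 - z.1) <= m /\ cabs (w.2 - z.2) <= m]
  (ltac:(by apply/nbhs_C2; exists m)).
move: (lip _ _ _ e1) (lip _ _ _ e2); rewrite !ler_norml; lra.
Qed.

Lemma cpoint_continuous : continuous (Defs.cpoint : (R * R) * (R * R) -> C2).
Proof.
move=> p A /nbhs_C2[d d0 hd].
have d2 : 0 < d / 2 by rewrite divr_gt0.
have n1 : nbhs p [set q | `|q.1.1 - p.1.1| <= d / 2 /\ `|q.1.2 - p.1.2| <= d / 2 /\
   `|q.2.1 - p.2.1| <= d / 2 /\ `|q.2.2 - p.2.2| <= d / 2].
  apply/nbhs_ballP; exists (d / 2) => // q [[/= b1 b2] [/= b3 b4]].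
  by move: b1 b2 b3 b4; rewrite /ball/= => *; do !split; rewrite distrC ltW.
apply: filterS n1 => q /= [h1 [h2 [h3 h4]]]; apply: hd.
  by apply: le_trans (cabs_le _) _ => /=; lra.
by apply: le_trans (cabs_le _) _ => /=; lra.
Qed.

Lemma compact_annulus_disc a b c : compact (annulus_disc a b c).
Proof.
pose B : set ((R * R) * (R * R)) :=
  (`[- b, b] `*` `[- b, b]) `*` (`[- c, c] `*` `[- c, c]).
have cB : compact B by do !apply: compact_setX; exact: segment_compact.
apply: (subclosed_compact (@closed_annulus_disc a b c) (B := Defs.cpoint @` B)).
  by apply: continuous_compact cB; apply: continuous_subspaceT; exact: cpoint_continuous.
move=> z [/andP[_ z1] z2].
exists ((complex.Re z.1, complex.Im z.1), (complex.Re z.2, complex.Im z.2)).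
  have := Re_le_cabs z.1; have := Im_le_cabs z.1.
  have := Re_le_cabs z.2; have := Im_le_cabs z.2.
  rewrite !ler_norml => *; split; split; rewrite /= in_itv/=; lra.
by case: z {z1 z2} => -[? ?] [? ?].
Qed.

(** Local statements that hold eventually along a filter hold uniformly on a
    compact set, eventually along that filter. *)
Lemma compact_covering (K : set C2) I (F : set_system I) (FF : Filter F)
    (P : I -> C2 -> Prop) : compact K ->
  (forall z, K z -> exists2 d : R, 0 < d & exists2 Q : set I, F Q &
    forall i w, Q i -> K w -> cabs (w.1 - z.1) <= d -> cabs (w.2 - z.2) <= d -> P i w) ->
  F [set i | forall w, K w -> P i w].
Proof.
move=> /compact_near_coveringP/near_covering_withinP cK loc.
apply: (cK I F P FF) => z Kz; have [d d0 [Q FQ h]] := loc z Kz.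
exists ([set w | cabs (w.1 - z.1) <= d /\ cabs (w.2 - z.2) <= d], Q).
  by split => //; apply/nbhs_C2; exists d.
by move=> [w i] /= [[h1 h2] Qi] Kw; exact: h.
Qed.

Lemma compact_maximum (K : set C2) (f : C2 -> R) : compact K -> K !=set0 ->
  (forall z, K z -> forall e, 0 < e -> exists2 d, 0 < d & forall w, K w ->
     cabs (w.1 - z.1) <= d -> cabs (w.2 - z.2) <= d -> `|f w - f z| <= e) ->
  exists2 c, K c & forall w, K w -> f w <= f c.
Proof.
move=> cK K0 fc; have [|c cK' hc] := compact_EVT_max K0 cK (f := f).
  apply/subspace_continuousP => z Kz; apply/cvgrPdist_le => e e0.
  have [d d0 hd] := fc z Kz e e0.
  apply/(nbhs_C2 z); exists d => // w h1 h2 Kw; rewrite distrC; exact: hd.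
by exists c; [exact: set_mem|move=> w Kw; apply: hc; exact: mem_set].
Qed.

Lemma compact_bound (K : set C2) (f : C2 -> C) : compact K ->
  (forall z, K z -> exists2 d : R, 0 < d & forall w, K w ->
     cabs (w.1 - z.1) <= d -> cabs (w.2 - z.2) <= d -> cabs (f w - f z) <= 1) ->
  exists M, forall z, K z -> cabs (f z) <= M.
Proof.
move=> cK fc.
have := @compact_covering K R (pinfty_nbhs R) _ (fun M z => cabs (f z) <= M) cK.
case=> [z Kz|M [_ hM]]; last by exists (M + 1); apply: hM; rewrite ltrDl.
have [d d0 hd] := fc z Kz; exists d => //.
exists [set M | cabs (f z) + 1 < M].
  by exists (cabs (f z) + 1); split; first exact: num_real.
move=> M w /= hM Kw h1 h2; have := hd w Kw h1 h2.
have := cabs_triangle (f w) (f z); lra.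
Qed.
End ComplexCompactness.

(** * The mean value property of holomorphic functions *)

Section ComplexMeanValue.
Variable R : realType.
Local Notation C := (CC R).
Local Notation C2 := (CC2 R).
Local Notation R1 := (measurableTypeR R).
Local Notation R2 := (R1 * R1)%type.
Local Notation lam2 := (@lebesgue2 R).
Local Notation cRe := (@complex.Re R).
Local Notation cIm := (@complex.Im R).
Implicit Types (f : C -> C) (a z w : C) (r s : R).

(** The complex number with the given coordinates; points of the plane carry the measure. *)
Definition cpl (p : R2) : C := p.1 +i* p.2.

Definition holo f a r := forall z, cabs (z - a) < r -> differentiable (f : C -> C) z.

Lemma sqd_cabs a (x y : R) : sqd (cRe a) (cIm a) x y = cabs (((x +i* y) : C) - a) ^+ 2.
Proof. by rewrite cabs_sqr; case: a. Qed.

(** The tent centred at a, as a function on the disc of radius s around a. *)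
Definition cone a s (p : R2) : R := tent (s ^+ 2) (cabs (cpl p - a) ^+ 2).

Lemma coneE a s p : cone a s p = tent (s ^+ 2) (sqd (cRe a) (cIm a) p.1 p.2).
Proof. by rewrite sqd_cabs. Qed.

Lemma cone_ge0 a s p : 0 <= cone a s p.
Proof. exact: tent_ge0. Qed.

Lemma ltr_sqr_cabs z s : 0 <= s -> (cabs z ^+ 2 < s ^+ 2) = (cabs z < s).
Proof. by move=> s0; rewrite ltr_pXn2r// nnegrE ?cabs_ge0. Qed.

Lemma ler_sqr_cabs z s : 0 <= s -> (cabs z ^+ 2 <= s ^+ 2) = (cabs z <= s).
Proof. by move=> s0; rewrite ler_pXn2r// nnegrE ?cabs_ge0. Qed.

Lemma cone_out a s p : 0 <= s -> s <= cabs (cpl p - a) -> cone a s p = 0.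
Proof.
move=> s0 h; rewrite /cone /tent max_l// subr_le0.
by rewrite ler_pXn2r// nnegrE ?cabs_ge0.
Qed.

Lemma cone_integral a s : 0 < s ->
  (\int[lam2]_p (cone a s p)%:E)%E = (s ^+ 4 * tentc R)%:E.
Proof.
move=> s0; under eq_integral do rewrite coneE.
by rewrite tent_integral ?exprn_gt0// -exprM.
Qed.

Lemma cpl_shift (x y h k : R) : ((x + h) +i* (y + k) : C) = (x +i* y) + (h +i* k).
Proof. by []. Qed.

(** The Cauchy-Riemann equations, as a relation between the two gradients. *)
Lemma differentiable_CR f (x y : R) : differentiable (f : C -> C) (x +i* y : C) ->
  exists al be,
    expansion2 (fun x y => cRe (f (x +i* y))) x y al (- be) /\
    expansion2 (fun x y => cIm (f (x +i* y))) x y be al.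
Proof.
move=> /differentiable_cexpansion[[al be] hf]; exists al, be.
have key e : 0 < e -> exists2 d, 0 < d & forall h k, `|h| <= d -> `|k| <= d ->
    cabs (f ((x + h) +i* (y + k)) - f (x +i* y) - (al +i* be) * (h +i* k)) <= e * (`|h| + `|k|).
  move=> e0; have [d d0 hd] := hf e e0.
  exists (d / 2); first by rewrite divr_gt0.
  move=> h k hh kk; have hk : cabs (h +i* k : C) <= `|h| + `|k| by exact: cabs_le.
  have hk2 : `|h| + `|k| <= d by lra.
  have := hd (h +i* k) (le_trans hk hk2).
  rewrite -cpl_shift => /le_trans; apply.
  by rewrite ler_wpM2l ?(ltW e0).
split=> e /key[d d0 hd]; exists d => // h k hh kk; have {hd} := hd h k hh kk.
  move/(le_trans (Re_le_cabs _)).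
  case: (f ((x + h) +i* (y + k))) => u1 v1; case: (f (x +i* y)) => u2 v2 /=.
  by congr (`|_| <= _); ring.
move/(le_trans (Im_le_cabs _)).
case: (f ((x + h) +i* (y + k))) => u1 v1; case: (f (x +i* y)) => u2 v2 /=.
by congr (`|_| <= _); ring.
Qed.

Lemma differentiable_cont f z : differentiable (f : C -> C) z ->
  forall e, 0 < e -> exists2 d : R, 0 < d &
    forall w, cabs (w - z) <= d -> cabs (f w - f z) <= e.
Proof.
move=> /differentiable_cexpansion[a ha] e e0.
have [d d0 hd] := ha 1 ltr01.
pose K := 1 + cabs a; have K0 : 0 < K by rewrite /K; have := cabs_ge0 a; lra.
exists (Num.min d (e / K)); first by rewrite lt_min d0 divr_gt0.
move=> w; rewrite le_min => /andP[w1 w2]; have := hd (w - z) w1.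
rewrite subrKC => h.
have -> : f w - f z = (f w - f z - a * (w - z)) + a * (w - z) by rewrite subrK.
apply: le_trans (cabsD _ _) _; rewrite cabsM.
have : K * cabs (w - z) <= e by rewrite mulrC -ler_pdivlMr.
rewrite /K; lra.
Qed.

Lemma holo_bounded f a r s : holo f a r -> s < r ->
  exists M, forall z, cabs (z - a) <= s -> cabs (f z) <= M.
Proof.
move=> hf sr; have cK := @compact_annulus_disc R 0 s 0.
have [|M hM] := @compact_bound R _ (fun z : C2 => f (a + z.1)) cK.
  move=> z [/andP[_ zs] _].
  have az : cabs (a + z.1 - a) < r by rewrite addrC addKr; lra.
  have [d d0 hd] := differentiable_cont (hf _ az) ltr01.
  exists d => // w _ w1 _; apply: hd.
  by rewrite opprD addrACA subrr add0r.
exists M => z zs; have := hM (z - a, 0); rewrite /= subrKC; apply.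
split; first by rewrite /= cabs_ge0 zs.
by rewrite -[X in _ <= X](cabs0 R) lexx.
Qed.

Lemma cone_mul_cont (F : R -> R -> R) a r s : 0 <= s -> s < r ->
  (forall x y, cabs ((x +i* y : C) - a) < r -> cont2 F x y) ->
  forall x y, cont2 (fun x y => F x y * cone a s (x, y)) x y.
Proof.
move=> s0 sr hF x y.
have [h|h] := ltP (cabs ((x +i* y : C) - a)) r.
  apply: cont2_mul; first exact: hF.
  have -> : (fun x y => cone a s (x, y)) =
      (fun x y => tent (s ^+ 2) (sqd (cRe a) (cIm a) x y)).
    by apply/funext => x'; apply/funext => y'; rewrite coneE.
  by apply: cont2_lip_comp; [exact: tent_lip|exact: sqd_cont].
have h2 : s ^+ 2 < sqd (cRe a) (cIm a) x y.
  rewrite sqd_cabs ltr_pXn2r// ?nnegrE ?cabs_ge0//; lra.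
have [d d0 hd] := sqd_far h2.
apply: (cont2_eq d0 _ (expansion2_cont2 (expansion2_cst 0 x y))) => h' k' hh kk.
by rewrite coneE /tent max_l ?mulr0// subr_le0; exact: hd.
Qed.

Lemma cone_mul_measurable f a r s (phi : C -> R) : 0 <= s -> s < r ->
  (forall z w, `|phi z - phi w| <= cabs (z - w)) ->
  holo f a r -> measurable_fun [set: R2] (fun p => phi (f (cpl p)) * cone a s p : R1).
Proof.
move=> s0 sr lphi hf.
have -> : (fun p => phi (f (cpl p)) * cone a s p) =
   (fun p : R2 => (fun x y => phi (f (x +i* y)) * cone a s (x, y)) p.1 p.2).
  by apply/funext => -[x y].
apply: (@cont2_measurable R (fun x y => phi (f (x +i* y)) * cone a s (x, y))); apply: (cone_mul_cont s0 sr) => x y h.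
move=> e e0; have [d d0 hd] := differentiable_cont (hf _ h) e0.
exists (d / 2); first by rewrite divr_gt0.
move=> h' k' hh kk; apply: le_trans (lphi _ _) _; apply: hd.
rewrite cpl_shift addrC addKr; apply: le_trans (cabs_le _) _ => /=; lra.
Qed.

Lemma Re_lip z w : `|cRe z - cRe w| <= cabs (z - w).
Proof. by apply: le_trans (Re_le_cabs _); case: z w => a b [c d]. Qed.

Lemma cabs_lip z w : `|cabs z - cabs w| <= cabs (z - w).
Proof.
rewrite ler_norml; have := cabs_triangle z w.
by have := cabs_triangle w z; rewrite (cabs_distrC w); lra.
Qed.

Section MV.
Variables (f : C -> C) (a : C) (r s : R).
Hypothesis hf : holo f a r.
Hypothesis s0 : 0 < s.
Hypothesis sr : s < r.

Let CR x y : sqd (cRe a) (cIm a) x y < r ^+ 2 -> exists al be,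
    expansion2 (fun x y => cRe (f (x +i* y))) x y al (- be) /\
    expansion2 (fun x y => cIm (f (x +i* y))) x y be al.
Proof.
rewrite sqd_cabs ltr_sqr_cabs; last exact: ltW (lt_trans s0 sr).
by move=> h; apply: differentiable_CR; exact: hf.
Qed.

Let s2 : 0 < s ^+ 2. Proof. by rewrite exprn_gt0. Qed.
Let s2r2 : s ^+ 2 < r ^+ 2.
Proof. by have r0 := lt_trans s0 sr; rewrite ltr_pXn2r ?nnegrE ?(ltW r0) ?(ltW s0). Qed.

Lemma Re_cone_integrable : lam2.-integrable setT
  (EFin \o (fun p => cRe (f (cpl p)) * cone a s p)).
Proof.
have [M hM] := holo_bounded hf sr.
have uM x y : sqd (cRe a) (cIm a) x y <= s ^+ 2 -> `|cRe (f (x +i* y))| <= M.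
  rewrite sqd_cabs ler_sqr_cabs ?(ltW s0)// => h.
  exact: le_trans (Re_le_cabs _) (hM _ h).
have -> : (fun p => cRe (f (cpl p)) * cone a s p) =
    (fun p : R2 => (fun x y => cRe (f (x +i* y))) p.1 p.2
      * tent (s ^+ 2) (sqd (cRe a) (cIm a) p.1 p.2)).
  by apply/funext => p; rewrite coneE.
by apply: (tent_integrable CR s2 (lexx _) s2r2 uM); rewrite s2 lexx.
Qed.

(** The factor s^4 tentc is the mass of the cone. *)
Lemma Re_mean_value : \int[lam2]_p (cRe (f (cpl p)) * cone a s p) =
  s ^+ 4 * tentc R * cRe (f a).
Proof.
have [M hM] := holo_bounded hf sr.
have uM x y : sqd (cRe a) (cIm a) x y <= s ^+ 2 -> `|cRe (f (x +i* y))| <= M.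
  rewrite sqd_cabs ler_sqr_cabs ?(ltW s0)// => h.
  exact: le_trans (Re_le_cabs _) (hM _ h).
have vM x y : sqd (cRe a) (cIm a) x y <= s ^+ 2 -> `|cIm (f (x +i* y))| <= M.
  rewrite sqd_cabs ler_sqr_cabs ?(ltW s0)// => h.
  exact: le_trans (Im_le_cabs _) (hM _ h).
have := mean_value CR s2 s2r2 uM vM.
rewrite -exprM => E.
under eq_Rintegral do rewrite coneE.
rewrite E; congr (_ * cRe (f _)).
by case: (a).
Qed.
End MV.
End ComplexMeanValue.

(** * Sub-mean values and Lipschitz estimates *)

Section MeanValueConsequences.
Variable R : realType.
Local Notation C := (CC R).
Local Notation R1 := (measurableTypeR R).
Local Notation R2 := (R1 * R1)%type.
Local Notation lam2 := (@lebesgue2 R).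
Local Notation cRe := (@complex.Re R).
Local Notation cIm := (@complex.Im R).
Implicit Types (f : C -> C) (a z w : C) (r s : R).
Local Notation c := (tentc R).

Lemma phase z : exists2 e : C, cabs e = 1 & cRe (e * z) = cabs z.
Proof.
have [->|z0] := eqVneq z 0; first by exists 1; rewrite ?cabs1// mulr0 cabs0.
have n0 := cabs_gt0 z0; set n := cabs z in n0 *.
have nn : n != 0 by rewrite gt_eqF.
have zz := cabs_sqr z; rewrite -/n in zz.
exists ((cRe z / n) +i* (- (cIm z / n))).
  have : cabs ((cRe z / n) +i* (- (cIm z / n)) : C) ^+ 2 = 1.
    rewrite cabs_sqr /=.
    have -> : (cRe z / n) ^+ 2 + (- (cIm z / n)) ^+ 2 = (cRe z ^+ 2 + cIm z ^+ 2) / n ^+ 2.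
      by field.
    by rewrite -zz divff// expf_neq0.
  by move=> /eqP; rewrite -[X in _ == X](expr1n _ 2) eqrXn2 ?cabs_ge0// => /eqP.
rewrite -[RHS]/n; case: z {z0} @n n0 nn zz => x y n n0 nn /= zz.
have -> : x / n * x - - (y / n) * y = (x ^+ 2 + y ^+ 2) / n by field.
by rewrite -zz expr2 mulfK.
Qed.

Lemma holoZ e f a r : holo f a r -> holo (fun z => e * f z) a r.
Proof. by move=> hf z /hf; exact: (differentiableM (differentiable_cst e z)). Qed.

Lemma holo_sub f a r b s : holo f a r -> cabs (b - a) + s <= r -> holo f b s.
Proof.
move=> hf h z zb; apply: hf.
have -> : z - a = (z - b) + (b - a) by rewrite addrA subrK.
apply: le_lt_trans (cabsD _ _) _; lra.
Qed.

Lemma cabs_cone_measurable f a r s : 0 <= s -> s < r -> holo f a r ->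
  measurable_fun [set: R2] (fun p => cabs (f (cpl p)) * cone a s p : R1).
Proof. by move=> s0 sr; apply: cone_mul_measurable => // z w; exact: cabs_lip. Qed.

(** Rotate f so that f(a) is its modulus, and take real parts in the mean value
    property. *)
Lemma submean f a r s : holo f a r -> 0 < s -> s < r ->
  ((s ^+ 4 * c * cabs (f a))%:E <=
   \int[lam2]_p (cabs (f (cpl p)) * cone a s p)%:E)%E.
Proof.
move=> hf s0 sr; have [e e1 fe] := phase (f a).
have hg := holoZ e hf.
have i1 := Re_cone_integrable hg s0 sr.
have := Re_mean_value hg s0 sr; rewrite fe => <-.
apply: (@le_trans _ _ (`|\int[lam2]_p (cRe (e * f (cpl p)) * cone a s p)%:E|)%E).
  rewrite /Rintegral fineK ?lee_abs//; exact: (integrable_fin_num _ i1).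
apply: le_trans (le_abse_integral _ _ _) _ => //; first exact: measurable_int i1.
apply: ge0_le_integral => //.
- apply: measurableT_comp => //; exact: measurable_int i1.
- by apply/measurable_EFinP; exact: (cabs_cone_measurable (ltW s0) sr hf).
move=> p _ /=; rewrite lee_fin normrM (ger0_norm (cone_ge0 _ _ _)).
rewrite ler_wpM2r ?cone_ge0//; apply: le_trans (Re_le_cabs _) _.
by rewrite cabsM e1 mul1r.
Qed.

(** A Cauchy estimate without derivatives: f(z) - f(w) is the average of f
    against the difference of two cones of radius s, and that difference is at
    most 4 s |z - w| on a disc of radius 2 s. Dividing by the mass of a cone gives
    a constant independent of f. *)
Lemma cauchy_lipschitz f z w r s M : holo f z r -> holo f w r -> 0 < s -> s < r ->
  (forall x, cabs (x - z) <= s -> cabs (f x) <= M) ->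
  (forall x, cabs (x - w) <= s -> cabs (f x) <= M) ->
  cabs (z - w) <= s ->
  cabs (f z - f w) <= 64 * M / s * cabs (z - w).
Proof.
move=> hz hw s0 sr zM wM zw; have [e e1 fe] := phase (f z - f w).
have M0 : 0 <= M by apply: le_trans (cabs_ge0 (f z)) (zM _ _); rewrite subrr cabs0 ltW.
have c0 := tentc_gt0 R.
have iz := Re_cone_integrable (holoZ e hz) s0 sr.
have iw := Re_cone_integrable (holoZ e hw) s0 sr.
have mz := Re_mean_value (holoZ e hz) s0 sr.
have mw := Re_mean_value (holoZ e hw) s0 sr.
pose K := M * cabs (z - w) / s.
have K0 : 0 <= K by rewrite divr_ge0 ?(ltW s0)// mulr_ge0// cabs_ge0.
(* the tent of squared radius 8 s^2 is at least 4 s^2 on the disc of radius 2 s, which carries both cones *)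
have pw p : cRe (e * f (cpl p)) * cone z s p - cRe (e * f (cpl p)) * cone w s p
    <= K * tent (8 * s ^+ 2) (sqd (cRe z) (cIm z) p.1 p.2).
  rewrite sqd_cabs -/(cpl p).
  have t0 := tent_ge0 (8 * s ^+ 2) (cabs (cpl p - z) ^+ 2).
  have zwp := cabs_lip (cpl p - z) (cpl p - w).
  have zwE : cpl p - z - (cpl p - w) = - (z - w).
    by ring.
  rewrite zwE cabsN in zwp.
  set dz := cabs (cpl p - z) in t0 zwp *; set dw := cabs (cpl p - w) in zwp *.
  have dz0 : 0 <= dz by exact: cabs_ge0.
  have dw0 : 0 <= dw by exact: cabs_ge0.
  have t8 : dz <= 2 * s -> 4 * s ^+ 2 <= tent (8 * s ^+ 2) (dz ^+ 2).
    by move=> h; rewrite /tent le_max; apply/orP; right; nra.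
  have KK : K * (4 * s ^+ 2) = 4 * s * M * cabs (z - w).
    by rewrite /K; field; rewrite gt_eqF.
  have [hz1|hz1] := leP s dz; have [hw1|hw1] := leP s dw.
  - by rewrite !cone_out ?(ltW s0)// !mulr0 subrr mulr_ge0.
  - (* only the w-cone is nonzero *)
    have db : dz <= 2 * s by move: zwp; rewrite ler_norml; lra.
    have fM : cabs (f (cpl p)) <= M by apply: wM; exact: ltW.
    rewrite (cone_out (ltW s0) hz1) mulr0 sub0r.
    have RM : `|cRe (e * f (cpl p))| <= M.
      by apply: le_trans (Re_le_cabs _) _; rewrite cabsM e1 mul1r.
    have bw : cone w s p <= 4 * s * cabs (z - w).
      rewrite /cone -/dw /tent ge_max; apply/andP; split.
        by rewrite !mulr_ge0 ?cabs_ge0 ?(ltW s0).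
      move: zwp; rewrite ler_norml; nra.
    apply: le_trans (ler_wpM2l K0 (t8 db)); rewrite KK.
    have b0 := cone_ge0 w s p.
    move: RM; rewrite ler_norml; nra.
  - have db : dz <= 2 * s by lra.
    have fM : cabs (f (cpl p)) <= M by apply: zM; exact: ltW.
    rewrite (cone_out (ltW s0) hw1) mulr0 subr0.
    have RM : `|cRe (e * f (cpl p))| <= M.
      by apply: le_trans (Re_le_cabs _) _; rewrite cabsM e1 mul1r.
    have bw : cone z s p <= 4 * s * cabs (z - w).
      rewrite /cone -/dz /tent ge_max; apply/andP; split.
        by rewrite !mulr_ge0 ?cabs_ge0 ?(ltW s0).
      move: zwp; rewrite ler_norml; nra.
    apply: le_trans (ler_wpM2l K0 (t8 db)); rewrite KK.
    have b0 := cone_ge0 z s p.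
    move: RM; rewrite ler_norml; nra.
  - have db : dz <= 2 * s by lra.
    have fM : cabs (f (cpl p)) <= M by apply: zM; exact: ltW.
    have RM : `|cRe (e * f (cpl p))| <= M.
      by apply: le_trans (Re_le_cabs _) _; rewrite cabsM e1 mul1r.
    have bw : `|cone z s p - cone w s p| <= 4 * s * cabs (z - w).
      apply: le_trans (tent_lip _ _ _) _; rewrite -/dz -/dw subr_sqr normrM.
      rewrite (ger0_norm (addr_ge0 dz0 dw0)).
      have := normr_ge0 (dz - dw); nra.
    apply: le_trans (ler_wpM2l K0 (t8 db)); rewrite KK.
    rewrite -mulrBr; apply: le_trans (ler_norm _) _; rewrite normrM.
    have -> : 4 * s * M * cabs (z - w) = M * (4 * s * cabs (z - w)) by ring.
    by rewrite ler_pM.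
have s8 : 0 < 8 * s ^+ 2 by rewrite mulr_gt0// exprn_gt0.
have ti := tent1_integrable (cRe z) (cIm z) s8.
have : \int[lam2]_p (cRe (e * f (cpl p)) * cone z s p - cRe (e * f (cpl p)) * cone w s p)
   <= \int[lam2]_p (K * tent (8 * s ^+ 2) (sqd (cRe z) (cIm z) p.1 p.2)).
  apply: le_Rintegral => //.
  - exact: (integrableB measurableT iz iw).
  - exact: (integrableZl measurableT _ ti).
rewrite RintegralB// RintegralZl// mz mw.
rewrite -[X in _ <= _ * X]/(tentI _ _ _) tentIE// -mulrBr.
have -> : cRe (e * f z) - cRe (e * f w) = cRe (e * (f z - f w)).
  by rewrite mulrBr; case: (e * f z) => ? ?; case: (e * f w).
rewrite fe => h.
have s4c : 0 < s ^+ 4 * c by rewrite mulr_gt0// exprn_gt0.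
rewrite -(ler_pM2l s4c); apply: le_trans h _.
rewrite le_eqVlt; apply/orP; left; apply/eqP; rewrite /K; field.
by rewrite gt_eqF.
Qed.
End MeanValueConsequences.

(** * The maximum principle and a Schwarz lemma *)

Section MaximumPrinciple.
Variable R : realType.
Local Notation C := (CC R).
Local Notation C2 := (CC2 R).
Local Notation R1 := (measurableTypeR R).
Local Notation R2 := (R1 * R1)%type.
Local Notation lam2 := (@lebesgue2 R).
Local Notation cRe := (@complex.Re R).
Local Notation cIm := (@complex.Im R).
Implicit Types (f h : C -> C) (a z w : C) (r s : R).
Local Notation c := (tentc R).

Lemma differentiable_mul (V : normedModType R[i]) (f g : V -> C) (x : V) :
  differentiable f x -> differentiable g x -> differentiable (fun y => f y * g y) x.
Proof. exact: differentiableM. Qed.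

Lemma differentiable_pow (V : normedModType R[i]) (f : V -> C) n (x : V) :
  differentiable f x -> differentiable (fun y => f y ^+ n) x.
Proof.
move=> df; elim: n => [|n IH]; first exact: (@differentiable_cst _ V C 1 x).
have -> : (fun y => f y ^+ n.+1) = (fun y => f y * f y ^+ n).
  by apply/funext => y; rewrite exprS.
exact: differentiable_mul.
Qed.

Lemma differentiable_inv (V : normedModType R[i]) (f : V -> C) (x : V) :
  differentiable f x -> f x != 0 -> differentiable (fun y => (f y)^-1) x.
Proof. by move=> df f0; exact: differentiableV. Qed.

(** |f| + e |z|^2 is strictly subharmonic, hence has no local maximum. Expanding
    |z|^2 around z0 gives a harmonic term with mean zero and the term |z - z0|^2,
    whose average exceeds its value at z0 by a definite amount. *)
Lemma local_maximum_contra f z0 r e : holo f z0 r -> 0 < r -> 0 < e ->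
  (forall z, cabs (z - z0) < r ->
     cabs (f z) + e * cabs z ^+ 2 <= cabs (f z0) + e * cabs z0 ^+ 2) -> False.
Proof.
move=> hf r0 e0 hmax.
pose s := r / 2; have s0 : 0 < s by rewrite divr_gt0.
have sr : s < r by rewrite /s; lra.
have t0 : 0 < s / 2 by rewrite divr_gt0.
have c0 := tentc_gt0 R.
(* |z|^2 = |z0|^2 + Re g(z) + |z - z0|^2 *)
pose g z : C := (2 * z0^*)%C * (z - z0).
have hg : holo g z0 r.
  move=> z _; apply: differentiable_mul; first exact: differentiable_cst.
  by apply: differentiableB; [exact: ex_diff|exact: differentiable_cst].
have ig := Re_cone_integrable hg s0 sr; have mg := Re_mean_value hg s0 sr.
have ci t : 0 < t -> lam2.-integrable setT (EFin \o cone z0 t).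
  move=> t0'; have -> : cone z0 t = (fun p => tent (t ^+ 2) (sqd (cRe z0) (cIm z0) p.1 p.2)).
    by apply/funext => p; rewrite coneE.
  by apply: tent1_integrable; rewrite exprn_gt0.
have cm t : 0 < t -> \int[lam2]_p (cone z0 t p) = t ^+ 4 * c.
  by move=> t0'; rewrite /Rintegral cone_integral.
pose A := cabs (f z0) - e * (s / 2) ^+ 2.
pose B := e * s ^+ 2.
pose rhs (p : R2) : R := A * cone z0 s p - e * (cRe (g (cpl p)) * cone z0 s p)
  + B * cone z0 (s / 2) p.
have pw p : cabs (f (cpl p)) * cone z0 s p <= rhs p.
  have [h|h] := leP s (cabs (cpl p - z0)).
    rewrite /rhs !cone_out ?(ltW s0) ?(ltW t0)//; [|lra].
    by rewrite !mulr0 subr0 addr0.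
  have := hmax (cpl p) (lt_trans h sr).
  have gE : cabs (cpl p) ^+ 2 = cabs z0 ^+ 2 + cRe (g (cpl p)) + cabs (cpl p - z0) ^+ 2.
    by rewrite !cabs_sqr /g; case: (cpl p) => x y; case: (z0) => x0 y0 /=; ring.
  rewrite gE => hm.
  rewrite /rhs /A /B /cone /tent.
  set G := cRe (g (cpl p)) in hm *; set d := cabs (cpl p - z0) in h hm *.
  have d0 : 0 <= d by exact: cabs_ge0.
  have ds : 0 < s ^+ 2 - d ^+ 2 by rewrite subr_gt0 ltr_pXn2r// nnegrE ltW.
  rewrite (max_r (ltW ds)).
  have E1 : cabs (f (cpl p)) <= cabs (f z0) - e * G - e * d ^+ 2 by lra.
  apply: le_trans (ler_wpM2r (ltW ds) E1) _.
  have E2 : (s / 2) ^+ 2 * (s ^+ 2 - d ^+ 2) - s ^+ 2 * Num.max 0 ((s / 2) ^+ 2 - d ^+ 2)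
     <= d ^+ 2 * (s ^+ 2 - d ^+ 2).
    have [q|q] := leP 0 ((s / 2) ^+ 2 - d ^+ 2); last by rewrite mulr0 subr0 ler_wpM2r; lra.
    have d20 := sqr_ge0 d.
    nra.
  have := ler_wpM2l (ltW e0) E2.
  set S := s ^+ 2 - d ^+ 2; set T := Num.max 0 _; set D2 := d ^+ 2.
  lra.
have irhs : lam2.-integrable setT (EFin \o rhs).
  have i1 := integrableZl measurableT A (ci s s0).
  have i2 := integrableZl measurableT e ig.
  have i3 := integrableZl measurableT B (ci _ t0).
  exact: (integrableD measurableT (integrableB measurableT i1 i2) i3).
have Erhs : \int[lam2]_p rhs p = A * (s ^+ 4 * c) + B * ((s / 2) ^+ 4 * c).
  have i1 := integrableZl measurableT A (ci s s0).
  have i2 := integrableZl measurableT e ig.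
  have i3 := integrableZl measurableT B (ci _ t0).
  rewrite RintegralD//; last exact: (integrableB measurableT i1 i2).
  rewrite RintegralB// !RintegralZl//; [|exact: ci..].
  rewrite mg !cm// /g subrr mulr0 /=; ring.
have : (s ^+ 4 * c * cabs (f z0) <= \int[lam2]_p rhs p).
  rewrite -lee_fin; apply: le_trans (submean hf s0 sr) _.
  rewrite /Rintegral fineK; last exact: (integrable_fin_num _ irhs).
  apply: ge0_le_integral => //.
  - by move=> p _; rewrite lee_fin mulr_ge0 ?cabs_ge0 ?cone_ge0.
  - by apply/measurable_EFinP; exact: (cabs_cone_measurable (ltW s0) sr hf).
  - exact: measurable_int irhs.
  - by move=> p _; rewrite lee_fin pw.
rewrite Erhs /A /B => h.
have : 0 < e * c * s ^+ 6 by rewrite !mulr_gt0// exprn_gt0.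
have E : (cabs (f z0) - e * (s / 2) ^+ 2) * (s ^+ 4 * c) + e * s ^+ 2 * ((s / 2) ^+ 4 * c)
  = s ^+ 4 * c * cabs (f z0) - 3 / 16 * (e * c * s ^+ 6) by field.
rewrite E in h; lra.
Qed.

(** A Schwarz lemma for maps that do not fix the origin: Q = h^n / z is bounded
    by 1 at the inner radius 1/2 because |h|^n <= 1/2 there, and by 1 + o(1) near the
    unit circle, so the maximum principle on the annulus bounds it in between. *)
Lemma schwarz_power h rho n : holo h 0 1 -> (forall z, cabs z < 1 -> cabs (h z) <= 1) ->
  (forall z, cabs z <= 2^-1 -> cabs (h z) <= rho) -> rho ^+ n <= 2^-1 ->
  forall z, 2^-1 <= cabs z < 1 -> cabs (h z) ^+ n <= cabs z.
Proof.
move=> hh h1 hrho rn z1 /andP[z1a z1b]; rewrite leNgt; apply/negP => bad.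
pose Q z := h z ^+ n * z^-1.
have QE z : cabs (Q z) = cabs (h z) ^+ n / cabs z by rewrite /Q cabsM cabsX cabsV.
have p1 : 0 < cabs z1 by apply: lt_le_trans z1a.
set q := cabs (Q z1); have q1 : 1 < q by rewrite /q QE ltr_pdivlMr// mul1r.
pose e := (q - 1) / 4; have e0 : 0 < e by rewrite /e; lra.
pose t := Num.max ((1 + cabs z1) / 2) (1 + e)^-1.
have i1 : (1 + e)^-1 < 1 by rewrite invf_lt1; lra.
have t1 : t < 1 by rewrite /t gt_max i1 andbT; lra.
have tz : cabs z1 < t by rewrite /t lt_max; apply/orP; left; lra.
have te : (1 + e)^-1 <= t by rewrite /t le_max lexx orbT.
have t0 : 0 < t by lra.
have ti : t^-1 <= 1 + e by rewrite -[1 + e]invrK lef_pV2// posrE invr_gt0; lra.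
have dQ z : z != 0 -> cabs z < 1 -> differentiable (Q : C -> C) z.
  move=> z0 zl; apply: differentiable_mul.
    by apply: differentiable_pow; apply: hh; rewrite subr0.
  apply: (@differentiable_inv C id z _ z0).
  exact: (@ex_diff _ _ _ _ _ _ _ (is_diff_id z)).
have nz z : 2^-1 <= cabs z -> z != 0.
  by move=> hz; apply/eqP => z0; move: hz; rewrite z0 cabs0; lra.
(* the added strictly subharmonic term pushes the maximum to the boundary circles *)
pose Phi (w : C2) := cabs (Q w.1) + e * cabs w.1 ^+ 2.
have [||[z0 z0'] [/andP[z0a z0b] _] /= zmax] :=
    @compact_maximum R (annulus_disc 2^-1 t 0) Phi (@compact_annulus_disc R _ _ _).
- by exists (z1, 0); split; rewrite /= ?z1a ?(ltW tz)// -[X in _ <= X](cabs0 R).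
- move=> [w w'] [/andP[/= wa wb] _] e1 e10.
  have e2 : 0 < e1 / 2 by rewrite divr_gt0.
  have [d d0 hd] := differentiable_cont (dQ w (nz _ wa) (le_lt_trans wb t1)) e2.
  have e4 : 0 < 4 * e by apply: mulr_gt0.
  have e3 : 0 < e1 / (4 * e) by apply: divr_gt0.
  exists (Num.min d (e1 / (4 * e))); first by rewrite lt_min d0.
  move=> [x x'] [/andP[/= xa xb] _]; rewrite le_min => /andP[x1 x2] _.
  have := hd _ x1; have := cabs_lip (Q x) (Q w) => l1 l2.
  have l3 := cabs_lip x w.
  have -> : Phi (x, x') - Phi (w, w') = (cabs (Q x) - cabs (Q w))
     + e * ((cabs x - cabs w) * (cabs x + cabs w)).
    by rewrite /Phi /=; ring.
  apply: le_trans (ler_normD _ _) _; rewrite normrM (gtr0_norm e0) normrM.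
  have n0 : 0 <= cabs x + cabs w by rewrite addr_ge0 ?cabs_ge0.
  rewrite (ger0_norm n0).
  have hx : e * `|cabs x - cabs w| <= e1 / 4.
    have : `|cabs x - cabs w| <= e1 / (4 * e) by lra.
    rewrite ler_pdivlMr ?mulr_gt0//; lra.
  have n1 := normr_ge0 (cabs x - cabs w).
  have xw : cabs x + cabs w <= 2 by lra.
  have : e * `|cabs x - cabs w| * (cabs x + cabs w) <= e1 / 4 * 2.
    by rewrite ler_pM// mulr_ge0// ltW.
  lra.
have z1m := zmax (z1, 0).
have {}zmax z : 2^-1 <= cabs z <= t -> Phi (z, 0) <= Phi (z0, z0').
  by move=> hz; apply: zmax; split; rewrite //= -[X in _ <= X](cabs0 R).
have big : q < cabs (Q z0) + e * cabs z0 ^+ 2.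
  have := zmax z1; rewrite z1a (ltW tz) => /(_ isT); rewrite /Phi /= -/q.
  have : 0 < e * cabs z1 ^+ 2 by rewrite mulr_gt0// exprn_gt0.
  lra.
have z02 : e * cabs z0 ^+ 2 <= e.
  rewrite -[X in _ <= X]mulr1 ler_wpM2l ?(ltW e0)// exprn_ile1 ?cabs_ge0//; lra.
have z0p : 0 < cabs z0 by lra.
have eE : q = 1 + 4 * e by rewrite /e; lra.
have z0in : 2^-1 < cabs z0.
  rewrite lt_neqAle z0a andbT; apply/eqP => zE.
  have : cabs (Q z0) <= 1.
    rewrite QE -zE invrK; have : cabs (h z0) ^+ n <= rho ^+ n.
      by rewrite lerXn2r ?nnegrE ?cabs_ge0// ?(le_trans (cabs_ge0 _) (hrho z0 _)) ?hrho// -zE.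
    lra.
  lra.
have z0t : cabs z0 < t.
  rewrite lt_neqAle z0b andbT; apply/eqP => zE.
  have : cabs (Q z0) <= 1 + e.
    apply: le_trans ti; rewrite QE zE -[X in _ <= X]mul1r ler_pM2r ?invr_gt0//.
    by rewrite exprn_ile1 ?cabs_ge0// h1// zE.
  lra.
pose r := Num.min (cabs z0 - 2^-1) (t - cabs z0).
have r0 : 0 < r by rewrite lt_min !subr_gt0 z0in.
have near z : cabs (z - z0) < r -> 2^-1 <= cabs z <= t.
  rewrite lt_min => /andP[n1 n2]; have := cabs_lip z z0; rewrite ler_norml; lra.
apply: (@local_maximum_contra Q z0 r e) => //.
  move=> z /near/andP[za zb]; apply: dQ; [exact: nz|lra].
by move=> z /near/zmax.
Qed.
End MaximumPrinciple.

(** * A Carleson-type area estimate *)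

Section CarlesonEstimate.
Variable R : realType.
Local Notation C := (CC R).
Local Notation R1 := (measurableTypeR R).
Local Notation R2 := (R1 * R1)%type.
Local Notation lam2 := (@lebesgue2 R).
Local Notation cRe := (@complex.Re R).
Implicit Types (f h : C -> C) (a z w : C) (r s : R).
Local Notation c := (tentc R).

Lemma measurable_sublevel d (T : measurableType d) (f : T -> R) x :
  measurable_fun setT (f : T -> R1) -> measurable [set p | f p <= x].
Proof.
move=> mf; rewrite -[X in measurable X]setTI.
have -> : [set p | f p <= x] = f @^-1` `]-oo, x]%classic.
  by apply/seteqP; split => p /=; rewrite in_itv.
by apply: mf => //; exact: measurable_itv.
Qed.

Lemma measurable_cabs_cpl a : measurable_fun setT (fun p => cabs (cpl p - a) : R1).
Proof.
have -> : (fun p => cabs (cpl p - a)) =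
   (fun p : R2 => (fun x y => cabs ((x +i* y : C) - a)) p.1 p.2).
  by apply/funext => -[x y].
apply: (@cont2_measurable R (fun x y => cabs ((x +i* y : C) - a))) => x y e e0.
exists (e / 2); first by rewrite divr_gt0.
move=> k l kk ll; apply: le_trans (cabs_lip _ _) _.
have -> : ((x + k) +i* (y + l) - a - (x +i* y - a) : C) = k +i* l by rewrite cpl_shift; ring.
by apply: le_trans (cabs_le _) _ => /=; lra.
Qed.

Lemma measurable_annulus (r : R) : measurable [set p : R2 | (r < cabs (cpl p) < 1)%R].
Proof.
have m := measurable_cabs_cpl 0.
have -> : [set p : R2 | (r < cabs (cpl p) < 1)%R] =
   ~` [set p : R2 | (cabs (cpl p - 0) <= r)%R] `&` ~` [set p : R2 | (- cabs (cpl p - 0) <= -1)%R].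
  apply/seteqP; split => [p /andP[h1 h2]|p [/negP h1 /negP h2]].
    by split => h; rewrite /mkset subr0 in h; move: h; apply/negP; rewrite -ltNge//; rewrite ltrN2.
  rewrite /mkset subr0 -ltNge in h1; rewrite /mkset subr0 -ltNge ltrN2 in h2.
  exact/andP.
apply: measurableI; apply: measurableC; apply: measurable_sublevel => //.
exact: measurableT_comp.
Qed.

Lemma disc_square (p : R2) : cabs (cpl p) < 1 -> square (-1) (-1) 2 p.
Proof.
move=> z1; split; rewrite /seg /= in_itv/=.
  have := le_lt_trans (Re_le_cabs _) z1; rewrite ltr_norml /=; lra.
have := le_lt_trans (Im_le_cabs _) z1; rewrite ltr_norml /=; lra.
Qed.

(** Four tents combine to a trapezoid in the variable s = |z|^2, nonnegative and at
    least d on an annulus, while each of them averages harmonic functions exactly. *)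
Lemma trapezoid (p q d s : R) : 0 < d -> p <= q ->
  0 <= tent (q + d) s - tent q s - tent p s + tent (p - d) s /\
  (p <= s <= q -> d <= tent (q + d) s - tent q s - tent p s + tent (p - d) s).
Proof.
move=> d0 pq; rewrite /tent.
case: (leP 0 (q + d - s)) => h1; case: (leP 0 (q - s)) => h2;
  case: (leP 0 (p - s)) => h3; case: (leP 0 (p - d - s)) => h4;
  split; move=> *; lra.
Qed.

Lemma trapezoid_out (p q d s : R) : 0 < d -> p <= q -> q + d <= s ->
  tent (q + d) s - tent q s - tent p s + tent (p - d) s = 0.
Proof. by move=> d0 pq qs; rewrite /tent !max_l; lra. Qed.

Variables (h : C -> C) (kap rho : R) (xi : C) (E : set R2).
Hypothesis hh : holo h 0 1.
Hypothesis h1 : forall z, cabs z < 1 -> cabs (h z) < 1.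
Hypothesis kap0 : 0 < kap.
Hypothesis hkap : forall z, cabs z < 1 -> kap * (1 - cabs z) <= 1 - cabs (h z).
Hypothesis rho1 : rho < 1.
Hypothesis h0 : cabs (h 0) <= rho.
Hypothesis xi1 : cabs xi < 1.
Hypothesis mE : measurable E.
Hypothesis Edisc : forall p, E p -> cabs (cpl p) < 1.
Hypothesis Enear : forall p, E p -> cabs (h (cpl p) - xi) < 1 - cabs xi.

(** The first term serves for points xi at distance at least kap / 2 from the circle,
    where the area of a square containing the disc is a sufficient bound. *)
Definition carleson_const : R := 16 / kap ^+ 2 + 72 * c / (kap * (1 - rho)).

Let eta := 1 - cabs xi.
Let eta0 : 0 < eta. Proof. by rewrite subr_gt0. Qed.
Let D := 2 * eta / kap.
Let D0 : 0 < D. Proof. by rewrite divr_gt0// mulr_gt0. Qed.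
Let rho1' : 0 < 1 - rho. Proof. by rewrite subr_gt0. Qed.

(* Re G is a positive harmonic function of size at most 1 / (1 - rho) at 0 and at
   least 1 / (9 eta) on E, while E lies in an annulus of width D = 2 eta / kap: hence
   its area is of order eta * D = eta^2. *)
Let G z : C := (1 - xi^* * h z)^-1.

Let den_gt0 z : cabs z < 1 -> eta <= cRe (1 - xi^* * h z).
Proof.
move=> z1; have := Re_le_cabs (xi^* * h z).
rewrite cabsM cabs_conj.
have := ler_wpM2l (cabs_ge0 xi) (ltW (h1 z1)).
have -> : cRe (1 - xi^* * h z) = 1 - cRe (xi^* * h z) by case: (xi^* * h z).
rewrite /eta ler_norml; lra.
Qed.

Let den_neq0 z : cabs z < 1 -> 1 - xi^* * h z != 0.
Proof.
by move=> /den_gt0 hz; apply/eqP => z0; move: hz; rewrite z0 /= leNgt eta0.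
Qed.

Let hG : holo G 0 1.
Proof.
move=> z; rewrite subr0 => z1.
apply: (@differentiable_inv R C (fun z => 1 - xi^* * h z)); last exact: den_neq0.
apply: differentiableB; first exact: differentiable_cst.
apply: differentiable_mul; first exact: differentiable_cst.
by apply: hh; rewrite subr0.
Qed.

Let ReG z : cRe (G z) = cRe (1 - xi^* * h z) / cabs (1 - xi^* * h z) ^+ 2.
Proof.
rewrite /G cabs_sqr; case: (1 - xi^* * h z) => x y /=; rewrite /GRing.inv /=.
by [].
Qed.

Let ReG_ge0 z : cabs z < 1 -> 0 <= cRe (G z).
Proof.
move=> /den_gt0 hz; rewrite ReG divr_ge0 ?sqr_ge0//.
by apply: le_trans hz; exact: ltW.
Qed.

Let ReG_0 : cRe (G 0) <= (1 - rho)^-1.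
Proof.
apply: le_trans (ler_norm _) _; apply: le_trans (Re_le_cabs _) _.
rewrite /G cabsV.
have hd : 1 - rho <= cabs (1 - xi^* * h 0).
  have := cabs_triangle 1 (xi^* * h 0); rewrite cabs1 cabsM cabs_conj.
  have := ler_pM (cabs_ge0 xi) (cabs_ge0 (h 0)) (ltW xi1) h0; lra.
by rewrite lef_pV2 ?posrE//; exact: lt_le_trans hd.
Qed.

Let ReG_E p : E p -> (9 * eta)^-1 <= cRe (G (cpl p)).
Proof.
move=> Ep; have z1 := Edisc Ep; have := den_gt0 z1; have := Enear Ep.
rewrite -/eta => hn hd; rewrite ReG.
set d := cabs (1 - xi^* * h (cpl p)).
have d3 : d <= 3 * eta.
  have -> : d = cabs ((1 - xi^* * xi) - xi^* * (h (cpl p) - xi)).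
    by rewrite /d; congr (cabs _); ring.
  apply: le_trans (cabsB _ _) _; rewrite cabsM cabs_conj.
  have -> : 1 - xi^* * xi = ((1 - cabs xi ^+ 2)%:C)%C.
    by rewrite cabs_sqr; case: (xi) => x y /=; apply/eqP; rewrite eq_complex /=; apply/andP;
      split; apply/eqP; ring.
  have x0 := cabs_ge0 xi.
  rewrite cabs_real ger0_norm; last by have := ler_pM x0 x0 (ltW xi1) (ltW xi1); rewrite expr2; lra.
  have := ler_wpM2l x0 (ltW hn); move: (xi1) => x1; rewrite /eta; nra.
have dp : 0 < d.
  have := Re_le_cabs (1 - xi^* * h (cpl p)); rewrite -/d => hr.
  by apply: lt_le_trans hr; apply: lt_le_trans (ler_norm _); exact: lt_le_trans eta0 hd.
have d29 : d ^+ 2 <= 9 * eta ^+ 2.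
  have := ler_pM (ltW dp) (ltW dp) d3 d3; rewrite -expr2; lra.
rewrite ler_pdivlMr ?exprn_gt0// mulrC ler_pdivrMr ?mulr_gt0//.
have := ler_wpM2r (ltW eta0) hd; move: (eta0); nra.
Qed.

(* on E, kap (1 - |z|) <= 1 - |h z| < 2 eta *)
Let E_annulus p : E p -> 1 - D < cabs (cpl p).
Proof.
move=> Ep; have z1 := Edisc Ep; have := hkap z1; have := Enear Ep.
have := cabs_triangle xi (h (cpl p)); rewrite (cabs_distrC xi) -/eta => t n k.
have : kap * (1 - cabs (cpl p)) < kap * D.
  have -> : kap * D = 2 * eta by rewrite /D mulrC divfK// gt_eqF.
  by rewrite /eta in n t *; lra.
by rewrite ltr_pM2l//; lra.
Qed.

(* The trapezoid weight needs room d below the unit circle, so the estimate is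
   first proved for |z|^2 <= 1 - 2 d, with a bound independent of d. *)
Let truncated_area d : D < 1 -> 0 < d -> d < (1 - D) ^+ 2 -> (1 - D) ^+ 2 <= 1 - 2 * d ->
  (lam2 (E `&` [set p | cabs (cpl p) ^+ 2 <= 1 - 2 * d]%R) <=
    (72 * c / (kap * (1 - rho)) * eta ^+ 2)%:E)%E.
Proof.
move=> D1 d0; set q2 := (1 - D) ^+ 2 => dq q2q3.
set F := E `&` _.
have sq (x : R) : 0 < x -> x < 1 -> [/\ 0 < Num.sqrt x, Num.sqrt x < 1 & Num.sqrt x ^+ 2 = x].
  move=> x0 x1; split; [by rewrite sqrtr_gt0| |by rewrite sqr_sqrtr// ltW].
  by rewrite -[X in _ < X](@sqrtr1 R) ltr_sqrt.
have [a40 a41 a4E] := sq (1 - 2 * d + d) (ltac:(lra)) (ltac:(lra)).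
have [a30 a31 a3E] := sq (1 - 2 * d) (ltac:(lra)) (ltac:(lra)).
have [a20 a21 a2E] := sq q2 (ltac:(lra)) (ltac:(lra)).
have [a10 a11 a1E] := sq (q2 - d) (ltac:(lra)) (ltac:(lra)).
have i4 := Re_cone_integrable hG a40 a41; have m4 := Re_mean_value hG a40 a41.
have i3 := Re_cone_integrable hG a30 a31; have m3 := Re_mean_value hG a30 a31.
have i2 := Re_cone_integrable hG a20 a21; have m2 := Re_mean_value hG a20 a21.
have i1 := Re_cone_integrable hG a10 a11; have m1 := Re_mean_value hG a10 a11.
pose u (p : R2) := cRe (G (cpl p)).
pose w4 p := u p * cone 0 (Num.sqrt (1 - 2 * d + d)) p.
pose w3 p := u p * cone 0 (Num.sqrt (1 - 2 * d)) p.
pose w2 p := u p * cone 0 (Num.sqrt q2) p.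
pose w1 p := u p * cone 0 (Num.sqrt (q2 - d)) p.
pose W (p : R2) := 9 * eta / d * (w4 p - w3 p - w2 p + w1 p).
have i43 := integrableB measurableT i4 i3.
have i432 := integrableB measurableT i43 i2.
have i4321 := integrableD measurableT i432 i1.
have iW : lam2.-integrable setT (EFin \o W) by exact: (integrableZl measurableT _ i4321).
have EW : \int[lam2]_p W p = 9 * eta / d * (c * cRe (G 0)) *
    ((1 - 2 * d + d) ^+ 2 - (1 - 2 * d) ^+ 2 - q2 ^+ 2 + (q2 - d) ^+ 2).
  rewrite RintegralZl// RintegralD// RintegralB// RintegralB//.
  rewrite /w4 /w3 /w2 /w1 /u m4 m3 m2 m1 -[4%N]/(2 * 2)%N !exprM a4E a3E a2E a1E.
  ring.
have pw p : (\1_F p : R) <= W p.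
  have WE : W p = 9 * eta / d * (u p * (tent (1 - 2 * d + d) (cabs (cpl p) ^+ 2)
       - tent (1 - 2 * d) (cabs (cpl p) ^+ 2) - tent q2 (cabs (cpl p) ^+ 2)
       + tent (q2 - d) (cabs (cpl p) ^+ 2))).
    rewrite /W /w4 /w3 /w2 /w1 /cone a4E a3E a2E a1E subr0; ring.
  have [t0 t1] := trapezoid (cabs (cpl p) ^+ 2) d0 q2q3.
  rewrite WE; set T := (tent _ _ - _ - _ + _) in t0 t1 *.
  have k0 : 0 < 9 * eta / d by rewrite divr_gt0// mulr_gt0.
  have [z1|z1] := ltP (cabs (cpl p)) 1; last first.
    have T0 : T = 0.
      have : 1 <= cabs (cpl p) ^+ 2 by rewrite expr_ge1 ?cabs_ge0.
      by move=> s1; apply: trapezoid_out => //; lra.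
    rewrite T0 !mulr0 indicE; case: (asboolP (F p)) => [[Ep _]|nF].
      by have := Edisc Ep; lra.
    by rewrite memNset.
  have u0 := ReG_ge0 z1.
  case: (asboolP (F p)) => [Fp|nF]; last first.
    by rewrite indicE memNset// mulr_ge0 ?(ltW k0)// mulr_ge0.
  rewrite indicE mem_set//=; case: Fp => Ep /= s3.
  have s2 : q2 <= cabs (cpl p) ^+ 2.
    by rewrite /q2 ler_pXn2r ?nnegrE ?cabs_ge0//; [exact: ltW (E_annulus Ep)|lra].
  have {}t1 : d <= T by apply: t1; rewrite s2.
  have uE := ReG_E Ep.
  have : (9 * eta)^-1 * d <= u p * T.
    by rewrite ler_pM ?(ltW d0)// invr_ge0 mulr_ge0// ltW.
  move=> /(ler_wpM2l (ltW k0)); apply: le_trans.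
  by rewrite le_eqVlt; apply/orP; left; apply/eqP; field; rewrite !gt_eqF.
have mF : measurable F.
  apply: measurableI => //.
  apply: measurable_sublevel; apply: measurable_funX.
  by have := measurable_cabs_cpl 0; under eq_fun do rewrite subr0.
have -> : lam2 F = (\int[lam2]_p (\1_F p)%:E)%E by rewrite integral_indic// setIT.
apply: (@le_trans _ _ (\int[lam2]_p W p)%:E); last first.
  rewrite lee_fin EW.
  have c0 := tentc_gt0 R.
  have -> : 9 * eta / d * (c * cRe (G 0)) *
      ((1 - 2 * d + d) ^+ 2 - (1 - 2 * d) ^+ 2 - q2 ^+ 2 + (q2 - d) ^+ 2) =
      9 * eta * c * cRe (G 0) * (2 * (1 - q2) - 2 * d) by field; rewrite gt_eqF.
  have qD : 2 * (1 - q2) - 2 * d <= 4 * D.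
    by rewrite /q2; have := sqr_ge0 D; nra.
  have e9 : 0 <= 9 * eta * c by rewrite !mulr_ge0 ?(ltW eta0) ?(ltW c0).
  have g0 : 0 <= cRe (G 0) by apply: ReG_ge0; rewrite cabs0.
  have -> : 72 * c / (kap * (1 - rho)) * eta ^+ 2 = 9 * eta * c * (1 - rho)^-1 * (4 * D).
    by rewrite /D; field; rewrite !gt_eqF.
  apply: ler_pM => //.
  - exact: mulr_ge0.
  - by lra.
  - exact: ler_wpM2l.
rewrite /Rintegral fineK; last exact: (integrable_fin_num _ iW).
apply: ge0_le_integral => //.
- by apply/measurable_EFinP; exact: measurable_indic.
- exact: measurable_int iW.
- by move=> p _; rewrite lee_fin pw.
Qed.

(** Points that h maps into the disc of centre xi and radius eta = 1 - |xi| occupy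
    an area at most a constant times eta^2; the constant depends on h only through
    kap and rho, hence is uniform over families of slices. *)
Lemma carleson_area : (lam2 E <= (carleson_const * eta ^+ 2)%:E)%E.
Proof.
have c0 := tentc_gt0 R.
have [D1|D1] := leP 1 D.
  apply: (@le_trans _ _ (lam2 (square (-1) (-1) 2))).
    apply: le_measure; rewrite ?inE//; first exact: measurable_square.
    by move=> p /Edisc; exact: disc_square.
  rewrite lam2_square// lee_fin /carleson_const mulrDl.
  have : 0 <= 72 * c / (kap * (1 - rho)) * eta ^+ 2.
    by rewrite mulr_ge0 ?sqr_ge0// divr_ge0 ?mulr_ge0 ?(ltW c0) ?(ltW kap0) ?(ltW rho1').
  have -> : 16 / kap ^+ 2 * eta ^+ 2 = 4 * D ^+ 2 by rewrite /D; field; rewrite gt_eqF.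
  have : 1 <= D ^+ 2 by rewrite expr_ge1// ltW.
  lra.
have kD0 : 0 <= 1 - D by rewrite subr_ge0 ltW.
have kD1 : 1 - D < 1 by rewrite ltrBlDr ltrDl.
pose d0 := Num.min ((1 - D) ^+ 2 / 2) ((1 - (1 - D) ^+ 2) / 4).
have d00 : 0 < d0.
  rewrite lt_min !divr_gt0 ?exprn_gt0 ?subr_gt0//.
  by rewrite exprn_ilt1//.
pose d n := d0 / n.+1%:R.
have dp n : 0 < d n by rewrite divr_gt0.
have dd n : d n <= d0 by rewrite ler_pdivrMr// ler_pMr// ler1n.
pose F n := E `&` [set p | cabs (cpl p) ^+ 2 <= 1 - 2 * d n]%R.
have EF : E = \bigcup_n F n.
  apply/seteqP; split => [p Ep|p [n _ []//]].
  have z1 := Edisc Ep.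
  have z2 : 0 < 1 - cabs (cpl p) ^+ 2.
    by rewrite subr_gt0 exprn_ilt1// cabs_ge0.
  have b0 : 0 <= 2 * d0 / (1 - cabs (cpl p) ^+ 2) by rewrite divr_ge0 ?mulr_ge0 ?ltW.
  exists (Num.bound (2 * d0 / (1 - cabs (cpl p) ^+ 2))) => //; split => //.
  set N := Num.bound _; change (is_true (cabs (cpl p) ^+ 2 <= 1 - 2 * d N)).
  have hN : 2 * d0 / (1 - cabs (cpl p) ^+ 2) < N%:R by exact: archi_boundP.
  rewrite ltr_pdivrMr// in hN.
  have : 2 * d N <= 1 - cabs (cpl p) ^+ 2.
    rewrite /d mulrA ler_pdivrMr//; apply: le_trans (ltW hN) _.
    by rewrite mulrC ler_wpM2l ?(ltW z2)// ler_nat.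
  lra.
have mF n : measurable (F n).
  apply: measurableI => //.
  apply: measurable_sublevel; apply: measurable_funX.
  by have := measurable_cabs_cpl 0; under eq_fun do rewrite subr0.
have ndF : nondecreasing_seq F.
  move=> m n mn; apply/subsetPset => p [Ep hp]; split => //.
  change (is_true (cabs (cpl p) ^+ 2 <= 1 - 2 * d m)) in hp.
  change (is_true (cabs (cpl p) ^+ 2 <= 1 - 2 * d n)).
  apply: le_trans hp _; rewrite lerD2l lerN2 ler_wpM2l// /d ler_wpM2l ?(ltW d00)//.
  by rewrite lef_pV2 ?posrE// ler_nat ltnS.
have mE' : measurable (\bigcup_n F n) by rewrite -EF.
have cv := nondecreasing_cvg_mu mF mE' ndF (mu := lam2).
rewrite {1}EF -(cvg_lim _ cv)//; apply: lime_le.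
  by apply/cvg_ex; eexists; exact: cv.
apply: nearW => n /=; apply: le_trans (truncated_area D1 (dp n) _ _) _.
- have := dd n; rewrite le_min => /andP[d1 _].
  have : 0 < (1 - D) ^+ 2 by rewrite exprn_gt0// subr_gt0.
  by lra.
- have := dd n; rewrite le_min => /andP[_ d1].
  have : (1 - D) ^+ 2 < 1 by rewrite exprn_ilt1.
  by lra.
rewrite lee_fin ler_wpM2r ?sqr_ge0// /carleson_const lerDr.
by rewrite divr_ge0// sqr_ge0.
Qed.
End CarlesonEstimate.

(** * Holomorphic functions on the bidisc *)

Section BidiscFunctions.
Variable R : realType.
Local Notation C := (CC R).
Local Notation C2 := (CC2 R).
Local Notation R1 := (measurableTypeR R).
Local Notation R2 := (R1 * R1)%type.
Local Notation R4 := (R2 * R2)%type.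
Local Notation lam2 := (@lebesgue2 R).
Local Notation lam4 := (@volume R).
Local Notation cRe := (@complex.Re R).
Local Notation cIm := (@complex.Im R).
Local Notation c := (tentc R).
Implicit Types (f : C2 -> C) (z w : C2).

Lemma bidiscE z : bidisc z <-> cabs z.1 < 1 /\ cabs z.2 < 1.
Proof. by []. Qed.

(** The bidisc in the four real coordinates that carry the volume. *)
Definition bidisc4 : set R4 := [set q | bidisc (Defs.cpoint q)].

Lemma bidisc4E (q : R4) : bidisc4 q <-> cabs (cpl q.1) < 1 /\ cabs (cpl q.2) < 1.
Proof. by []. Qed.

Lemma cpointE (q : R4) : Defs.cpoint q = (cpl q.1, cpl q.2).
Proof. by []. Qed.

Lemma cpl_near (p q : R2) (d : R) : `|q.1 - p.1| <= d / 2 -> `|q.2 - p.2| <= d / 2 ->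
  cabs (cpl q - cpl p) <= d.
Proof. by move=> h1 h2; apply: le_trans (cabs_le _) _ => /=; lra. Qed.

Lemma bidisc_open z : bidisc z -> exists2 d : R, 0 < d &
  forall w, cabs (w.1 - z.1) <= d -> cabs (w.2 - z.2) <= d -> bidisc w.
Proof.
move=> /bidiscE[z1 z2]; exists (Num.min (1 - cabs z.1) (1 - cabs z.2) / 2).
  by rewrite divr_gt0// lt_min !subr_gt0 z1.
move=> w h1 h2; apply/bidiscE.
have m1 : Num.min (1 - cabs z.1) (1 - cabs z.2) <= 1 - cabs z.1 by rewrite ge_min lexx.
have m2 : Num.min (1 - cabs z.1) (1 - cabs z.2) <= 1 - cabs z.2 by rewrite ge_min lexx orbT.
have := cabs_triangle w.1 z.1; have := cabs_triangle w.2 z.2; split; lra.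
Qed.

Lemma differentiable_cont2 f z : differentiable (f : C2 -> C) z ->
  forall e, 0 < e -> exists2 d : R, 0 < d &
    forall w, cabs (w.1 - z.1) <= d -> cabs (w.2 - z.2) <= d -> cabs (f w - f z) <= e.
Proof.
move=> /differentiable_cexpansion2[a [b hab]] e e0.
have [d d0 hd] := hab 1 ltr01.
pose K := 2 + cabs a + cabs b.
have a0 := cabs_ge0 a; have b0 := cabs_ge0 b.
have K0 : 0 < K by rewrite /K; lra.
exists (Num.min d (e / K)); first by rewrite lt_min d0 divr_gt0.
move=> w; rewrite !le_min => /andP[w1 k1] /andP[w2 k2].
have := hd (w.1 - z.1) (w.2 - z.2) w1 w2; rewrite !subrKC -surjective_pairing => h.
have -> : f w - f z = (f w - f z - a * (w.1 - z.1) - b * (w.2 - z.2))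
   + (a * (w.1 - z.1) + b * (w.2 - z.2)) by ring.
apply: le_trans (cabsD _ _) _.
have := cabsD (a * (w.1 - z.1)) (b * (w.2 - z.2)); rewrite !cabsM => h2.
have x0 := cabs_ge0 (w.1 - z.1); have y0 := cabs_ge0 (w.2 - z.2).
have q1 := ler_wpM2l a0 k1; have q2 := ler_wpM2l b0 k2.
have qE : K * (e / K) = e by rewrite mulrC divfK// gt_eqF.
have : 2 * (e / K) + cabs a * (e / K) + cabs b * (e / K) = e by rewrite -!mulrDl.
lra.
Qed.

Lemma measurable_bidisc4 : measurable bidisc4.
Proof.
apply: open4_measurable => p /bidisc_open[d d0 hd].
exists (d / 2); first by rewrite divr_gt0.
by move=> q h1 h2 h3 h4; apply: hd; exact: cpl_near.
Qed.

Lemma restrict_measurable (f : C2 -> C) (psi : C -> R) :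
  (forall x y, `|psi x - psi y| <= cabs (x - y)) -> holomorphic_on bidisc f ->
  measurable_fun setT ((fun q : R4 => psi (f (Defs.cpoint q))) \_ bidisc4 : R4 -> R1).
Proof.
move=> lpsi hf; apply/(measurable_restrictT _ measurable_bidisc4).
move=> mD; apply: (measurability _ (RGenOInfty.measurableE R)) => //.
move=> _ [_ [a ->] <-]; apply: open4_measurable.
move=> p [Bp /=]; rewrite in_itv/= andbT => ap.
have e0 : 0 < (psi (f (Defs.cpoint p)) - a) / 2 by rewrite divr_gt0// subr_gt0.
have [d1 d10 hd1] := bidisc_open Bp.
have [d2 d20 hd2] := differentiable_cont2 (hf _ Bp) e0.
exists (Num.min d1 d2 / 2); first by rewrite divr_gt0// lt_min d10.
move=> q h1 h2 h3 h4.
have k1 := cpl_near h1 h2; have k2 := cpl_near h3 h4.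
rewrite !le_min in k1 k2; have /andP[k11 k12] := k1; have /andP[k21 k22] := k2.
split; first exact: hd1.
rewrite /= in_itv/= andbT.
have := le_trans (lpsi _ _) (hd2 (Defs.cpoint q) k12 k22).
rewrite ler_norml; lra.
Qed.

(** |f|^2 extended by zero: a measurable function on the whole space. *)
Definition modsq f : R4 -> R := (fun q => cabs (f (Defs.cpoint q)) ^+ 2) \_ bidisc4.

Lemma modsq_ge0 f q : 0 <= modsq f q.
Proof. by rewrite /modsq /patch; case: ifP => // _; exact: sqr_ge0. Qed.

Lemma modsq_in f q : bidisc4 q -> modsq f q = cabs (f (Defs.cpoint q)) ^+ 2.
Proof. by move=> h; rewrite /modsq patchE mem_set. Qed.

Lemma modsq_out f q : ~ bidisc4 q -> modsq f q = 0.
Proof. by move=> h; rewrite /modsq patchE memNset. Qed.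

Lemma modsq_measurable f : holomorphic_on bidisc f -> measurable_fun setT (modsq f : R4 -> R1).
Proof.
move=> hf; have := restrict_measurable (@cabs_lip R) hf.
set g := (_ \_ _) => mg.
have -> : modsq f = fun q => g q ^+ 2.
  by apply/funext => q; rewrite /modsq /g /patch; case: ifP => // _; rewrite expr0n.
exact: measurable_funX.
Qed.

Lemma sqnormE f : sqnorm f = (\int[lam4]_q (modsq f q)%:E)%E.
Proof.
rewrite /sqnorm integral_mkcond; apply: eq_integral => q _.
by rewrite /modsq !patchE; case: ifP.
Qed.

Lemma holo_slice1 f (y : C) : holomorphic_on bidisc f -> cabs y < 1 ->
  holo (fun x => f (x, y)) 0 1.
Proof.
move=> hf y1 x; rewrite subr0 => x1.
apply: (@differentiable_comp _ C C2 C (fun x => (x, y)) f x); last exact: hf.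
apply: differentiable_pair; first exact: ex_diff.
exact: differentiable_cst.
Qed.

Lemma holo_slice2 f (x : C) : holomorphic_on bidisc f -> cabs x < 1 ->
  holo (fun y => f (x, y)) 0 1.
Proof.
move=> hf x1 y; rewrite subr0 => y1.
apply: (@differentiable_comp _ C C2 C (fun y => (x, y)) f y); last exact: hf.
apply: differentiable_pair; last exact: ex_diff.
exact: differentiable_cst.
Qed.

Lemma submean_sq (g : C -> C) (a : C) (r s : R) : holo g a r -> 0 < s -> s < r ->
  ((s ^+ 4 * c * cabs (g a) ^+ 2)%:E <=
   \int[lam2]_p (cabs (g (cpl p)) ^+ 2 * cone a s p)%:E)%E.
Proof.
move=> hg s0 sr.
have h2 : holo (fun z : C => g z ^+ 2) a r.
  by move=> z /hg; exact: differentiable_pow.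
have := submean h2 s0 sr; rewrite cabsX => /le_trans; apply.
by under [leRHS]eq_integral do rewrite -cabsX.
Qed.

Lemma cone_measurable (a : C) s : measurable_fun setT (cone a s : R2 -> R1).
Proof.
have -> : cone a s =
    (fun p : R2 => (fun x y => tent (s ^+ 2) (sqd (cRe a) (cIm a) x y)) p.1 p.2).
  by apply/funext => p; rewrite coneE.
apply: (@cont2_measurable R (fun x y => tent (s ^+ 2) (sqd (cRe a) (cIm a) x y))) => x y.
by apply: cont2_lip_comp; [exact: tent_lip|exact: sqd_cont].
Qed.

(** The sub-mean value property of |f|^2, in one variable and then in the other, by Tonelli. *)
Lemma submean2 f w (s1 s2 : R) : holomorphic_on bidisc f -> 0 < s1 -> 0 < s2 ->
  cabs w.1 + s1 < 1 -> cabs w.2 + s2 < 1 ->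
  ((s1 ^+ 4 * c * (s2 ^+ 4 * c) * cabs (f w) ^+ 2)%:E <=
   \int[lam4]_q (modsq f q * (cone w.1 s1 q.1 * cone w.2 s2 q.2))%:E)%E.
Proof.
move=> hf s10 s20 w1 w2.
have c0 := tentc_gt0 R.
have w11 : cabs w.1 < 1 by lra.
have w21 : cabs w.2 < 1 by lra.
have mF : measurable_fun setT (fun q : R4 => (modsq f q * (cone w.1 s1 q.1 * cone w.2 s2 q.2))%:E).
  apply/measurable_EFinP; apply: measurable_funM; first exact: modsq_measurable.
  by apply: measurable_funM; [exact: measurableT_comp (cone_measurable _ _) measurable_fst
                             |exact: measurableT_comp (cone_measurable _ _) measurable_snd].
have F0 q : (0 <= (modsq f q * (cone w.1 s1 q.1 * cone w.2 s2 q.2))%:E)%E.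
  by rewrite lee_fin mulr_ge0 ?modsq_ge0// mulr_ge0 ?cone_ge0.
rewrite /volume (fubini_tonelli1 _ mF F0) /fubini_F.
have hsl (g : C -> C) (a : C) s : holo g 0 1 -> cabs a + s < 1 -> 0 < s -> holo g a (1 - cabs a).
  by move=> hg h s0; apply: (holo_sub hg); rewrite subr0 subrKC.
have w1r : s1 < 1 - cabs w.1 by lra.
have w2r : s2 < 1 - cabs w.2 by lra.
have S1 := submean_sq (hsl _ _ _ (holo_slice1 hf w21) w1 s10) s10 w1r.
apply: (@le_trans _ _ (\int[lam2]_p ((s2 ^+ 4 * c)%:E *
     (cabs (f (cpl p, w.2)) ^+ 2 * cone w.1 s1 p)%:E))%E).
  rewrite ge0_integralZl//; last 3 first.
  - have h2 : holo (fun x => f (x, w.2) ^+ 2) w.1 (1 - cabs w.1).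
      by move=> z /(hsl _ _ _ (holo_slice1 hf w21) w1 s10); exact: differentiable_pow.
    have := cabs_cone_measurable (ltW s10) w1r h2.
    by under eq_fun do rewrite cabsX; move=> ?; exact/measurable_EFinP.
  - by move=> p _; rewrite lee_fin mulr_ge0 ?sqr_ge0 ?cone_ge0.
  - by rewrite lee_fin mulr_ge0 ?(ltW c0)// exprn_ge0// ltW.
  apply: le_trans (lee_wpmul2l _ S1).
    rewrite -EFinM -surjective_pairing lee_fin le_eqVlt; apply/orP; left; apply/eqP; ring.
  by rewrite lee_fin mulr_ge0 ?(ltW c0)// exprn_ge0// ltW.
apply: ge0_le_integral => //.
- move=> p _; rewrite -EFinM lee_fin mulr_ge0//.
    by rewrite mulr_ge0 ?(ltW c0)// exprn_ge0// ltW.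
  by rewrite mulr_ge0 ?sqr_ge0 ?cone_ge0.
- apply: emeasurable_funM; first exact: measurable_cst.
  have h2 : holo (fun x => f (x, w.2) ^+ 2) w.1 (1 - cabs w.1).
    by move=> z /(hsl _ _ _ (holo_slice1 hf w21) w1 s10); exact: differentiable_pow.
  have := cabs_cone_measurable (ltW s10) w1r h2.
  by under eq_fun do rewrite cabsX; move=> ?; exact/measurable_EFinP.
- exact: (measurable_fun_fubini_tonelli_F _ mF F0).
move=> p _.
have [p1|p1] := leP s1 (cabs (cpl p - w.1)).
  rewrite (cone_out (ltW s10) p1) mulr0 mule0.
  by apply: integral_ge0 => q _; rewrite mul0r mulr0.
have pd : cabs (cpl p) < 1.
  have := cabs_triangle (cpl p) w.1.
  lra.
have S2 := submean_sq (hsl _ _ _ (holo_slice2 hf pd) w2 s20) s20 w2r.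
have -> : ((s2 ^+ 4 * c)%:E * (cabs (f (cpl p, w.2)) ^+ 2 * cone w.1 s1 p)%:E)%E =
  ((cone w.1 s1 p)%:E * (s2 ^+ 4 * c * cabs (f (cpl p, w.2)) ^+ 2)%:E)%E.
  by rewrite -!EFinM; congr EFin; ring.
apply: le_trans (lee_wpmul2l _ S2) _; first by rewrite lee_fin cone_ge0.
rewrite -ge0_integralZl//; last 3 first.
- have h2 : holo (fun y => f (cpl p, y) ^+ 2) w.2 (1 - cabs w.2).
    by move=> z /(hsl _ _ _ (holo_slice2 hf pd) w2 s20); exact: differentiable_pow.
  have := cabs_cone_measurable (ltW s20) w2r h2.
  by under eq_fun do rewrite cabsX; move=> ?; exact/measurable_EFinP.
- by move=> q _; rewrite lee_fin mulr_ge0 ?sqr_ge0 ?cone_ge0.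
- by rewrite lee_fin cone_ge0.
rewrite le_eqVlt; apply/orP; left; apply/eqP.
apply: eq_integral => q _; rewrite -EFinM; congr EFin => /=.
have [q1|q1] := leP s2 (cabs (cpl q - w.2)).
  by rewrite (cone_out (ltW s20) q1) !mulr0.
have qd : cabs (cpl q) < 1.
  by have := cabs_triangle (cpl q) w.2; lra.
rewrite modsq_in ?bidisc4E// cpointE /=; ring.
Qed.
End BidiscFunctions.

(** * Kernels as test functions *)

Section ProductIntegral.
Local Open Scope ereal_scope.
(** Applied to products of lines and then to products of planes. *)
Lemma product_integral_le d1 d2 (T1 : measurableType d1) (T2 : measurableType d2)
  (R : realType) (m1 : {sigma_finite_measure set T1 -> \bar R})
  (m2 : {sigma_finite_measure set T2 -> \bar R}) (f : T1 -> R) (g : T2 -> R) (a b : R) :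
  measurable_fun setT f -> measurable_fun setT g ->
  (forall x, (0 <= f x)%R) -> (forall y, (0 <= g y)%R) -> (0 <= a)%R -> (0 <= b)%R ->
  \int[m1]_x (f x)%:E <= a%:E -> \int[m2]_y (g y)%:E <= b%:E ->
  \int[m1 \x m2]_p (f p.1 * g p.2)%:E <= (a * b)%:E.
Proof.
move=> mf mg f0 g0 a0 b0 fa gb.
have mfg : measurable_fun setT (fun p : T1 * T2 => (f p.1 * g p.2)%:E).
  apply/measurable_EFinP; apply: measurable_funM.
    exact: (measurableT_comp mf measurable_fst).
  exact: (measurableT_comp mg measurable_snd).
have fg0 p : 0 <= (f p.1 * g p.2)%:E by rewrite lee_fin mulr_ge0.
rewrite (fubini_tonelli1 _ mfg fg0) /fubini_F /=.
apply: (@le_trans _ _ (\int[m1]_x ((f x)%:E * b%:E))).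
  apply: ge0_le_integral => //.
  - by move=> x _; apply: integral_ge0 => y _; rewrite lee_fin mulr_ge0.
  - exact: (measurable_fun_fubini_tonelli_F _ mfg fg0).
  - by apply: emeasurable_funM; [exact/measurable_EFinP|exact: measurable_cst].
  move=> x _; under eq_integral do rewrite EFinM.
  rewrite ge0_integralZl//; last 2 first.
  - by move=> y _; rewrite lee_fin.
  - by rewrite lee_fin.
    by apply: lee_wpmul2l; rewrite ?lee_fin.
  exact/measurable_EFinP.
rewrite ge0_integralZr//; last by move=> x _; rewrite lee_fin.
  by rewrite EFinM; apply: lee_wpmul2r; rewrite ?lee_fin.
exact/measurable_EFinP.
Qed.
End ProductIntegral.

Section TestFunctions.
Variable R : realType.
Local Notation C := (CC R).
Local Notation C2 := (CC2 R).
Local Notation R1 := (measurableTypeR R).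
Local Notation R2 := (R1 * R1)%type.
Local Notation R4 := (R2 * R2)%type.
Local Notation lam1 := (@lebesgue_measure R).
Local Notation lam2 := (@lebesgue2 R).
Local Notation lam4 := (@volume R).
Local Notation cRe := (@complex.Re R).
Local Notation cIm := (@complex.Im R).

(** The Poisson kernel of a half plane, up to a factor: integral at most pi for every d. *)
Definition cauchy_density (d a x : R) : R := d / ((x - a) ^+ 2 + d ^+ 2).

Lemma cauchy_density_ge0 d a x : 0 < d -> 0 <= cauchy_density d a x.
Proof. by move=> d0; rewrite divr_ge0 ?(ltW d0)// addr_ge0 ?sqr_ge0. Qed.

Lemma cauchy_density_continuous d a : 0 < d -> continuous (cauchy_density d a).
Proof.
move=> d0 x; apply: cvgM; first exact: cvg_cst.
apply: cvgV; first by rewrite gt_eqF// ltr_wpDl ?sqr_ge0// exprn_gt0.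
apply: cvgD; last exact: cvg_cst.
have c1 : (y - a) @[y --> x] --> x - a by apply: cvgB; [exact: cvg_id|exact: cvg_cst].
exact: (cvgM c1 c1).
Qed.

Lemma cauchy_density_integral (d a : R) : 0 < d ->
  (\int[lam1]_(x in `[(-1)%R, 1%R]) (cauchy_density d a x)%:E <= (pi : R)%:E)%E.
Proof.
move=> d0; pose F := (@atan R) \o (fun x => d^-1 * (x - a)).
have dF (x : R) : is_derive x (1 : R) (F : R -> R) (cauchy_density d a x).
  have h : is_derive x (1 : R) (fun x => d^-1 * (x - a)) (d^-1 * (1 - 0)).
    have := @is_deriveZ R R R (fun x : R => x - a) d^-1 x 1 (1 - 0).
    by apply; apply: is_deriveB.
  have := @is_derive1_comp R (@atan R) (fun x => d^-1 * (x - a)) x _ _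
    (is_derive1_atan (d^-1 * (x - a))) h.
  congr (is_derive _ _ _ _); rewrite /cauchy_density; field.
  by rewrite !gt_eqF// ltr_wpDl ?sqr_ge0// exprn_gt0.
have cF (x : R) : {for x, continuous (F : R -> R)}.
  have [dx _] := dF x.
  by apply: differentiable_continuous; apply/derivable1_diffP.
rewrite (@continuous_FTC2 _ _ F); last 1 first.
- by move=> x _; rewrite derive1E; have [_ ->] := dF x.
- by rewrite -EFinB lee_fin /F /=; have := atan_ltpi2 (d^-1 * (1 - a));
    have := atan_gtNpi2 (d^-1 * (-1 - a)); lra.
- lra.
- by apply: continuous_subspaceT => x; exact: cauchy_density_continuous.
- split.
  + by move=> x _; have [] := dF x.
  + by apply: cvg_at_right_filter; exact: cF.
  + by apply: cvg_at_left_filter; exact: cF.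
Qed.

Definition cauchy_cut d a (x : R1) : R1 := (cauchy_density d a) \_ `[-1, 1] x.

Lemma cauchy_cut_ge0 d a x : 0 < d -> 0 <= cauchy_cut d a x.
Proof. by move=> d0; rewrite /cauchy_cut /patch; case: ifP => // _; exact: cauchy_density_ge0. Qed.

Lemma cauchy_cut_measurable d a : 0 < d -> measurable_fun setT (cauchy_cut d a).
Proof.
move=> d0; have mI : measurable (`[-1, 1]%classic : set R1) by exact: measurable_itv.
apply/(measurable_restrictT (cauchy_density d a : R1 -> R1) mI).
by apply: measurable_funTS; apply: continuous_measurable_fun; exact: cauchy_density_continuous.
Qed.

Lemma cauchy_cut_integral (d a : R) : 0 < d -> (\int[lam1]_x (cauchy_cut d a x)%:E <= (pi : R)%:E)%E.
Proof.
move=> d0; have := cauchy_density_integral a d0.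
by rewrite integral_mkcond restrict_EFin.
Qed.

(** A product of one-dimensional densities that dominates the square of a
    reproducing kernel, and whose integral factors. *)
Definition plane_cut d (a : C) (p : R2) : R := cauchy_cut d (cRe a) p.1 * cauchy_cut d (cIm a) p.2.

Lemma plane_cut_ge0 d a p : 0 < d -> 0 <= plane_cut d a p.
Proof. by move=> d0; rewrite mulr_ge0// cauchy_cut_ge0. Qed.

Lemma plane_cut_measurable d a : 0 < d -> measurable_fun setT (plane_cut d a : R2 -> R1).
Proof.
move=> d0; apply: measurable_funM.
  exact: (measurableT_comp (cauchy_cut_measurable _ d0) measurable_fst).
exact: (measurableT_comp (cauchy_cut_measurable _ d0) measurable_snd).
Qed.

Lemma plane_cut_integral (d : R) (a : C) : 0 < d ->
  (\int[lam2]_p (plane_cut d a p)%:E <= ((pi * pi : R))%:E)%E.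
Proof.
move=> d0; apply: product_integral_le; rewrite ?pi_ge0//.
- exact: cauchy_cut_measurable.
- exact: cauchy_cut_measurable.
- by move=> x; exact: cauchy_cut_ge0.
- by move=> x; exact: cauchy_cut_ge0.
- exact: cauchy_cut_integral.
- exact: cauchy_cut_integral.
Qed.

(** The reproducing kernel of the Bergman space of the disc at a, normalized up to a constant factor. *)
Definition kernel1 (a x : C) : C := (1 - cabs a ^+ 2)%:C * (1 - a^* * x) ^- 2.

Definition test_function (w z : C2) : C := kernel1 w.1 z.1 * kernel1 w.2 z.2.

(** |1 - a^* x|^2 = |x - a|^2 + (1 - |a|^2)(1 - |x|^2), combined with the lower
    bound by 1 - |a|. *)
Lemma kernel_den_ge (a x : C) : cabs a < 1 -> cabs x < 1 ->
  ((cabs (x - a) ^+ 2) + (1 - cabs a) ^+ 2) / 2 <= cabs (1 - a^* * x) ^+ 2 /\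
  1 - cabs x <= cabs (1 - a^* * x) /\ 1 - cabs a <= cabs (1 - a^* * x).
Proof.
move=> a1 x1.
have a0 := cabs_ge0 a; have x0 := cabs_ge0 x.
have t : 1 - cabs a * cabs x <= cabs (1 - a^* * x).
  by have := cabs_triangle 1 (a^* * x); rewrite cabs1 cabsM cabs_conj.
have ta : 1 - cabs a <= cabs (1 - a^* * x) by nra.
have tx : 1 - cabs x <= cabs (1 - a^* * x) by nra.
split => //.
have key (b y : C) :
    cabs (1 - b^* * y) ^+ 2 = cabs (y - b) ^+ 2 + (1 - cabs b ^+ 2) * (1 - cabs y ^+ 2).
  by rewrite !cabs_sqr; case: b => b1 b2; case: y => y1 y2 /=; ring.
have id := key a x.
have p0 : 0 <= (1 - cabs a ^+ 2) * (1 - cabs x ^+ 2).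
  by rewrite mulr_ge0// subr_ge0 exprn_ile1// ltW.
have : (1 - cabs a) ^+ 2 <= cabs (1 - a^* * x) ^+ 2.
  by rewrite ler_pXn2r ?nnegrE ?subr_ge0 ?cabs_ge0// ltW.
lra.
Qed.

Lemma kernel_den_neq0 (a x : C) : cabs a < 1 -> cabs x < 1 -> 1 - a^* * x != 0.
Proof.
move=> a1 x1; have [_ [_ h]] := kernel_den_ge a1 x1.
by apply/eqP => h0; move: h; rewrite h0 cabs0; lra.
Qed.

Lemma cabs_kernel1 (a x : C) : cabs a < 1 ->
  cabs (kernel1 a x) = (1 - cabs a ^+ 2) / cabs (1 - a^* * x) ^+ 2.
Proof.
move=> a1; rewrite /kernel1 cabsM cabs_real cabsV cabsX ger0_norm//.
by rewrite subr_ge0 exprn_ile1 ?cabs_ge0// ltW.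
Qed.

Lemma kernel1_holo (a : C) : cabs a < 1 -> holo (kernel1 a) 0 1.
Proof.
move=> a1 x; rewrite subr0 => x1; apply: differentiable_mul.
  exact: differentiable_cst.
apply: (@differentiable_inv R C (fun x => (1 - a^* * x) ^+ 2)).
  apply: differentiable_pow; apply: differentiableB; first exact: differentiable_cst.
  by apply: differentiable_mul; [exact: differentiable_cst|exact: ex_diff].
by rewrite expf_neq0// kernel_den_neq0.
Qed.

Lemma test_function_holo (w : C2) : bidisc w -> holomorphic_on bidisc (test_function w).
Proof.
move=> [w1 w2] z [z1 z2]; apply: differentiable_mul.
  apply: (@differentiable_comp _ C2 C C fst (kernel1 w.1) z).
    by apply: linear_differentiable => ?; exact: cvg_fst.
  by apply: kernel1_holo => //; rewrite subr0.
apply: (@differentiable_comp _ C2 C C snd (kernel1 w.2) z).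
  by apply: linear_differentiable => ?; exact: cvg_snd.
by apply: kernel1_holo => //; rewrite subr0.
Qed.

(** With X, Y the squares of the coordinates of x - a and d = 1 - |a|:
    (X + Y + d^2)^2 >= (X + d^2)(Y + d^2). *)
Lemma kernel1_bound (a : C) (p : R2) : cabs a < 1 -> cabs (cpl p) < 1 ->
  cabs (kernel1 a (cpl p)) ^+ 2 <= 16 * plane_cut (1 - cabs a) a p.
Proof.
move=> a1 p1; rewrite cabs_kernel1//.
have [h _] := kernel_den_ge a1 p1.
set D := cabs (1 - _) ^+ 2 in h *; set d := 1 - cabs a in h *.
have d0 : 0 < d by rewrite subr_gt0.
have a0 := cabs_ge0 a.
have in1 (f : C -> R) : (forall z, `|f z| <= cabs z) -> f (cpl p) \in `[(-1), 1].
  by move=> hf; have := le_lt_trans (hf _) p1; rewrite in_itv/= ltr_norml => /andP[? ?]; apply/andP; split; apply: ltW.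
have i1 := in1 _ (@Re_le_cabs R); have i2 := in1 _ (@Im_le_cabs R).
rewrite /plane_cut /cauchy_cut !patchE !mem_set// /cauchy_density.
have := cabs_sqr (cpl p - a).
have -> : cRe (cpl p - a) = p.1 - cRe a by case: (a).
have -> : cIm (cpl p - a) = p.2 - cIm a by case: (a).
set X := (p.1 - cRe a) ^+ 2; set Y := (p.2 - cIm a) ^+ 2 => E.
rewrite E in h.
have X0 : 0 <= X by exact: sqr_ge0.
have Y0 : 0 <= Y by exact: sqr_ge0.
have d2 : 0 < d ^+ 2 by rewrite exprn_gt0.
have D0 : 0 < D by lra.
have num : 1 - cabs a ^+ 2 <= 2 * d by rewrite /d; nra.
have num0 : 0 <= 1 - cabs a ^+ 2 by rewrite subr_ge0 exprn_ile1// ltW.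
have s1 : ((1 - cabs a ^+ 2) / D) ^+ 2 <= (2 * d) ^+ 2 / D ^+ 2.
  rewrite expr_div_n; apply: ler_wpM2r; first by rewrite invr_ge0 sqr_ge0.
  by rewrite ler_pXn2r ?nnegrE// mulr_ge0// ltW.
apply: le_trans s1 _.
have XYp : 0 < (X + d ^+ 2) * (Y + d ^+ 2) by rewrite mulr_gt0// ltr_wpDl.
have -> : 16 * (d / (X + d ^+ 2) * (d / (Y + d ^+ 2))) =
   16 * d ^+ 2 / ((X + d ^+ 2) * (Y + d ^+ 2)).
  by field; rewrite !gt_eqF// ltr_wpDl.
have -> : (2 * d) ^+ 2 / D ^+ 2 = 16 * d ^+ 2 / (4 * D ^+ 2) by field; rewrite gt_eqF.
apply: ler_wpM2l; first by rewrite mulr_ge0// ltW.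
have D4 : 0 < 4 * D ^+ 2 by rewrite mulr_gt0// exprn_gt0.
rewrite lef_pV2 ?posrE//.
have : (X + Y + d ^+ 2) ^+ 2 <= (2 * D) ^+ 2.
  have q1 : X + Y + d ^+ 2 <= 2 * D by lra.
  have q2 : 0 <= X + Y + d ^+ 2 by rewrite !addr_ge0 ?sqr_ge0.
  by rewrite ler_pXn2r ?nnegrE ?(le_trans q2 q1).
nra.
Qed.

Definition test_bound : R := 256 * ((pi * pi) * (pi * pi)).

(** The bound is uniform in w, which is what makes these functions test compactness. *)
Lemma test_function_sqnorm (w : C2) : bidisc w ->
  (sqnorm (test_function w) <= test_bound%:E)%E.
Proof.
move=> bw; have [w1 w2] := bw; rewrite sqnormE.
have d1 : 0 < 1 - cabs w.1 by rewrite subr_gt0.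
have d2 : 0 < 1 - cabs w.2 by rewrite subr_gt0.
have m1 := plane_cut_measurable w.1 d1; have m2 := plane_cut_measurable w.2 d2.
have mP : measurable_fun setT (fun q : R4 =>
    (plane_cut (1 - cabs w.1) w.1 q.1 * plane_cut (1 - cabs w.2) w.2 q.2)%:E).
  apply/measurable_EFinP; apply: measurable_funM.
    exact: (measurableT_comp m1 measurable_fst).
  exact: (measurableT_comp m2 measurable_snd).
apply: (@le_trans _ _ (\int[lam4]_q (256%:E *
    (plane_cut (1 - cabs w.1) w.1 q.1 * plane_cut (1 - cabs w.2) w.2 q.2)%:E))%E).
  apply: ge0_le_integral => //.
  - by move=> q _; rewrite lee_fin modsq_ge0.
  - by apply/measurable_EFinP; apply: modsq_measurable; exact: test_function_holo.
  - by apply: emeasurable_funM => //; exact: measurable_cst.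
  move=> q _; rewrite -EFinM lee_fin.
  have [Bq|nB] := pselect (bidisc4 q); last first.
    by rewrite modsq_out// mulr_ge0// mulr_ge0// plane_cut_ge0.
  have [q1 q2] := Bq.
  rewrite modsq_in// /test_function cabsM exprMn cpointE /=.
  have -> : 256 * (plane_cut (1 - cabs w.1) w.1 q.1 * plane_cut (1 - cabs w.2) w.2 q.2) =
    (16 * plane_cut (1 - cabs w.1) w.1 q.1) * (16 * plane_cut (1 - cabs w.2) w.2 q.2) by ring.
  by rewrite ler_pM ?sqr_ge0//; exact: kernel1_bound.
rewrite ge0_integralZl//; last by move=> q _; rewrite lee_fin mulr_ge0// plane_cut_ge0.
rewrite /test_bound EFinM lee_wpmul2l ?lee_fin//.
apply: product_integral_le; rewrite ?mulr_ge0 ?pi_ge0//.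
- by move=> p; exact: plane_cut_ge0.
- by move=> p; exact: plane_cut_ge0.
- exact: plane_cut_integral.
- exact: plane_cut_integral.
Qed.

Lemma test_function_bergman (w : C2) : bidisc w -> bergman (test_function w).
Proof.
move=> bw; split; first exact: test_function_holo.
by apply: le_lt_trans (test_function_sqnorm bw) _; rewrite ltry.
Qed.
End TestFunctions.

(** * The Bergman norm and a compactness test *)

Section BergmanSpace.
Variable R : realType.
Local Notation C := (CC R).
Local Notation C2 := (CC2 R).
Local Notation lam4 := (@volume R).
Local Notation c := (tentc R).
Implicit Types (f g : C2 -> C) (z w : C2).

Lemma cone_le (a : C) (s : R) p : cone a s p <= s ^+ 2.
Proof. by rewrite /cone /tent ge_max sqr_ge0/= lerBlDr lerDl sqr_ge0. Qed.

Lemma sqnorm_ge0 f : (0 <= sqnorm f)%E.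
Proof. by apply: integral_ge0 => q _; rewrite lee_fin sqr_ge0. Qed.

(** The sub-mean value property on the polydisc of half the distance to the boundary. *)
Lemma point_evaluation f w : holomorphic_on bidisc f -> bidisc w ->
  (((c / 4 * ((1 - cabs w.1) * (1 - cabs w.2))) ^+ 2 * cabs (f w) ^+ 2)%:E <= sqnorm f)%E.
Proof.
move=> hf /bidiscE[w1 w2]; have c0 := tentc_gt0 R.
pose s1 := (1 - cabs w.1) / 2; pose s2 := (1 - cabs w.2) / 2.
have s10 : 0 < s1 by rewrite divr_gt0// subr_gt0.
have s20 : 0 < s2 by rewrite divr_gt0// subr_gt0.
have e1 : cabs w.1 + s1 < 1 by rewrite /s1; lra.
have e2 : cabs w.2 + s2 < 1 by rewrite /s2; lra.
have S := submean2 hf s10 s20 e1 e2.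
have k0 : 0 < s1 ^+ 2 * s2 ^+ 2 by rewrite mulr_gt0// exprn_gt0.
have mM := modsq_measurable hf.
have : ((s1 ^+ 4 * c * (s2 ^+ 4 * c) * cabs (f w) ^+ 2)%:E <=
    (s1 ^+ 2 * s2 ^+ 2)%:E * sqnorm f)%E.
  apply: (le_trans S).
  rewrite sqnormE -ge0_integralZl//; last 3 first.
  - exact/measurable_EFinP.
  - by move=> q _; rewrite lee_fin modsq_ge0.
  - by rewrite lee_fin ltW.
  apply: ge0_le_integral => //.
  - by move=> q _; rewrite lee_fin mulr_ge0 ?modsq_ge0// mulr_ge0 ?cone_ge0.
  - apply/measurable_EFinP; apply: measurable_funM => //.
    by apply: measurable_funM; [exact: measurableT_comp (cone_measurable _ _) measurable_fst
                             |exact: measurableT_comp (cone_measurable _ _) measurable_snd].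
  - by apply: emeasurable_funM; [exact: measurable_cst|exact/measurable_EFinP].
  move=> q _; rewrite -EFinM lee_fin mulrC ler_wpM2r ?modsq_ge0//.
  by rewrite ler_pM ?cone_ge0// cone_le.
rewrite -lee_pdivrMl//; apply: le_trans.
rewrite -EFinM lee_fin le_eqVlt; apply/orP; left; apply/eqP.
rewrite /s1 /s2; field.
by rewrite !gt_eqF// subr_gt0.
Qed.

Lemma cabs_sqrD (x y : C) : cabs (x - y) ^+ 2 <= 2 * cabs x ^+ 2 + 2 * cabs y ^+ 2.
Proof.
have h := cabsB x y; have x0 := cabs_ge0 x; have y0 := cabs_ge0 y.
have : cabs (x - y) ^+ 2 <= (cabs x + cabs y) ^+ 2.
  by rewrite ler_pXn2r ?nnegrE ?cabs_ge0// addr_ge0.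
have := sqr_ge0 (cabs x - cabs y); nra.
Qed.

Lemma holomorphic_sub f g : holomorphic_on bidisc f -> holomorphic_on bidisc g ->
  holomorphic_on bidisc (fun z => f z - g z).
Proof. by move=> hf hg z Bz; apply: differentiableB; [exact: hf|exact: hg]. Qed.

Lemma sqnorm_sub f g : holomorphic_on bidisc f -> holomorphic_on bidisc g ->
  (sqnorm (fun z => f z - g z)%R <= 2%:E * sqnorm f + 2%:E * sqnorm g)%E.
Proof.
move=> hf hg; rewrite !sqnormE.
have mf := modsq_measurable hf; have mg := modsq_measurable hg.
have i2 (h : C2 -> C) : holomorphic_on bidisc h ->
    (2%:E * \int[lam4]_q (modsq h q)%:E = \int[lam4]_q (2%:E * (modsq h q)%:E))%E.
  move=> hh; rewrite ge0_integralZl//.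
  - by apply/measurable_EFinP; exact: modsq_measurable.
  - by move=> q _; rewrite lee_fin modsq_ge0.
rewrite !i2// -ge0_integralD//; last 4 first.
- by move=> q _; rewrite -EFinM lee_fin mulr_ge0// modsq_ge0.
- by apply: emeasurable_funM; [exact: measurable_cst|exact/measurable_EFinP].
- by move=> q _; rewrite -EFinM lee_fin mulr_ge0// modsq_ge0.
- by apply: emeasurable_funM; [exact: measurable_cst|exact/measurable_EFinP].
apply: ge0_le_integral => //.
- by move=> q _; rewrite lee_fin modsq_ge0.
- by apply/measurable_EFinP; apply: modsq_measurable; exact: holomorphic_sub.
- by apply: emeasurable_funD; apply: emeasurable_funM;
    [exact: measurable_cst|exact/measurable_EFinP|exact: measurable_cst|exact/measurable_EFinP].
move=> q _; rewrite -!EFinM -EFinD lee_fin.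
have [Bq|nB] := pselect (bidisc4 q); last by rewrite !modsq_out// !mulr0 addr0.
by rewrite !modsq_in//; exact: cabs_sqrD.
Qed.

Lemma bergman_sub f g : bergman f -> bergman g -> bergman (fun z => f z - g z).
Proof.
move=> [hf f1] [hg g1]; split; first exact: holomorphic_sub.
apply: (le_lt_trans (sqnorm_sub hf hg)).
by apply: lte_add_pinfty; rewrite lte_mul_pinfty// ge0_fin_numE.
Qed.

Lemma bergman_sqnorm f : bergman f -> sqnorm f = (bergman_norm f ^+ 2)%:E.
Proof.
move=> [_ f1]; rewrite /bergman_norm sqr_sqrtr ?fineK//.
  by rewrite ge0_fin_numE// sqnorm_ge0.
by rewrite fine_ge0// sqnorm_ge0.
Qed.

Lemma bergman_norm_le f (B : R) : 0 <= B -> (sqnorm f <= B%:E)%E ->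
  bergman_norm f <= Num.sqrt B.
Proof.
move=> B0 h; rewrite /bergman_norm ler_wsqrtr// -lee_fin fineK//.
by rewrite ge0_fin_numE ?sqnorm_ge0//; apply: le_lt_trans h _; rewrite ltry.
Qed.

Lemma point_evaluation_norm f w : bergman f -> bidisc w ->
  c / 4 * ((1 - cabs w.1) * (1 - cabs w.2)) * cabs (f w) <= bergman_norm f.
Proof.
move=> bf bw; have := point_evaluation bf.1 bw; rewrite bergman_sqnorm// lee_fin -exprMn.
have [w1 w2] := bw; rewrite ler_pXn2r// nnegrE ?sqrtr_ge0//.
by rewrite !mulr_ge0 ?cabs_ge0 ?subr_ge0 ?invr_ge0 ?(ltW (tentc_gt0 R))// ltW.
Qed.
End BergmanSpace.

Section Necessity.
Variable R : realType.
Local Notation C := (CC R).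
Local Notation C2 := (CC2 R).
Local Notation c := (tentc R).
Variables (phi : C2 -> C2) (zn : nat -> C2) (k : R).
Hypothesis phi_self : forall z, bidisc z -> bidisc (phi z).
Hypothesis compact : compact_on_bergman (composition_operator phi).
Hypothesis zn_in : forall n, bidisc (zn n).
(* the product of the distances of the coordinates of phi (z_n) to the circle *)
Let e n := (1 - cabs (phi (zn n)).1) * (1 - cabs (phi (zn n)).2).
Hypothesis k0 : 0 < k.
Hypothesis ratio : forall n, k * e n <= (1 - cabs (zn n).1) * (1 - cabs (zn n).2).
Hypothesis e_small : forall r, 0 < r -> exists N, forall n, (N <= n)%N -> e n <= r.

Let e_gt0 n : 0 < e n.
Proof. by have [h1 h2] := phi_self (zn_in n); rewrite mulr_gt0// subr_gt0. Qed.

Lemma test_function_small (w x : C2) : bidisc w -> bidisc x ->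
  cabs (test_function w x) * ((1 - cabs x.1) ^+ 2 * (1 - cabs x.2) ^+ 2) <=
  4 * ((1 - cabs w.1) * (1 - cabs w.2)).
Proof.
have one (a y : C) : cabs a < 1 -> cabs y < 1 ->
    cabs (kernel1 a y) * (1 - cabs y) ^+ 2 <= 2 * (1 - cabs a).
  move=> a1 y1; rewrite cabs_kernel1//.
  have [_ [h _]] := kernel_den_ge a1 y1.
  have D0 : 0 < cabs (1 - a^* * y) by apply: cabs_gt0; exact: kernel_den_neq0.
  rewrite mulrAC ler_pdivrMr ?exprn_gt0//.
  have a0 := cabs_ge0 a.
  have h2 : (1 - cabs y) ^+ 2 <= cabs (1 - a^* * y) ^+ 2.
    by rewrite ler_pXn2r ?nnegrE ?cabs_ge0 ?subr_ge0// ltW.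
  apply: ler_pM => //; rewrite ?sqr_ge0//.
    by rewrite subr_ge0 exprn_ile1// ltW.
  nra.
move=> [w1 w2] [x1 x2]; rewrite /test_function cabsM.
have nn (a y : C) : 0 <= cabs (kernel1 a y) * (1 - cabs y) ^+ 2.
  exact: mulr_ge0 (cabs_ge0 _) (sqr_ge0 _).
have := ler_pM (nn _ _) (nn _ _) (one _ _ w1 x1) (one _ _ w2 x2).
have -> : 2 * (1 - cabs w.1) * (2 * (1 - cabs w.2)) = 4 * ((1 - cabs w.1) * (1 - cabs w.2)) by ring.
apply: le_trans.
by rewrite le_eqVlt; apply/orP; left; apply/eqP; ring.
Qed.

Lemma test_function_diag (w : C2) : bidisc w ->
  1 <= cabs (test_function w w) * (4 * ((1 - cabs w.1) * (1 - cabs w.2))).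
Proof.
have one (a : C) : cabs a < 1 -> 1 <= cabs (kernel1 a a) * (2 * (1 - cabs a)).
  move=> a1; rewrite cabs_kernel1//.
  have -> : 1 - a^* * a = (1 - cabs a ^+ 2)%:C.
    by rewrite cabs_sqr; case: (a) => x y; apply/eqP; rewrite eq_complex /=;
      apply/andP; split; apply/eqP; ring.
  have a0 := cabs_ge0 a.
  have d0 : 0 < 1 - cabs a ^+ 2 by rewrite subr_gt0 exprn_ilt1.
  rewrite cabs_real gtr0_norm//.
  have -> : (1 - cabs a ^+ 2) / (1 - cabs a ^+ 2) ^+ 2 * (2 * (1 - cabs a)) =
    2 * (1 - cabs a) / (1 - cabs a ^+ 2) by field; rewrite gt_eqF.
  rewrite ler_pdivlMr// mul1r; nra.
move=> [w1 w2]; rewrite /test_function cabsM.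
have := ler_pM ler01 ler01 (one _ w1) (one _ w2); rewrite mulr1 => /le_trans; apply.
by rewrite le_eqVlt; apply/orP; left; apply/eqP; ring.
Qed.

(** A compact operator sends the normalized kernels at w_n = phi (z_n), which are
    bounded and tend to zero pointwise as w_n approaches the boundary, to a sequence
    that tends to zero in norm. Evaluated at z_n the image is of order 1 / e n while
    evaluation costs the product of the distances of z_n: these cannot stay
    comparable. *)
Lemma comparable_distances_not_compact : False.
Proof.
have [map_in _ cpt] := compact.
have c0 := tentc_gt0 R.
pose w n := phi (zn n).
have wB n : bidisc (w n) by apply: phi_self.
have B0 : 0 <= test_bound R by rewrite !mulr_ge0 ?pi_ge0.
have [|s [g [sinc gB cvgs]]] := cpt (fun n => test_function (w n)) (fun n => test_function_bergman (wB n)).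
  exists (Num.sqrt (test_bound R)) => n.
  by apply: bergman_norm_le => //; exact: test_function_sqnorm.
have s_ge n : (n <= s n)%N.
  elim: n => [//|n IH]; apply: (leq_ltn_trans IH); exact: sinc.
pose D n z := composition_operator phi (test_function (w (s n))) z - g z.
have DB n : bergman (D n).
  exact: bergman_sub (map_in _ (test_function_bergman (wB _))) gB.
have Dsmall r : 0 < r -> exists N, forall n, (N <= n)%N -> bergman_norm (D n) <= r.
  move=> r0; have /cvgrPdist_le/(_ r r0)[N _ hN] := cvgs.
  exists N => n Nn; have := hN n Nn; rewrite sub0r normrN; apply: le_trans; exact: ler_norm.
(* norm convergence forces the limit to be the pointwise limit *)
have g0 z : bidisc z -> g z = 0.
  move=> Bz; apply: cabs0_eq0; apply/eqP; rewrite eq_le cabs_ge0 andbT leNgt; apply/negP => gz.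
  have [z1 z2] := Bz; have [p1 p2] := phi_self Bz.
  set gz' := cabs (g z) in gz.
  pose A := c / 4 * ((1 - cabs z.1) * (1 - cabs z.2)).
  have A0 : 0 < A by rewrite !mulr_gt0 ?subr_gt0 ?invr_gt0.
  pose P := (1 - cabs (phi z).1) ^+ 2 * (1 - cabs (phi z).2) ^+ 2.
  have P0 : 0 < P by rewrite mulr_gt0// exprn_gt0// subr_gt0.
  have [N1 hN1] := Dsmall (A * gz' / 3) (divr_gt0 (mulr_gt0 A0 gz) (ltr0Sn _ 2)).
  have [N2 hN2] := e_small (divr_gt0 (mulr_gt0 P0 gz) (ltr0Sn _ 11)).
  pose n := maxn N1 N2.
  have := hN1 n (leq_maxl _ _); have := hN2 (s n) (leq_trans (leq_maxr _ _) (s_ge n)).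
  move=> he hD.
  have := le_trans (point_evaluation_norm (DB n) Bz) hD; rewrite -/A -mulrA ler_pM2l// => hd.
  have := test_function_small (wB (s n)) (phi_self Bz); rewrite -/P -/(e (s n)) => ht.
  have ht2 : cabs (test_function (w (s n)) (phi z)) <= gz' / 3.
    have : cabs (test_function (w (s n)) (phi z)) * P <= gz' / 3 * P.
      apply: le_trans ht _; apply: le_trans (ler_wpM2l (ler0n R 4) he) _.
      by rewrite le_eqVlt; apply/orP; left; apply/eqP; field.
    by rewrite ler_pM2r.
  have : gz' <= cabs (D n z) + cabs (test_function (w (s n)) (phi z)).
    have -> : gz' = cabs (test_function (w (s n)) (phi z) - D n z).
      by congr cabs; rewrite /D /composition_operator /= opprB addrC subrK.
    by rewrite [X in _ <= X]addrC; exact: cabsB.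
  lra.
have low n : c * k / 16 <= bergman_norm (D n).
  have Bz := zn_in (s n); have [z1 z2] := Bz.
  have := point_evaluation_norm (DB n) Bz; apply: le_trans.
  rewrite /D g0// subr0 /composition_operator /=.
  have := test_function_diag (wB (s n)); rewrite -/(e (s n)).
  set T := cabs _ => hT.
  have T0 : 0 <= T by exact: cabs_ge0.
  have := ler_wpM2r T0 (ratio (s n)).
  set Z := (1 - _) * (1 - _) => hZ.
  have : c / 4 * (k / 4) <= c / 4 * (Z * T).
    rewrite ler_wpM2l ?divr_ge0 ?(ltW c0)//; apply: le_trans hZ.
    have := ler_wpM2l (ltW k0) hT; lra.
  lra.
have ck : 0 < c * k / 32 by rewrite divr_gt0// mulr_gt0.
have [N hN] := Dsmall _ ck.
have := low N; have := hN N (leqnn N); have := mulr_gt0 c0 k0; lra.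
Qed.
End Necessity.

(** * The tail estimate *)

Section TailEstimate.
Variable R : realType.
Local Notation C := (CC R).
Local Notation C2 := (CC2 R).
Local Notation R1 := (measurableTypeR R).
Local Notation R2 := (R1 * R1)%type.
Local Notation R4 := (R2 * R2)%type.
Local Notation lam2 := (@lebesgue2 R).
Local Notation lam4 := (@volume R).
Local Notation c := (tentc R).
Local Notation cIm := (@complex.Im R).

(** Both components of the symbol obey the same estimates; b selects one of them. *)
Definition component {T : Type} (b : bool) (x : T * T) : T := if b then x.1 else x.2.

Variables (phi : C2 -> C2) (b : bool).
Hypothesis phi_self : forall z, bidisc z -> bidisc (phi z).
Hypothesis phi_holo : forall b, holomorphic_on bidisc (fun z => component b (phi z)).
Let psi (z : C2) : C := component b (phi z).
Variables (E : set R4) (d0 r kap rho A : R).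
Hypothesis mE : measurable E.
Hypothesis Ein : E `<=` @bidisc4 R.
Hypothesis d00 : 0 < d0.
(* E is a set on which the selected component may approach the circle while the
   other stays d0 away from it, and where the first variable is near the circle. *)
Hypothesis Eother : forall q, E q -> d0 <= 1 - cabs (component (~~ b) (phi (Defs.cpoint q))).
Hypothesis Efar : forall q, E q -> r < cabs (cpl q.1).
Hypothesis kap0 : 0 < kap.
Hypothesis rho1 : rho < 1.
Hypothesis slice_kap : forall x y : C, cabs x < 1 -> cabs y < 1 ->
  kap * (1 - cabs y) <= 1 - cabs (psi (x, y)).
Hypothesis slice_rho : forall x : C, cabs x < 1 -> cabs (psi (x, 0)) <= rho.
Hypothesis annulus_area :
  (lam2 [set p : R2 | (r < cabs (cpl p) < 1)%R] <= A%:E)%E.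
Hypothesis A0 : 0 <= A.
Variable f : C2 -> C.
Hypothesis f_holo : holomorphic_on bidisc f.
Hypothesis comp_holo : holomorphic_on bidisc (f \o phi).

Let eta (q : R4) : R := 1 - cabs (cpl (component b q)).
Let wt (q : R4) : R := eta q `^ (- 2).
(* Pairs (z, q) such that q may be used to estimate f at phi z: its selected
   coordinate is close to that of phi z, relative to its distance to the circle. *)
Let near_set : set (R4 * R4) := [set p | E p.1 /\ bidisc4 p.2 /\
  cabs (cpl (component b p.2) - psi (Defs.cpoint p.1)) < eta p.2].

Let component_measurable : measurable_fun setT (component b : R4 -> R2).
Proof. by rewrite /component; case: (b); [exact: measurable_fst|exact: measurable_snd]. Qed.

Let eta_measurable : measurable_fun setT (eta : R4 -> R1).
Proof.
apply: measurable_funB; first exact: measurable_cst.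
have := measurable_cabs_cpl (0 : C); under eq_fun do rewrite subr0.
by move=> m; exact: (measurableT_comp m component_measurable).
Qed.

Let wt_measurable : measurable_fun setT (wt : R4 -> R1).
Proof.
have m := @measurable_powR R (- 2).
exact: (@measurableT_comp _ _ _ _ _ _ _ setT eta m eta_measurable).
Qed.

Let eta_gt0 q : bidisc4 q -> 0 < eta q.
Proof. by move=> [q1 q2]; rewrite /eta /component subr_gt0; case: (b). Qed.

Let wtE q : bidisc4 q -> wt q = (eta q ^+ 2)^-1.
Proof.
by move=> /eta_gt0 h; rewrite /wt powRN powR_mulrn// ltW.
Qed.

Let near_measurable : measurable near_set.
Proof.
have mRe := restrict_measurable (@Re_lip R) (phi_holo b).
have imlip (x y : C) : `|cIm x - cIm y| <= cabs (x - y).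
  by apply: le_trans (Im_le_cabs _); case: x y => x1 x2 [y1 y2].
have mIm := restrict_measurable imlip (phi_holo b).
set u := (_ \_ _) in mRe; set v := (_ \_ _) in mIm.
pose G (p : R4 * R4) : R1 := ((component b p.2).1 - u p.1) ^+ 2 + ((component b p.2).2 - v p.1) ^+ 2.
have mp1 : measurable_fun setT (fst : R4 * R4 -> R4) by exact: measurable_fst.
have mp2 : measurable_fun setT (snd : R4 * R4 -> R4) by exact: measurable_snd.
have mpick := measurableT_comp component_measurable mp2.
have mG : measurable_fun setT G.
  apply: measurable_funD; apply: measurable_funX; apply: measurable_funB.
  - exact: (measurableT_comp measurable_fst mpick).
  - exact: (measurableT_comp mRe mp1).
  - exact: (measurableT_comp measurable_snd mpick).
  - exact: (measurableT_comp mIm mp1).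
have mH : measurable_fun setT (fun p : R4 * R4 => eta p.2 ^+ 2 : R1).
  by apply: measurable_funX; exact: (measurableT_comp eta_measurable mp2).
have mlt : measurable [set p : R4 * R4 | G p < eta p.2 ^+ 2].
  have := measurable_fun_ltr mG mH => /(_ measurableT [set true]).
  by rewrite setTI; apply.
have GE z q : E z -> G (z, q) = cabs (cpl (component b q) - psi (Defs.cpoint z)) ^+ 2.
  move=> Ez; rewrite cabs_sqr /G /u /v !patchE (mem_set (Ein Ez)) /= /psi.
  by case: (component b (phi _)).
have lt2 (x q : R4) : bidisc4 q ->
   (cabs (cpl (component b q) - psi (Defs.cpoint x)) ^+ 2 < eta q ^+ 2) =
   (cabs (cpl (component b q) - psi (Defs.cpoint x)) < eta q).
  by move=> Bq; rewrite ltr_sqr_cabs// ltW// eta_gt0.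
have -> : near_set = (E `*` @bidisc4 R) `&` [set p : R4 * R4 | G p < eta p.2 ^+ 2].
  apply/seteqP; split => -[z q].
    by move=> [Ez [Bq h]]; split; [split|rewrite /mkset GE// lt2].
  by move=> [[Ez Bq]]; rewrite /mkset GE// lt2// => h; split => //; split.
by apply: measurableI => //; apply: measurableX => //; exact: measurable_bidisc4.
Qed.

Let weight (q : R4) : R := modsq f q * wt q.
Let H (p : R4 * R4) : R := \1_near_set p * weight p.2.
Let K := 36 / (c ^+ 2 * d0 ^+ 2).

Let weight_ge0 q : 0 <= weight q.
Proof. by rewrite mulr_ge0 ?modsq_ge0 ?powR_ge0. Qed.

Let weight_measurable : measurable_fun setT (weight : R4 -> R1).
Proof. by apply: measurable_funM; [exact: modsq_measurable|exact: wt_measurable]. Qed.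

Let H_measurable : measurable_fun setT (fun p : R4 * R4 => (H p)%:E).
Proof.
apply/measurable_EFinP; apply: measurable_funM; first exact: measurable_indic.
exact: (measurableT_comp weight_measurable measurable_snd).
Qed.

Let H_ge0 p : (0 <= (H p)%:E)%E.
Proof. by rewrite lee_fin mulr_ge0. Qed.

(* The sub-mean value property on a polydisc around phi z; the radius of the
   selected coordinate is traded for eta q, the other one is at least d0 / 2. *)
Let pointwise z : E z -> (((cabs (f (phi (Defs.cpoint z)))) ^+ 2)%:E <=
   K%:E * \int[lam4]_q (H (z, q))%:E)%E.
Proof.
move=> Ez; have c0 := tentc_gt0 R.
set w := phi (Defs.cpoint z).
have /bidiscE[w1 w2] : bidisc w by apply: phi_self; exact: Ein.
pose s1 := (1 - cabs w.1) / 2; pose s2 := (1 - cabs w.2) / 2.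
have s10 : 0 < s1 by rewrite divr_gt0// subr_gt0.
have s20 : 0 < s2 by rewrite divr_gt0// subr_gt0.
have e1 : cabs w.1 + s1 < 1 by rewrite /s1; lra.
have e2 : cabs w.2 + s2 < 1 by rewrite /s2; lra.
have S := submean2 f_holo s10 s20 e1 e2.
pose sb := (1 - cabs (component b w)) / 2; pose so := (1 - cabs (component (~~ b) w)) / 2.
have sbo : s1 ^+ 2 * s2 ^+ 2 = sb ^+ 2 * so ^+ 2.
  by rewrite /sb /so /component; case: (b) => //; rewrite mulrC.
have sb0 : 0 < sb by rewrite /sb /component; case: (b).
have sod : d0 / 2 <= so by rewrite /so ler_pM2r//; exact: Eother.
have d2 : 0 < d0 / 2 by rewrite divr_gt0.
have so0 : 0 < so by exact: lt_le_trans d2 sod.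
have mHz : measurable_fun setT (fun q : R4 => (H (z, q))%:E).
  exact: (measurableT_comp H_measurable (pair1_measurable z)).
pose L := 9 * sb ^+ 2 * (s1 ^+ 2 * s2 ^+ 2).
have L0 : 0 <= L by apply: mulr_ge0; apply: mulr_ge0; rewrite ?sqr_ge0.
have LH q : 0 <= L * H (z, q) by rewrite mulr_ge0// -lee_fin; exact: H_ge0.
have pw q : modsq f q * (cone w.1 s1 q.1 * cone w.2 s2 q.2) <= L * H (z, q).
  have [Bq|nB] := pselect (bidisc4 q); last first.
    by rewrite modsq_out// mul0r.
  have [z1|z1] := leP s1 (cabs (cpl q.1 - w.1)).
    by rewrite (cone_out (ltW s10) z1) mul0r mulr0.
  have [z2|z2] := leP s2 (cabs (cpl q.2 - w.2)).
    by rewrite (cone_out (ltW s20) z2) !mulr0.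
  have close : cabs (cpl (component b q) - component b w) < sb.
    by move: z1 z2; rewrite /sb /component; case: (b).
  have t1 := cabs_triangle (cpl (component b q)) (component b w).
  have t2 := cabs_triangle (component b w) (cpl (component b q)).
  rewrite cabs_distrC in t2.
  have n1 : cabs (cpl (component b q) - component b w) < eta q.
    by rewrite /eta; rewrite /sb in close; lra.
  have n2 : eta q <= 3 * sb by rewrite /eta; rewrite /sb in close *; lra.
  have eq0 := eta_gt0 Bq.
  rewrite /H indicE mem_set ?mul1r//= /weight wtE//.
  have -> : L * (modsq f q / eta q ^+ 2) = modsq f q * (L / eta q ^+ 2) by ring.
  apply: ler_wpM2l; first exact: modsq_ge0.
  rewrite ler_pdivlMr ?exprn_gt0//.
  have cc : cone w.1 s1 q.1 * cone w.2 s2 q.2 <= s1 ^+ 2 * s2 ^+ 2.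
    by rewrite ler_pM ?cone_ge0 ?cone_le.
  have ee : eta q ^+ 2 <= 9 * sb ^+ 2.
    have -> : 9 * sb ^+ 2 = (3 * sb) ^+ 2 by ring.
    by rewrite ler_pXn2r ?nnegrE ?(ltW eq0)// mulr_ge0// ltW.
  rewrite /L [9 * _ * _]mulrC; apply: ler_pM => //; rewrite ?sqr_ge0//.
  by rewrite mulr_ge0 ?cone_ge0.
have S2 : ((s1 ^+ 4 * c * (s2 ^+ 4 * c) * cabs (f w) ^+ 2)%:E <=
    L%:E * \int[lam4]_q (H (z, q))%:E)%E.
  apply: (le_trans S); rewrite -ge0_integralZl//.
  apply: ge0_le_integral => //.
  - by move=> q _; rewrite lee_fin mulr_ge0 ?modsq_ge0// mulr_ge0 ?cone_ge0.
  - apply/measurable_EFinP; apply: measurable_funM; first exact: modsq_measurable.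
    by apply: measurable_funM; [exact: measurableT_comp (cone_measurable _ _) measurable_fst
                             |exact: measurableT_comp (cone_measurable _ _) measurable_snd].
  - by apply: emeasurable_funM => //; exact: measurable_cst.
  - by move=> q _; rewrite -EFinM lee_fin; exact: pw.
set I := (\int[lam4]_q _)%E in S2 *.
have I0 : (0 <= I)%E by apply: integral_ge0.
have T0 : 0 < s1 ^+ 4 * c * (s2 ^+ 4 * c) by apply: mulr_gt0; apply: mulr_gt0; rewrite ?exprn_gt0.
rewrite EFinM -lee_pdivlMl// in S2; apply: (le_trans S2).
rewrite muleA -EFinM; apply: lee_wpmul2r => //; rewrite lee_fin.
have s1n : s1 != 0 by rewrite gt_eqF.
have s2n : s2 != 0 by rewrite gt_eqF.
have E12 : s1 ^+ 4 * c * (s2 ^+ 4 * c) = (s1 ^+ 2 * s2 ^+ 2) * (sb ^+ 2 * so ^+ 2) * c ^+ 2.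
  by rewrite -sbo; ring.
have s120 : 0 < s1 ^+ 2 * s2 ^+ 2 by rewrite mulr_gt0// exprn_gt0.
rewrite E12 /L /K.
have -> : ((s1 ^+ 2 * s2 ^+ 2) * (sb ^+ 2 * so ^+ 2) * c ^+ 2)^-1
   * (9 * sb ^+ 2 * (s1 ^+ 2 * s2 ^+ 2)) = 9 / (c ^+ 2 * so ^+ 2).
  by field; rewrite !gt_eqF.
have -> : 36 / (c ^+ 2 * d0 ^+ 2) = 9 / (c ^+ 2 * (d0 / 2) ^+ 2) by field; rewrite !gt_eqF.
have p1 : 0 < c ^+ 2 * (d0 / 2) ^+ 2 by apply: mulr_gt0; rewrite exprn_gt0.
have p2 : 0 < c ^+ 2 * so ^+ 2 by apply: mulr_gt0; rewrite exprn_gt0.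
rewrite ler_wpM2l// lef_pV2 ?posrE//.
by rewrite ler_wpM2l ?sqr_ge0// ler_pXn2r ?nnegrE ?(ltW so0) ?(ltW d2).
Qed.

Let Kc := carleson_const kap rho.

(* The weight of q is its |f|^2 over eta q ^ 2, and the area estimate on each slice
   z1 = x bounds the z near q by a multiple of eta q ^ 2: the factors cancel. *)
Let inner q : (\int[lam4]_z (H (z, q))%:E <= (Kc * A * modsq f q)%:E)%E.
Proof.
have [Bq|nB] := pselect (bidisc4 q); last first.
  rewrite modsq_out// mulr0; under eq_integral do rewrite /H /weight modsq_out// mul0r mulr0.
  by rewrite integral0.
pose Z : set R4 := [set z | near_set (z, q)].
have mZ : measurable Z.
  rewrite -[Z]setTI; exact: (pair2_measurable q measurableT near_measurable).
have -> : (\int[lam4]_z (H (z, q))%:E = (weight q)%:E * lam4 Z)%E.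
  have Zi := @integral_indic _ R4 R lam4 setT measurableT Z mZ.
  rewrite setIT in Zi; rewrite -Zi.
  have mI : measurable_fun setT (fun z : R4 => (\1_Z z : R)%:E).
    by apply/measurable_EFinP; exact: measurable_indic.
  rewrite -(@ge0_integralZl _ R4 R lam4 setT measurableT _ mI).
  - by apply: eq_integral => z _; rewrite -EFinM; congr EFin; rewrite /H mulrC.
  - by move=> z _; rewrite lee_fin.
  - by rewrite lee_fin.
have e0 := eta_gt0 Bq.
have c0 := tentc_gt0 R.
have Kc0 : 0 <= Kc * eta q ^+ 2.
  rewrite mulr_ge0 ?sqr_ge0// addr_ge0// divr_ge0 ?sqr_ge0 ?mulr_ge0 ?(ltW c0) ?(ltW kap0)//.
  by rewrite subr_ge0 ltW.
suff : (lam4 Z <= (Kc * eta q ^+ 2 * A)%:E)%E.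
  have w0 : (0 <= (weight q)%:E)%E by rewrite lee_fin.
  move=> /(lee_wpmul2l w0)/le_trans; apply; rewrite -EFinM lee_fin le_eqVlt.
  apply/orP; left; apply/eqP; rewrite /weight wtE//; field.
  by rewrite gt_eqF.
pose Y : set R2 := [set p : R2 | r < cabs (cpl p) < 1].
have mY : measurable Y by exact: measurable_annulus.
have section x : (lam2 (xsection Z x) <= (Kc * eta q ^+ 2)%:E * (\1_Y x)%:E)%E.
  have mX : measurable (xsection Z x) by exact: measurable_xsection.
  case: (asboolP (Y x)) => [Yx|nY]; last first.
    rewrite indicE memNset// mule0.
    have -> : xsection Z x = set0; last by rewrite measure0.
    rewrite -subset0 => y; rewrite /xsection /= => /set_mem[/= Exy _].
    apply: nY; apply/andP; split; first exact: Efar Exy.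
    by have [] := Ein Exy.
  rewrite indicE mem_set// mule1.
  have /andP[_ x1] : r < cabs (cpl x) < 1 by exact: Yx.
  have xi1 : cabs (cpl (component b q)) < 1 by have [q1 q2] := Bq; rewrite /component; case: (b).
  apply: (@carleson_area R (fun y => psi (cpl x, y)) kap rho (cpl (component b q)) (xsection Z x)) => //.
  - exact: (holo_slice2 (phi_holo b)).
  - move=> y y1; have : bidisc (cpl x, y) by [].
    by move=> /phi_self[p1 p2]; rewrite /psi /component; case: (b).
  - by move=> y y1; exact: slice_kap.
  - exact: slice_rho.
  - by move=> y; rewrite /xsection /= => /set_mem[/= Exy _]; have [] := Ein Exy.
  - by move=> y; rewrite /xsection /= => /set_mem[/= Exy [_ h]]; rewrite cabs_distrC.
rewrite /volume /product_measure1.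
apply: (@le_trans _ _ (\int[lam2]_x ((Kc * eta q ^+ 2)%:E * (\1_Y x)%:E))%E).
  apply: ge0_le_integral => //.
  - exact: measurable_fun_xsection.
  - apply: emeasurable_funM; first exact: measurable_cst.
    by apply/measurable_EFinP; exact: measurable_indic.
  - by move=> x _; exact: section.
rewrite ge0_integralZl//; last by apply/measurable_EFinP; exact: measurable_indic.
rewrite integral_indic// setIT [leRHS]EFinM; apply: lee_wpmul2l; first by rewrite lee_fin.
exact: annulus_area.
Qed.

(** The part of the norm of f o phi carried by E is small when the annulus
    r < |z1| < 1 is thin: use the sub-mean value property at phi z, exchange the
    integrals, and bound the slices by the area estimate. *)
Theorem tail_estimate :
  (\int[lam4]_(z in E) ((cabs (f (phi (Defs.cpoint z)))) ^+ 2)%:E <=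
   (K * Kc * A)%:E * sqnorm f)%E.
Proof.
have c0 := tentc_gt0 R.
have K0 : 0 <= K by rewrite divr_ge0// mulr_ge0 ?sqr_ge0.
have Kc0 : 0 <= Kc.
  rewrite addr_ge0// divr_ge0 ?sqr_ge0 ?mulr_ge0 ?(ltW c0) ?(ltW kap0)//.
  by rewrite subr_ge0 ltW.
have mF : measurable_fun setT (fun z : R4 => \int[lam4]_q (H (z, q))%:E)%E.
  exact: (measurable_fun_fubini_tonelli_F _ H_measurable H_ge0).
apply: (@le_trans _ _ (\int[lam4]_z (K%:E * \int[lam4]_q (H (z, q))%:E))%E).
  have hcomp : holomorphic_on bidisc (f \o phi) by exact: comp_holo.
  rewrite (_ : (\int[lam4]_(z in E) _)%E =
     (\int[lam4]_z ((modsq (f \o phi) \_ E) z)%:E)%E); last first.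
    rewrite integral_mkcond; apply: eq_integral => z _; rewrite !patchE.
    by case: ifP => // /set_mem Ez; rewrite modsq_in//; exact: Ein.
  apply: ge0_le_integral => //.
  - by move=> z _; rewrite lee_fin patchE; case: ifP => // _; exact: modsq_ge0.
  - apply/measurable_EFinP; apply/(measurable_restrictT _ mE).
    by apply: measurable_funTS; exact: modsq_measurable.
  - by apply: emeasurable_funM; first exact: measurable_cst.
  move=> z _; rewrite patchE; case: ifP => [/set_mem Ez|_].
    by rewrite modsq_in; [exact: pointwise|exact: Ein].
  by apply: mule_ge0; [rewrite lee_fin|apply: integral_ge0].
rewrite ge0_integralZl//; last by move=> z _; apply: integral_ge0.
have -> : ((K * Kc * A)%:E * sqnorm f = K%:E * ((Kc * A)%:E * sqnorm f))%E.
  by rewrite muleA -EFinM mulrA.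
apply: lee_wpmul2l; first by rewrite lee_fin.
rewrite (fubini_tonelli _ H_measurable H_ge0).
rewrite sqnormE -ge0_integralZl//; last 3 first.
- by apply/measurable_EFinP; exact: modsq_measurable.
- by move=> q _; rewrite lee_fin modsq_ge0.
- by rewrite lee_fin mulr_ge0.
have mG := measurable_fun_fubini_tonelli_G _ H_measurable H_ge0 (m1 := lam4).
have mR : measurable_fun setT (fun q : R4 => (Kc * A)%:E * (modsq f q)%:E)%E.
  apply: emeasurable_funM; first exact: measurable_cst.
  by apply/measurable_EFinP; exact: modsq_measurable.
apply: (@ge0_le_integral _ R4 R lam4 setT measurableT _ _ _ mG mR).
- by move=> q _; apply: integral_ge0.
- by move=> q _; rewrite -EFinM; exact: inner.
Qed.
End TailEstimate.

(** * Locally bounded families *)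

Section EquiLipschitz.
Variable R : realType.
Local Notation C := (CC R).
Local Notation C2 := (CC2 R).
Implicit Types (f : C2 -> C) (z w h : C2) (r s t B : R).

Definition polydisc t : set C2 := [set z | cabs z.1 <= t /\ cabs z.2 <= t].

Definition holo2 f r := forall z, cabs z.1 < r -> cabs z.2 < r -> differentiable (f : C2 -> C) z.

Definition norm1 z : R := cabs z.1 + cabs z.2.

Lemma norm1_ge0 z : 0 <= norm1 z. Proof. by rewrite addr_ge0 ?cabs_ge0. Qed.

Lemma cauchy_lipschitz2 f r t s B : holo2 f r -> 0 < s -> t + s < r ->
  (forall z, polydisc (t + s) z -> cabs (f z) <= B) ->
  forall z w, polydisc t z -> polydisc t w ->
  cabs (z.1 - w.1) <= s -> cabs (z.2 - w.2) <= s ->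
  cabs (f z - f w) <= 64 * B / s * norm1 (z - w).
Proof.
move=> hf s0 tsr fB z w [z1 z2] [w1 w2] d1 d2.
have st : t < t + s by lra.
have ball (a x : C) (q : R) : cabs a <= t -> cabs (x - a) <= q -> cabs x <= t + q.
  by move=> ha hx; have := cabs_triangle x a; lra.
have ball' (a x : C) : cabs a <= t -> cabs (x - a) < r - t -> cabs x < r.
  by move=> ha hx; have := cabs_triangle x a; lra.
have h1 (a : C) : cabs a <= t -> holo (fun x => f (x, z.2)) a (r - t).
  move=> ha x hx; apply: (@differentiable_comp _ C C2 C (fun x => (x, z.2)) f x).
    by apply: differentiable_pair; [exact: ex_diff|exact: differentiable_cst].
  by apply: hf => /=; [exact: ball' hx|lra].
have h2 (a : C) : cabs a <= t -> holo (fun y => f (w.1, y)) a (r - t).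
  move=> ha y hy; apply: (@differentiable_comp _ C C2 C (fun y => (w.1, y)) f y).
    by apply: differentiable_pair; [exact: differentiable_cst|exact: ex_diff].
  by apply: hf => /=; [lra|exact: ball' hy].
have srt : s < r - t by lra.
have L1 := @cauchy_lipschitz R (fun x => f (x, z.2)) z.1 w.1 (r - t) s B
  (h1 _ z1) (h1 _ w1) s0 srt.
have L2 := @cauchy_lipschitz R (fun y => f (w.1, y)) z.2 w.2 (r - t) s B
  (h2 _ z2) (h2 _ w2) s0 srt.
have {}L1 : cabs (f (z.1, z.2) - f (w.1, z.2)) <= 64 * B / s * cabs (z.1 - w.1).
  by apply: L1 => // x hx; apply: fB; split; [exact: ball hx|rewrite /=; lra
    |exact: ball hx|rewrite /=; lra].
have {}L2 : cabs (f (w.1, z.2) - f (w.1, w.2)) <= 64 * B / s * cabs (z.2 - w.2).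
  by apply: L2 => // x hx; apply: fB; split; [rewrite /=; lra|exact: ball hx
    |rewrite /=; lra|exact: ball hx].
rewrite -!surjective_pairing in L1 L2.
have -> : f z - f w = (f z - f (w.1, z.2)) + (f (w.1, z.2) - f w) by ring.
apply: le_trans (cabsD _ _) _.
by rewrite /norm1 mulrDr; apply: lerD.
Qed.

Definition scale (x : R) z : C2 := (x%:C * z.1, x%:C * z.2).

Lemma scale_cabs x z : 0 <= x -> cabs (scale x z).1 = x * cabs z.1 /\ cabs (scale x z).2 = x * cabs z.2.
Proof. by move=> x0; rewrite /scale !cabsM !cabs_real ger0_norm. Qed.

(** A second order Taylor estimate with a constant that depends on the bound of f
    only, so that it survives pointwise limits. The difference quotient
    G N = N (f(. + h/N) - f) is Lipschitz in the point, uniformly in N; summing N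
    of its increments along the segment from z to z + h gives f(z + h) - f(z) up to
    a second order term, and N -> oo turns G N z into the differential. *)
Lemma second_order f s t B : holo2 f 1 -> 0 < s -> t + 3 * s < 1 ->
  (forall z, polydisc (t + 3 * s) z -> cabs (f z) <= B) ->
  forall z h a b, polydisc (t - s) z -> cabs h.1 <= s -> cabs h.2 <= s ->
  cexpansion2 f z a b ->
  cabs (f (z + h) - f z - a * h.1 - b * h.2) <= (64 / s) ^+ 2 * B * norm1 h ^+ 2.
Proof.
move=> hf s0 ts fB z h a b [z1 z2] hh1 hh2 fab.
have n0 := norm1_ge0 h.
have B0 : 0 <= B.
  by apply: le_trans (cabs_ge0 (f z)) (fB z _); split; lra.
pose G (N : nat) (w : C2) : C := (N%:R : R)%:C * (f (w + scale N%:R^-1 h) - f w).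
have step N : (0 < N)%N -> forall k, (k <= N)%N ->
  cabs (f (z + scale (k%:R / N%:R) h) - f z - (k%:R / N%:R)%:C * G N z) <=
  k%:R / N%:R * ((64 / s) ^+ 2 * B * norm1 h ^+ 2).
  move=> N0 k kN; pose F := G N; rewrite -/F.
  have NR : 0 < N%:R :> R by rewrite ltr0n.
  have Ni : 0 <= (N%:R^-1 : R) <= 1.
    by rewrite invr_ge0 ler0n invf_le1// ler1n.
  have hN1 : cabs (scale N%:R^-1 h).1 <= s /\ cabs (scale N%:R^-1 h).2 <= s.
    have /andP[i0 i1] := Ni; have [-> ->] := scale_cabs h i0.
    by have := cabs_ge0 h.1; have := cabs_ge0 h.2; split; nra.
  have FB w : polydisc (t + s) w -> cabs (F w) <= 64 * B / s * norm1 h.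
    move=> [w1 w2].
    have := @cauchy_lipschitz2 f 1 (t + 2 * s) s B hf s0 (ltac:(lra)).
    have -> : t + 2 * s + s = t + 3 * s by ring.
    move=> /(_ fB (w + scale N%:R^-1 h) w).
    have p1 : polydisc (t + 2 * s) (w + scale N%:R^-1 h).
      have [q1 q2] := hN1.
      by split; apply: le_trans (cabsD _ _) _; rewrite /= in q1 q2 *; lra.
    have p2 : polydisc (t + 2 * s) w by split; lra.
    have e1 : (w + scale N%:R^-1 h) - w = scale N%:R^-1 h by rewrite addrC addKr.
    move=> /(_ p1 p2); have [q1 q2] := hN1.
    have -> : (w + scale N%:R^-1 h).1 - w.1 = (scale N%:R^-1 h).1 by rewrite addrC addKr.
    have -> : (w + scale N%:R^-1 h).2 - w.2 = (scale N%:R^-1 h).2 by rewrite addrC addKr.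
    move=> /(_ q1 q2); rewrite e1 /F /G cabsM cabs_real ger0_norm ?ler0n// => H.
    have : norm1 (scale N%:R^-1 h) = N%:R^-1 * norm1 h.
      have /andP[i0 i1] := Ni; have [h1 h2] := scale_cabs h i0.
      by rewrite /norm1 h1 h2 mulrDr.
    move=> nE; rewrite nE in H; apply: le_trans (ler_wpM2l (ler0n _ _) H) _.
    by rewrite le_eqVlt; apply/orP; left; apply/eqP; field; rewrite !gt_eqF.
  have hF : holo2 F (1 - s).
    move=> w w1 w2; apply: differentiable_mul; first exact: differentiable_cst.
    have [q1 q2] := hN1.
    apply: differentiableB; last by apply: hf; lra.
    apply: (@differentiable_comp _ C2 C2 C (fun w => w + scale N%:R^-1 h) f w).
      by apply: differentiableD; [exact: ex_diff|exact: differentiable_cst].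
    by apply: hf; apply: le_lt_trans (cabsD _ _) _; lra.
  have LF := @cauchy_lipschitz2 F (1 - s) t s _ hF s0 (ltac:(lra)) FB.
  elim: k kN => [|k IH] kN.
    have -> : scale (0%:R / N%:R) h = 0.
      by rewrite /scale mul0r; congr pair; rewrite rmorph0 mul0r.
    by rewrite addr0 subrr mul0r rmorph0 mul0r subr0 cabs0 mul0r.
  have {}IH := IH (ltnW kN).
  have k0 : 0 <= (k%:R / N%:R : R) <= 1.
    by rewrite divr_ge0 ?ler0n//= ler_pdivrMr// mul1r ler_nat ltnW.
  have /andP[i0 i1] := k0; have [c1 c2] := scale_cabs h i0.
  have SE : scale (k.+1%:R / N%:R) h = scale (k%:R / N%:R) h + scale N%:R^-1 h.
    by rewrite /scale -natr1 mulrDl mul1r; congr pair; rewrite rmorphD mulrDl.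
  set y := z + scale (k%:R / N%:R) h in IH *.
  have yt : polydisc t y.
    have := cabs_ge0 h.1; have := cabs_ge0 h.2 => g2 g1.
    by split; apply: le_trans (cabsD _ _) _; rewrite ?c1 ?c2; nra.
  have zt : polydisc t z by split; lra.
  have yz1 : y.1 - z.1 = (scale (k%:R / N%:R) h).1 by rewrite /y addrC addKr.
  have yz2 : y.2 - z.2 = (scale (k%:R / N%:R) h).2 by rewrite /y addrC addKr.
  have LFy : cabs (F y - F z) <= 64 * (64 * B / s * norm1 h) / s * norm1 h.
    have := LF y z yt zt; rewrite yz1 yz2 c1 c2.
    have g1 := cabs_ge0 h.1; have g2 := cabs_ge0 h.2.
    have b1 : k%:R / N%:R * cabs h.1 <= cabs h.1 by nra.
    have b2 : k%:R / N%:R * cabs h.2 <= cabs h.2 by nra.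
    move=> /(_ (le_trans b1 hh1) (le_trans b2 hh2)) => H; apply: (le_trans H).
    have -> : y - z = scale (k%:R / N%:R) h by rewrite /y addrC addKr.
    apply: ler_wpM2l; first by rewrite divr_ge0 ?(ltW s0)// !mulr_ge0// invr_ge0 ltW.
    by rewrite /norm1 c1 c2; lra.
  have E1 : f (z + scale (k.+1%:R / N%:R) h) - f z - (k.+1%:R / N%:R)%:C * F z =
     (f y - f z - (k%:R / N%:R)%:C * F z) + (N%:R^-1)%:C * (F y - F z).
    rewrite SE addrA -/y -natr1 mulrDl mul1r rmorphD.
    have NE : (N%:R^-1)%:C * F y = f (y + scale N%:R^-1 h) - f y.
      rewrite /F /G mulrA -rmorphM mulVf ?gt_eqF//.
      by rewrite rmorph1 mul1r.
    rewrite mulrBr NE; ring.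
  rewrite E1; apply: le_trans (cabsD _ _) _.
  rewrite cabsM cabs_real ger0_norm; last by have /andP[] := Ni.
  have := ler_wpM2l (proj1 (andP Ni)) LFy.
  have -> : 64 * (64 * B / s * norm1 h) / s * norm1 h = (64 / s) ^+ 2 * B * norm1 h ^+ 2.
    by field; rewrite gt_eqF.
  have -> : (k.+1%:R / N%:R : R) = k%:R / N%:R + N%:R^-1 by rewrite -natr1 mulrDl mul1r.
  by move=> H; apply: le_trans (lerD IH H) _; rewrite -mulrDl.
(* with k = N, let N go to infinity *)
have lim e : 0 < e -> cabs (f (z + h) - f z - a * h.1 - b * h.2) <=
   (64 / s) ^+ 2 * B * norm1 h ^+ 2 + e * norm1 h.
  move=> e0; have [d d0 hd] := fab e e0.
  pose N := (Num.bound (s / d)).+1.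
  have N0 : (0 < N)%N by [].
  have NR : 0 < N%:R :> R by rewrite ltr0n.
  have := step N N0 N (leqnn _); rewrite divff ?gt_eqF// !mul1r.
  have -> : scale 1 h = h.
    by rewrite /scale rmorph1 !mul1r -surjective_pairing.
  rewrite /G; set F := (_%:C * (_ - _)) => H.
  have i0 : 0 <= N%:R^-1 :> R by rewrite invr_ge0 ltW.
  have [c1 c2] := scale_cabs h i0.
  have sN : N%:R^-1 * s <= d.
    rewrite mulrC ler_pdivrMr// mulrC -ler_pdivrMr//.
    have sd0 : 0 <= s / d by rewrite divr_ge0 ?ltW.
    apply: le_trans (ltW (archi_boundP sd0)) _.
    by rewrite ler_nat.
  have := hd (scale N%:R^-1 h).1 (scale N%:R^-1 h).2.
  rewrite c1 c2 => /(_ (le_trans (ler_wpM2l i0 hh1) sN) (le_trans (ler_wpM2l i0 hh2) sN)).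
  rewrite -mulrDr => H2.
  have FE : cabs (F - a * h.1 - b * h.2) <= e * norm1 h.
    have -> : F - a * h.1 - b * h.2 = N%:R%:C *
       (f (z.1 + (scale N%:R^-1 h).1, z.2 + (scale N%:R^-1 h).2) - f z
         - a * (scale N%:R^-1 h).1 - b * (scale N%:R^-1 h).2).
      have NN : (N%:R : R)%:C * (N%:R^-1)%:C = 1 :> C.
        by rewrite -rmorphM divff ?gt_eqF.
      rewrite /F /scale /= !mulrBr.
      have -> : N%:R%:C * (a * ((N%:R^-1)%:C * h.1)) = (N%:R%:C * (N%:R^-1)%:C) * (a * h.1) by ring.
      have -> : N%:R%:C * (b * ((N%:R^-1)%:C * h.2)) = (N%:R%:C * (N%:R^-1)%:C) * (b * h.2) by ring.
      by rewrite NN !mul1r.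
    rewrite cabsM cabs_real gtr0_norm//; apply: le_trans (ler_wpM2l (ltW NR) H2) _.
    by rewrite le_eqVlt; apply/orP; left; apply/eqP; rewrite /norm1; field; rewrite gt_eqF.
  have -> : f (z + h) - f z - a * h.1 - b * h.2 = (f (z + h) - f z - F) + (F - a * h.1 - b * h.2).
    by ring.
  by apply: le_trans (cabsD _ _) _; lra.
rewrite leNgt; apply/negP => lt.
set X := cabs _ in lim lt; set Y := _ * norm1 h ^+ 2 in lim lt.
have e0 : 0 < (X - Y) / (2 * (norm1 h + 1)).
  by rewrite divr_gt0 ?subr_gt0// mulr_gt0//; lra.
have := lim _ e0.
have : (X - Y) / (2 * (norm1 h + 1)) * norm1 h <= (X - Y) / 2.
  rewrite mulrAC ler_pdivrMr; last by rewrite mulr_gt0//; lra.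
  have -> : (X - Y) / 2 * (2 * (norm1 h + 1)) = (X - Y) * (norm1 h + 1) by field.
  by rewrite ler_wpM2l ?subr_ge0 ?(ltW lt)//; lra.
lra.
Qed.
End EquiLipschitz.

Section Montel.
Variable R : realType.
Local Notation C := (CC R).
Local Notation C2 := (CC2 R).

(** A bounded sequence converges along an ultrafilter, which replaces a diagonal extraction. *)
Lemma ultralimit (U : set_system nat) (x : nat -> C) (M : R) : UltraFilter U ->
  (forall n, cabs (x n) <= M) ->
  exists l : C, forall e : R, 0 < e -> U [set n | cabs (x n - l) <= e].
Proof.
move=> UU xM; pose y n : C2 := (x n, 0).
have M0 : 0 <= M by apply: le_trans (cabs_ge0 _) (xM 0%N).
have FA : (y @ U) (annulus_disc 0 M M).
  apply: (@filterS _ U _ setT) => [n _|]; last exact: filterT.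
  by split; [apply/andP; split; [exact: cabs_ge0|exact: xM]|rewrite (_ : (y n).2 = 0)// cabs0].
have [p [_ clp]] := @compact_annulus_disc R 0 M M (y @ U) _ FA.
exists p.1 => e e0.
have [//|US] := in_ultra_setVsetC [set n | cabs (x n - p.1) <= e] UU.
have near_p : nbhs p [set w : C2 | cabs (w.1 - p.1) <= e].
  by apply/nbhs_C2; exists e => // w w1 w2.
have FS : (y @ U) [set w : C2 | ~ cabs (w.1 - p.1) <= e] by exact: US.
by have [w [h1 h2]] := clp _ _ FS near_p.
Qed.

Lemma polydiscE t : @polydisc R t = annulus_disc 0 t t.
Proof.
by apply/seteqP; split => z [z1 z2]; split => //; [rewrite cabs_ge0|have /andP[] := z1].
Qed.

Variables (U : set_system nat) (u : nat -> C2 -> C).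
Hypothesis UU : UltraFilter U.
Hypothesis u_holo : forall n, holomorphic_on bidisc (u n).
Hypothesis u_bounded : forall t : R, t < 1 -> exists B, forall n z, polydisc t z -> cabs (u n z) <= B.

Let u_holo2 n : holo2 (u n) 1.
Proof. by move=> z z1 z2; apply: u_holo; apply/bidiscE. Qed.

(* The gradients of the u n at z are bounded, hence have a limit along U, and the
   second order estimate passes to the limit. *)
Let ulim_expansion (g : C2 -> C) (z : C2) :
  (forall w, bidisc w -> forall e : R, 0 < e -> U [set n | cabs (u n w - g w) <= e]) ->
  bidisc z -> exists a b, cexpansion2 g z a b.
Proof.
move=> gU /bidiscE[z1 z2].
pose T := Num.max (cabs z.1) (cabs z.2).
have T0 : 0 <= T by rewrite le_max cabs_ge0.
have T1 : T < 1 by rewrite gt_max z1.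
have zT1 : cabs z.1 <= T by rewrite le_max lexx.
have zT2 : cabs z.2 <= T by rewrite le_max lexx orbT.
pose s := (1 - T) / 8; have s0 : 0 < s by rewrite /s; lra.
have s1 : T + s + 3 * s < 1 by rewrite /s; lra.
have zt : polydisc (T + s - s) z by split; lra.
have [B uB] := u_bounded s1.
have B0 : 0 <= B by apply: le_trans (cabs_ge0 (u 0%N z)) (uB _ _ _); split; lra.
have zin : bidisc z by apply/bidiscE.
have /choice[ab hab] n : exists ab : C * C, cexpansion2 (u n) z ab.1 ab.2.
  have [a [b H]] := differentiable_cexpansion2 (u_holo n zin).
  by exists (a, b).
pose L := (64 / s) ^+ 2 * B.
have L0 : 0 <= L by rewrite mulr_ge0// sqr_ge0.
have so n h : cabs h.1 <= s -> cabs h.2 <= s ->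
    cabs (u n (z + h) - u n z - (ab n).1 * h.1 - (ab n).2 * h.2) <= L * norm1 h ^+ 2.
  move=> h1 h2.
  exact: (@second_order R (u n) s (T + s) B (u_holo2 n) s0 s1 (uB n) z h _ _ zt h1 h2 (hab n)).
have cs : cabs (s%:C : C) = s by rewrite cabs_real gtr0_norm.
have zh h : cabs h.1 <= s -> cabs h.2 <= s -> polydisc (T + s + 3 * s) (z + h).
  by move=> h1 h2; split; apply: le_trans (cabsD _ _) _; lra.
have ub n h (v : C) : cabs h.1 <= s -> cabs h.2 <= s -> norm1 h = s ->
    (ab n).1 * h.1 + (ab n).2 * h.2 = v * s%:C -> cabs v <= (2 * B + L * s ^+ 2) / s.
  move=> h1 h2 hs hv; rewrite ler_pdivlMr//.
  have -> : cabs v * s = cabs (v * s%:C) by rewrite cabsM cs.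
  rewrite -hv; have := so n h h1 h2; rewrite hs => H.
  have -> : (ab n).1 * h.1 + (ab n).2 * h.2 =
     (u n (z + h) - u n z) - (u n (z + h) - u n z - (ab n).1 * h.1 - (ab n).2 * h.2).
    by ring.
  apply: le_trans (cabsB _ _) _; have := cabsB (u n (z + h)) (u n z).
  have := uB n _ (zh h h1 h2).
  by have : cabs (u n z) <= B; [apply: uB; split; lra|lra].
have hs : cabs (s%:C : C) <= s by rewrite cs.
have h0 : cabs (0 : C) <= s by rewrite cabs0 ltW.
have n1 : norm1 ((s%:C, 0) : C2) = s.
  by rewrite -[LHS]/(cabs (s%:C : C) + cabs (0 : C)) cs cabs0 addr0.
have n2 : norm1 ((0, s%:C) : C2) = s.
  by rewrite -[LHS]/(cabs (0 : C) + cabs (s%:C : C)) cs cabs0 add0r.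
have e1 n : (ab n).1 * s%:C + (ab n).2 * 0 = (ab n).1 * s%:C by rewrite mulr0 addr0.
have e2 n : (ab n).1 * 0 + (ab n).2 * s%:C = (ab n).2 * s%:C by rewrite mulr0 add0r.
have [a ha] := ultralimit UU (fun n => ub n (s%:C, 0) _ hs h0 n1 (e1 n)).
have [b hb] := ultralimit UU (fun n => ub n (0, s%:C) _ h0 hs n2 (e2 n)).
exists a, b.
have lim h : cabs h.1 <= s -> cabs h.2 <= s ->
    cabs (g (z + h) - g z - a * h.1 - b * h.2) <= L * norm1 h ^+ 2.
  move=> h1 h2; apply/ler_addgt0Pr => e e0.
  have zhin : bidisc (z + h) by have [] := zh h h1 h2; move=> ? ?; apply/bidiscE; split; lra.
  have e4 : 0 < e / 4 by lra.
  have N0 := norm1_ge0 h.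
  have e5 : 0 < e / (4 * (norm1 h + 1)) by rewrite divr_gt0// mulr_gt0//; lra.
  have [n [[[/= m1 m2] m3] m4]] := filter_ex (filterI (filterI (filterI
     (gU _ zhin _ e4) (gU _ zin _ e4)) (ha _ e5)) (hb _ e5)).
  have hb' (v : C) (k : R) : 0 <= k -> k <= norm1 h -> cabs v <= e / (4 * (norm1 h + 1)) -> cabs v * k <= e / 4.
    move=> k0 kn hv; apply: (@le_trans _ _ (e / (4 * (norm1 h + 1)) * (norm1 h + 1))).
      by apply: ler_pM => //; [exact: cabs_ge0|lra].
    by rewrite le_eqVlt; apply/orP; left; apply/eqP; field; rewrite gt_eqF//; lra.
  have g1 := cabs_ge0 h.1; have g2 := cabs_ge0 h.2.
  have q1 := hb' _ _ g1 (ltac:(by rewrite /norm1; lra)) m3.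
  have q2 := hb' _ _ g2 (ltac:(by rewrite /norm1; lra)) m4.
  rewrite -!cabsM in q1 q2.
  have -> : g (z + h) - g z - a * h.1 - b * h.2 =
    (u n (z + h) - u n z - (ab n).1 * h.1 - (ab n).2 * h.2) +
    ((u n z - g z) - (u n (z + h) - g (z + h)) + (((ab n).1 - a) * h.1 + ((ab n).2 - b) * h.2)).
    by ring.
  apply: le_trans (cabsD _ _) _.
  apply: lerD; first exact: so.
  apply: le_trans (cabsD _ _) _.
  by have := cabsB (u n z - g z) (u n (z + h) - g (z + h));
     have := cabsD (((ab n).1 - a) * h.1) (((ab n).2 - b) * h.2); lra.
move=> e e0; pose d := Num.min s (e / (2 * (L + 1))).
have d0 : 0 < d by rewrite lt_min s0 divr_gt0// mulr_gt0//; lra.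
have ds : d <= s by rewrite ge_min lexx.
have dL : L * (2 * d) <= e.
  have : d <= e / (2 * (L + 1)) by rewrite ge_min lexx orbT.
  rewrite ler_pdivlMr; last by rewrite mulr_gt0//; lra.
  by move=> ?; nra.
exists d => // h k hd kd.
have := lim (h, k) (le_trans hd ds) (le_trans kd ds) => /= H.
apply: (le_trans H); rewrite /norm1 /=.
have g1 := cabs_ge0 h; have g2 := cabs_ge0 k.
rewrite expr2 mulrA ler_wpM2r ?addr_ge0//.
apply: le_trans dL; apply: ler_wpM2l => //; lra.
Qed.

(** Pointwise limits along U are holomorphic, and the common Lipschitz bounds make
    the convergence uniform on compact polydiscs. *)
Theorem montel : exists g, holomorphic_on bidisc g /\
  forall t e : R, t < 1 -> 0 < e -> U [set n | forall z, polydisc t z -> cabs (u n z - g z) <= e].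
Proof.
have /choice[g hg] (z : C2) : exists l : C, bidisc z ->
    forall e : R, 0 < e -> U [set n | cabs (u n z - l) <= e].
  have [zin|zout] := pselect (bidisc z); last by exists 0.
  have [z1 z2] := (bidiscE z).1 zin.
  have T1 : Num.max (cabs z.1) (cabs z.2) < 1 by rewrite gt_max z1.
  have [B uB] := u_bounded T1.
  have [l hl] := @ultralimit U (fun n => u n z) B UU (fun n => uB n z
    (ltac:(by split; rewrite le_max lexx ?orbT))).
  by exists l => _.
have g_holo : holomorphic_on bidisc g.
  move=> z zin; have [a [b]] := ulim_expansion hg zin.
  exact: cexpansion2_differentiable.
exists g; split=> // t e t1 e0.
pose s := (1 - t) / 3; have s0 : 0 < s by rewrite /s; lra.
have [B uB] := u_bounded (ltac:(rewrite /s; lra) : t + s < 1).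
have K : compact (annulus_disc 0 t t) := @compact_annulus_disc R 0 t t.
have := @compact_covering R (annulus_disc 0 t t) nat U _
  (fun n z => cabs (u n z - g z) <= e) K.
rewrite -polydiscE => main; apply: main => z [z1 z2].
have zin : bidisc z by apply/bidiscE; split; lra.
have B0 : 0 <= B by apply: le_trans (cabs_ge0 (u 0%N z)) (uB _ _ _); split; lra.
have e3 : 0 < e / 3 by lra.
have [d1 d10 hd1] := differentiable_cont2 (g_holo z zin) e3.
pose L := 64 * B / s.
have L0 : 0 <= L.
  by apply: divr_ge0; [apply: mulr_ge0|exact: ltW].
pose d := Num.min (Num.min d1 s) (e / 3 / (2 * (L + 1))).
have d0 : 0 < d by rewrite !lt_min d10 s0 divr_gt0// mulr_gt0//; lra.
exists d => //; exists [set n | cabs (u n z - g z) <= e / 3]; first exact: hg.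
move=> n w /= nz [w1 w2] wz1 wz2.
have dd1 : d <= d1 by rewrite !ge_min lexx.
have ds : d <= s by rewrite !ge_min lexx orbT.
have dL : L * (2 * d) <= e / 3.
  have : d <= e / 3 / (2 * (L + 1)) by rewrite !ge_min lexx !orbT.
  rewrite ler_pdivlMr; last by rewrite mulr_gt0//; lra.
  by move=> ?; nra.
have gw := hd1 w (le_trans wz1 dd1) (le_trans wz2 dd1).
have uw := @cauchy_lipschitz2 R (u n) 1 t s B (u_holo2 n) s0
  (ltac:(rewrite /s; lra)) (uB n) w z (conj w1 w2) (conj z1 z2)
  (le_trans wz1 ds) (le_trans wz2 ds).
have {}uw : cabs (u n w - u n z) <= e / 3.
  apply: (le_trans uw); apply: le_trans dL; apply: ler_wpM2l => //.
  rewrite /norm1; have : cabs (w - z).1 <= d by [].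
  have : cabs (w - z).2 <= d by []. lra.
have -> : u n w - g w = (u n w - u n z) + (u n z - g z) - (g w - g z) by ring.
apply: le_trans (cabsB _ _) _; have := cabsD (u n w - u n z) (u n z - g z); lra.
Qed.
End Montel.

(** * Boundary distances of slices and thin annuli *)

Section Geometry.
Variable R : realType.
Local Notation C := (CC R).
Local Notation C2 := (CC2 R).
Local Notation R1 := (measurableTypeR R).
Local Notation R2 := (R1 * R1)%type.
Local Notation lam2 := (@lebesgue2 R).

Lemma compact_lt1 (a c : R) (F : C2 -> R) : 0 <= a <= 1 -> 0 <= c <= 1 ->
  (forall (z : C2) (e : R), polydisc 1 z -> 0 < e -> exists2 d : R, 0 < d & forall w : C2, polydisc 1 w ->
     cabs (w.1 - z.1) <= d -> cabs (w.2 - z.2) <= d -> `|F w - F z| <= e) ->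
  (forall z, cabs z.1 <= a -> cabs z.2 <= c -> F z < 1) ->
  exists2 d : R, 0 < d & forall z, cabs z.1 <= a -> cabs z.2 <= c -> F z <= 1 - d.
Proof.
move=> /andP[a0 a1] /andP[c0 c1] Fcont F1.
have sub z : annulus_disc 0 a c z -> polydisc 1 z.
  by move=> [/andP[_ z1] z2]; split; lra.
have ne : annulus_disc 0 a c !=set0 by exists (0, 0); split; rewrite cabs0 ?lexx.
have [z zK e e0|m [/andP[_ m1] m2] hm] := @compact_maximum R _ F (@compact_annulus_disc R 0 a c) ne.
  have [d d0 hd] := Fcont z e (sub _ zK) e0.
  by exists d => // w wK; apply: hd; exact: sub.
exists (1 - F m); first by rewrite subr_gt0 F1.
move=> z z1 z2; have : F z <= F m; last lra.
by apply: hm; split=> //; rewrite cabs_ge0.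
Qed.

Lemma pow_small (rho : R) : 0 <= rho < 1 -> exists2 n, (0 < n)%N & rho ^+ n <= 2^-1.
Proof.
move=> /andP[r0 r1].
have c : (rho ^+ n) @[n --> \oo] --> (0 : R) by apply: cvg_expr; rewrite ger0_norm.
have h : 0 < 2^-1 :> R by [].
have /cvgrPdist_le /(_ _ h) [N _ hN] := c.
exists N.+1 => //; have := hN N.+1 (leqnSn _).
by rewrite sub0r normrN ger0_norm ?exprn_ge0.
Qed.

Lemma bernoulli (x : R) n : 0 <= x <= 1 -> 1 - x ^+ n <= n%:R * (1 - x).
Proof.
move=> /andP[x0 x1]; elim: n => [|n IH]; first by rewrite expr0 subrr mul0r.
have h : x ^+ n <= 1 by rewrite exprn_ile1.
by rewrite exprS -natr1; nra.
Qed.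

(** Near the circle the Schwarz bound |h|^n <= |y| and Bernoulli's inequality give
    the factor 1/n; on |y| <= 1/2 the bound by rho suffices. *)
Lemma slice_boundary_distance (h : C -> C) (rho : R) n :
  holo h 0 1 -> (forall z, cabs z < 1 -> cabs (h z) < 1) ->
  (forall z, cabs z <= 2^-1 -> cabs (h z) <= rho) -> rho < 1 -> rho ^+ n <= 2^-1 -> (0 < n)%N ->
  forall y, cabs y < 1 -> Num.min n%:R^-1 (1 - rho) * (1 - cabs y) <= 1 - cabs (h y).
Proof.
move=> hh h1 hrho rho1 rn n0 y y1.
have y0 := cabs_ge0 y; have hy0 := cabs_ge0 (h y); have hy1 := h1 y y1.
have [y2|y2] := leP (2^-1) (cabs y).
  apply: (@le_trans _ _ (n%:R^-1 * (1 - cabs y))).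
    by apply: ler_wpM2r; [lra|rewrite ge_min lexx].
  have nR : 0 < n%:R :> R by rewrite ltr0n.
  rewrite mulrC ler_pdivrMr//.
  have := @schwarz_power R h rho n hh (fun z zz => ltW (h1 z zz)) hrho rn y.
  rewrite y2 y1 => /(_ isT).
  have := @bernoulli (cabs (h y)) n; rewrite hy0 (ltW hy1) => /(_ isT); lra.
have := hrho y (ltW y2).
have : Num.min n%:R^-1 (1 - rho) <= 1 - rho by rewrite ge_min lexx orbT.
by nra.
Qed.

Lemma annulus_small (e : R) : 0 < e -> exists2 r, 0 <= r < 1 &
  (lam2 [set p : R2 | (r < cabs (cpl p) < 1)%R] <= e%:E)%E.
Proof.
move=> e0; pose F n := [set p : R2 | (1 - n.+1%:R^-1 < cabs (cpl p) < 1)%R].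
have F0 : (lam2 (F 0%N) < +oo)%E.
  have two : 0 < 2 :> R by [].
  apply: le_lt_trans (@lam2_square_lty R (-1) (-1) 2 two).
  apply: le_measure; rewrite ?inE; [exact: measurable_annulus|exact: measurable_square|].
  by move=> p /andP[_]; exact: disc_square.
have Fcap : \bigcap_n F n = set0.
  apply/seteqP; split => // p hp.
  have /andP[_ p1] := hp 0%N I.
  have d0 : 0 < 1 - cabs (cpl p) by rewrite subr_gt0.
  pose n := Num.bound (1 - cabs (cpl p))^-1.
  have /andP[h _] := hp n I.
  have hn : (1 - cabs (cpl p))^-1 < n.+1%:R.
    apply: lt_le_trans (archi_boundP _) _; first by rewrite invr_ge0 ltW.
    by rewrite ler_nat.
  have : n.+1%:R^-1 < 1 - cabs (cpl p).
    by rewrite invf_plt ?posrE.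
  by rewrite ltNge ltW //; move: h; rewrite ltrBlDr -ltrBlDl.
have := @nonincreasing_cvg_mu _ _ R lam2 F F0 (fun i => measurable_annulus _).
rewrite Fcap measure0 => /(_ measurable0) cv.
have {}cv : lam2 (F n) @[n --> \oo] --> 0%E.
  apply: cv => m n mn; apply/subsetPset => p /andP[h1 h2]; apply/andP; split=> //.
  apply: le_lt_trans h1; rewrite lerD2l lerN2.
  by rewrite lef_pV2 ?posrE ?ltr0n// ler_nat.
have /fine_cvgP[_ /cvgrPdist_le /(_ _ e0) [N _ hN]] := cv.
exists (1 - N.+1%:R^-1).
  by rewrite subr_ge0 invf_le1 ?ltr0n// ler1n/= ltrBlDr ltrDl invr_gt0 ltr0n.
have := hN N (leqnn _); rewrite sub0r normrN /= => h.
have fN : lam2 (F N) \is a fin_num.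
  rewrite (ge0_fin_numE (measure_ge0 lam2 _)); apply: le_lt_trans F0.
  apply: le_measure; rewrite ?inE; [exact: measurable_annulus|exact: measurable_annulus|].
  move=> p /andP[h1 h2]; apply/andP; split=> //.
  apply: le_lt_trans h1; rewrite lerD2l lerN2.
  by rewrite lef_pV2 ?posrE ?ltr0n// ler_nat.
rewrite -[leLHS]fineK// lee_fin; apply: le_trans h; exact: ler_norm.
Qed.
End Geometry.

(** * The composition estimate *)

Section Sufficiency.
Variable R : realType.
Local Notation C := (CC R).
Local Notation C2 := (CC2 R).
Local Notation R1 := (measurableTypeR R).
Local Notation R2 := (R1 * R1)%type.
Local Notation R4 := (R2 * R2)%type.
Local Notation lam2 := (@lebesgue2 R).
Local Notation lam4 := (@volume R).
Local Notation c := (tentc R).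

Variables (phi phib : C2 -> C2).
Hypothesis phi_self : forall z, bidisc z -> bidisc (phi z).
Hypothesis phi_holo : forall b, holomorphic_on bidisc (fun z => component b (phi z)).
Hypothesis comp_holo : forall f : C2 -> C, holomorphic_on bidisc f -> holomorphic_on bidisc (f \o phi).
Hypothesis phib_ext : forall z, bidisc z -> phib z = phi z.
Hypothesis phib_cont : forall b (z : C2) (e : R), polydisc 1 z -> 0 < e ->
  exists2 d : R, 0 < d & forall w : C2, polydisc 1 w ->
    cabs (w.1 - z.1) <= d -> cabs (w.2 - z.2) <= d ->
    cabs (component b (phib w) - component b (phib z)) <= e.
Hypothesis phib_torus : forall z, polydisc 1 z -> ~ (cabs (phib z).1 = 1 /\ cabs (phib z).2 = 1).
Hypothesis phib_boundary : forall z, polydisc 1 z -> ~ (cabs z.1 = 1 /\ cabs z.2 = 1) ->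
  forall b, cabs (component b (phib z)) < 1.
Hypothesis phib_le1 : forall b z, polydisc 1 z -> cabs (component b (phib z)) <= 1.

Let component_lt1 b z : bidisc z -> cabs (component b (phi z)) < 1.
Proof. by move=> /phi_self /bidiscE[]; case: b. Qed.

Let cabs_cont b (z : C2) (e : R) : polydisc 1 z -> 0 < e ->
  exists2 d : R, 0 < d & forall w : C2, polydisc 1 w ->
    cabs (w.1 - z.1) <= d -> cabs (w.2 - z.2) <= d ->
    `|cabs (component b (phib w)) - cabs (component b (phib z))| <= e.
Proof.
move=> z1 e0; have [d d0 hd] := phib_cont b z1 e0.
by exists d => // w w1 h1 h2; apply: le_trans (cabs_lip _ _) (hd _ w1 h1 h2).
Qed.

Let min_cont (z : C2) (e : R) : polydisc 1 z -> 0 < e ->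
  exists2 d : R, 0 < d & forall w : C2, polydisc 1 w ->
    cabs (w.1 - z.1) <= d -> cabs (w.2 - z.2) <= d ->
    `|Num.min (cabs (phib w).1) (cabs (phib w).2) - Num.min (cabs (phib z).1) (cabs (phib z).2)| <= e.
Proof.
move=> z1 e0; have [d d0 hd] := cabs_cont true z1 e0.
have [d' d'0 hd'] := cabs_cont false z1 e0.
exists (Num.min d d'); first by rewrite lt_min d0.
move=> w w1; rewrite !le_min => /andP[a1 a2] /andP[b1 b2].
have := hd w w1 a1 b1; have := hd' w w1 a2 b2; rewrite /component.
move: (cabs (phib w).1) (cabs (phib w).2) (cabs (phib z).1) (cabs (phib z).2) => p q r s.
by rewrite /Num.min !ler_norml => /andP[? ?] /andP[? ?]; case: ifP; case: ifP; lra.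
Qed.

(** No point of the closed bidisc is mapped to the torus, and compactness makes this quantitative. *)
Lemma separated : exists2 d, 0 < d & forall b z, bidisc z ->
  cabs (component b (phi z)) <= 1 - d \/ cabs (component (~~ b) (phi z)) <= 1 - d.
Proof.
have h1 : 0 <= (1 : R) <= 1 by rewrite ler01 lexx.
have [|d d0 hd] := @compact_lt1 R 1 1 _ h1 h1 min_cont.
  move=> z z1 z2; rewrite gt_min; apply/orP.
  have P : polydisc 1 z by split.
  have /= l1 := phib_le1 true P; have /= l2 := phib_le1 false P.
  have [e1|] := eqVneq (cabs (phib z).1) 1; last by move=> ?; left; rewrite lt_neqAle; apply/andP.
  have [e2|] := eqVneq (cabs (phib z).2) 1; last by move=> ?; right; rewrite lt_neqAle; apply/andP.
  by case: (phib_torus P).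
exists d => // b z zin; have [z1 z2] := (bidiscE z).1 zin.
have := hd z (ltW z1) (ltW z2); rewrite (phib_ext zin) ge_min => /orP[] h.
  by case: b; [left|right].
by case: b; [right|left].
Qed.

(** A closed bidisc one of whose radii is below 1 misses the torus, so its image is
    compactly contained in the bidisc. *)
Lemma away_from_torus (a a' : R) b : 0 <= a <= 1 -> 0 <= a' <= 1 -> a < 1 \/ a' < 1 ->
  exists2 d, 0 < d & forall z, bidisc z -> cabs z.1 <= a -> cabs z.2 <= a' ->
    cabs (component b (phi z)) <= 1 - d.
Proof.
move=> ha ha' aa.
have [|d d0 hd] := @compact_lt1 R a a' _ ha ha' (cabs_cont b).
  move=> z z1 z2; apply: phib_boundary.
    by move/andP: ha => [_ ?]; move/andP: ha' => [_ ?]; split; lra.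
  by move=> [e1 e2]; lra.
by exists d => // z zin z1 z2; rewrite -(phib_ext zin); exact: hd.
Qed.

(** The slices y |-> phi_b (x, y) satisfy the Schwarz estimate with constants that
    do not depend on x, because the points with |y| <= 1/2 stay away from the torus. *)
Lemma slice_constants b : exists kap rho : R, [/\ 0 < kap, rho < 1,
  (forall x y : C, cabs x < 1 -> cabs y < 1 -> kap * (1 - cabs y) <= 1 - cabs (component b (phi (x, y)))) &
  (forall x : C, cabs x < 1 -> cabs (component b (phi (x, 0))) <= rho)].
Proof.
have h1 : 0 <= (1 : R) <= 1 by rewrite ler01 lexx.
have h2 : 0 <= (2^-1 : R) <= 1 by lra.
have [|d d0 hd] := @away_from_torus 1 2^-1 b h1 h2; first by right; lra.
pose rho := 1 - d.
have hrho (x y : C) : cabs x < 1 -> cabs y <= 2^-1 -> cabs (component b (phi (x, y))) <= rho.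
  by move=> x1 y1; apply: hd => //=; [apply/bidiscE; split=> /=; lra|lra].
have z0 : cabs (0 : C) = 0 := cabs0 R.
have rho0 : 0 <= rho < 1.
  have := hrho 0 0; rewrite z0 => /(_ ltac:(lra) ltac:(lra)) h.
  by have := cabs_ge0 (component b (phi (0, 0))); rewrite /rho in h *; lra.
have [n n0 rn] := pow_small rho0.
exists (Num.min n%:R^-1 (1 - rho)), rho; split.
- by rewrite lt_min invr_gt0 ltr0n n0/= /rho; lra.
- by have /andP[] := rho0.
- move=> x y x1; apply: (@slice_boundary_distance R (fun y => component b (phi (x, y))) rho n) => //.
  + exact: (holo_slice2 (phi_holo b)).
  + by move=> z zz; apply: component_lt1; apply/bidiscE.
  + by move=> z; exact: hrho.
  + by have /andP[] := rho0.
- by move=> x x1; apply: hrho => //; rewrite z0; lra.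
Qed.

Let Efar b (t : R) : set R4 := @bidisc4 R `&`
  [set q | t < cabs (component b (phi (Defs.cpoint q)))].

Let measurable_Efar b t : measurable (Efar b t).
Proof.
pose F : R4 -> R := (fun q : R4 => cabs (component b (phi (Defs.cpoint q)))) \_ (@bidisc4 R).
have mF : measurable_fun setT (F : R4 -> R1).
  exact: (@restrict_measurable R (fun z => component b (phi z)) (@cabs R) (@cabs_lip R) (phi_holo b)).
have -> : Efar b t = @bidisc4 R `&` ~` [set q | F q <= t].
  have FE q : bidisc4 q -> F q = cabs (component b (phi (Defs.cpoint q))).
    by move=> qin; rewrite /F patchE mem_set.
  apply/seteqP; split => q [qin h]; split => //.
    by apply/negP; rewrite -ltNge FE.
  by move/negP: h; rewrite -ltNge FE.
apply: measurableI; first exact: measurable_bidisc4.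
by apply: measurableC; exact: measurable_sublevel.
Qed.

(* K does not depend on A: a smaller A only requires a threshold t0 closer to 1, as
   points where phi_b is near the circle have their first coordinate near it. *)
Let tail b : exists2 K : R, 0 <= K & forall A : R, 0 < A -> exists2 t0, t0 < 1 &
  forall t f, t0 <= t -> holomorphic_on bidisc f ->
  (\int[lam4]_(z in Efar b t) ((cabs (f (phi (Defs.cpoint z)))) ^+ 2)%:E <=
   (K * A)%:E * sqnorm f)%E.
Proof.
have [d d0 hd] := separated.
have [kap [rho [kap0 rho1 sk sr]]] := slice_constants b.
pose K := 36 / (c ^+ 2 * d ^+ 2) * carleson_const kap rho.
have K0 : 0 <= K.
  rewrite /K /carleson_const.
  have r0 : 0 < 1 - rho by lra.
  have c0 : 0 < c := tentc_gt0 R.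
  have k1 : 0 < kap * (1 - rho) by rewrite mulr_gt0.
  have k2 : 0 < kap ^+ 2 by rewrite exprn_gt0.
  apply: mulr_ge0; first by rewrite divr_ge0// mulr_ge0// sqr_ge0.
  apply: addr_ge0; first by rewrite divr_ge0// ltW.
  by rewrite divr_ge0 ?(ltW k1)// mulr_ge0// ltW.
exists K => // A A0; have [r /andP[r0 r1] hA] := annulus_small A0.
have r01 : 0 <= r <= 1 by rewrite r0 ltW.
have h1 : 0 <= (1 : R) <= 1 by rewrite ler01 lexx.
have [d' d'0 hd'] := away_from_torus b r01 h1 (or_introl r1).
exists (Num.max (1 - d) (1 - d')); first by rewrite gt_max; apply/andP; split; lra.
move=> t f; rewrite ge_max => /andP[t1 t2] fh.
apply: (@tail_estimate R phi b phi_self phi_holo (Efar b t) d r kap rho A) => //.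
- by move=> q [].
- by move=> q [qin h]; rewrite /mkset in h; have [] := hd b _ qin; lra.
- move=> q [qin h]; rewrite ltNge; apply/negP => h2; rewrite /mkset in h.
  have := (bidiscE _).1 qin; rewrite cpointE => -[_ q2].
  have := hd' _ qin; rewrite cpointE => /(_ h2 (ltW q2)).
  by rewrite -cpointE; lra.
- exact: ltW.
- exact: comp_holo.
Qed.

Lemma lam4_bidisc : (lam4 (@bidisc4 R) <= 16%:E)%E.
Proof.
have two : 0 < 2 :> R by [].
pose S : set R2 := square (-1) (-1) 2.
have mS : measurable S := measurable_square _ _ _.
apply: (@le_trans _ _ (lam4 (S `*` S))).
  apply: le_measure; rewrite ?inE; [exact: measurable_bidisc4|exact: measurableX|].
  by move=> q /bidisc4E[q1 q2]; split; exact: disc_square.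
have -> : lam4 (S `*` S) = (lam2 S * lam2 S)%E by rewrite /volume product_measure1E.
by rewrite lam2_square// -EFinM lee_fin; lra.
Qed.

(** Where a component of phi exceeds t the tail estimate applies; elsewhere f o phi
    only sees f on the polydisc of radius t. The coefficient e of the square norm of
    f can be as small as desired. *)
Lemma composition_estimate (e : R) : 0 < e -> exists2 t, t < 1 &
  forall f (m : R), holomorphic_on bidisc f -> (forall z, polydisc t z -> cabs (f z) <= m) ->
  (sqnorm (f \o phi) <= e%:E * sqnorm f + (16 * m ^+ 2)%:E)%E.
Proof.
move=> e0; have [K1 K10 h1] := tail true; have [K2 K20 h2] := tail false.
pose A := e / (K1 + K2 + 1).
have A0 : 0 < A by rewrite divr_gt0//; lra.
have Ae : K1 * A + K2 * A <= e.
  have -> : e = A * (K1 + K2 + 1) by rewrite /A; field; rewrite gt_eqF//; lra.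
  by nra.
have [t1 t11 {}h1] := h1 A A0; have [t2 t21 {}h2] := h2 A A0.
pose t := Num.max t1 t2; exists t; first by rewrite gt_max t11.
move=> f m fh fm.
have {}h1 := h1 t f (ltac:(by rewrite le_max lexx)) fh.
have {}h2 := h2 t f (ltac:(by rewrite le_max lexx orbT)) fh.
have Fh := comp_holo fh.
pose F := modsq (f \o phi).
have mF : measurable_fun setT (F : R4 -> R1) := modsq_measurable Fh.
have F0 q : 0 <= F q := modsq_ge0 _ q.
have m2 : 0 <= m ^+ 2 := sqr_ge0 m.
pose F1 (q : R4) : R := \1_(Efar true t) q * F q.
pose F2 (q : R4) : R := \1_(Efar false t) q * F q.
pose F3 (q : R4) : R := \1_(@bidisc4 R) q * m ^+ 2.
have mI (E : set R4) : measurable E -> measurable_fun setT (\1_E : R4 -> R1).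
  by move=> mE; exact: measurable_indic.
have mF1 : measurable_fun setT (F1 : R4 -> R1).
  by apply: measurable_funM => //; apply: mI; exact: measurable_Efar.
have mF2 : measurable_fun setT (F2 : R4 -> R1).
  by apply: measurable_funM => //; apply: mI; exact: measurable_Efar.
have mF3 : measurable_fun setT (F3 : R4 -> R1).
  by apply: measurable_funM => //; apply: mI; exact: measurable_bidisc4.
have F10 q : 0 <= F1 q by rewrite mulr_ge0.
have F20 q : 0 <= F2 q by rewrite mulr_ge0.
have F30 q : 0 <= F3 q by rewrite mulr_ge0.
have I (b : bool) : (\int[lam4]_q (\1_(Efar b t) q * F q)%:E =
   \int[lam4]_(z in Efar b t) ((cabs (f (phi (Defs.cpoint z)))) ^+ 2)%:E)%E.
  rewrite [RHS]integral_mkcond; apply: eq_integral => q _; rewrite patchE indicE.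
  case: ifPn => [|_]; last by rewrite mul0r.
  by move=> /set_mem[qin _]; rewrite mul1r /F modsq_in.
have I3 : (\int[lam4]_q (F3 q)%:E <= (16 * m ^+ 2)%:E)%E.
  have -> : (\int[lam4]_q (F3 q)%:E = \int[lam4]_q ((m ^+ 2)%:E * (\1_(@bidisc4 R) q)%:E))%E.
    by apply: eq_integral => q _; rewrite -EFinM mulrC.
  have mB := @measurable_bidisc4 R.
  have i0 q : (0 <= (\1_(@bidisc4 R) q : R)%:E)%E by rewrite lee_fin.
  have e1 : measurable_fun setT (fun q : R4 => (\1_(@bidisc4 R) q)%:E : \bar R1).
    by apply/measurable_EFinP; exact: mI.
  rewrite (@ge0_integralZl_EFin _ R4 R lam4 setT measurableT _ (fun q _ => i0 q) e1 _ m2).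
  rewrite (@integral_indic _ R4 R lam4 setT measurableT _ mB) setIT.
  rewrite (mulrC 16) [X in (_ <= X)%E]EFinM; apply: lee_wpmul2l; [by rewrite lee_fin|exact: lam4_bidisc].
rewrite sqnormE -/F.
apply: (@le_trans _ _ (\int[lam4]_q ((F1 q)%:E + (F2 q)%:E + (F3 q)%:E))%E).
  apply: (@ge0_le_integral _ R4 R lam4 setT measurableT).
  - by move=> q _; rewrite lee_fin.
  - exact/measurable_EFinP.
  - apply: emeasurable_funD; last exact/measurable_EFinP.
    by apply: emeasurable_funD; exact/measurable_EFinP.
  - move=> q _; rewrite -!EFinD lee_fin.
    have [qin|qout] := pselect (bidisc4 q); last by rewrite {1}/F modsq_out// !addr_ge0.
    have [q1|q1] := leP (cabs (component true (phi (Defs.cpoint q)))) t; last first.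
      have -> : F1 q = F q by rewrite /F1 indicE mem_set// mul1r.
      by rewrite -addrA lerDl addr_ge0.
    have [q2|q2] := leP (cabs (component false (phi (Defs.cpoint q)))) t; last first.
      have -> : F2 q = F q by rewrite /F2 indicE mem_set// mul1r.
      by rewrite addrAC lerDr addr_ge0.
    have -> : F3 q = m ^+ 2 by rewrite /F3 indicE mem_set// mul1r.
    rewrite {1}/F modsq_in//; apply: (@le_trans _ _ (m ^+ 2)); last by rewrite lerDr addr_ge0.
    have h : cabs (f (phi (Defs.cpoint q))) <= m by apply: fm.
    by rewrite ler_pXn2r// nnegrE ?cabs_ge0//; apply: le_trans h; exact: cabs_ge0.
have e1 : measurable_fun setT (fun q : R4 => (F1 q)%:E : \bar R1) by exact/measurable_EFinP.
have e2 : measurable_fun setT (fun q : R4 => (F2 q)%:E : \bar R1) by exact/measurable_EFinP.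
have e3 : measurable_fun setT (fun q : R4 => (F3 q)%:E : \bar R1) by exact/measurable_EFinP.
have p1 (q : R4) : setT q -> (0 <= (F1 q)%:E)%E by rewrite lee_fin.
have p2 (q : R4) : setT q -> (0 <= (F2 q)%:E)%E by rewrite lee_fin.
have p3 (q : R4) : setT q -> (0 <= (F3 q)%:E)%E by rewrite lee_fin.
have p12 (q : R4) : setT q -> (0 <= (F1 q)%:E + (F2 q)%:E)%E.
  by rewrite -EFinD lee_fin addr_ge0.
rewrite (@ge0_integralD _ R4 R lam4 setT measurableT _ _ p12 (emeasurable_funD e1 e2) p3 e3).
rewrite (@ge0_integralD _ R4 R lam4 setT measurableT _ _ p1 e1 p2 e2).
apply: leeD; last exact: I3.
rewrite (I true) (I false); apply: le_trans (leeD h1 h2) _.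
have KA1 : 0 <= K1 * A := mulr_ge0 K10 (ltW A0).
have KA2 : 0 <= K2 * A := mulr_ge0 K20 (ltW A0).
rewrite -ge0_muleDl ?lee_fin//.
by apply: lee_wpmul2r; [exact: sqnorm_ge0|rewrite -EFinD lee_fin].
Qed.
End Sufficiency.

(** * Compactness of the composition operator *)

Section Compactness.
Variable R : realType.
Local Notation C := (CC R).
Local Notation C2 := (CC2 R).
Local Notation R1 := (measurableTypeR R).
Local Notation R2 := (R1 * R1)%type.
Local Notation R4 := (R2 * R2)%type.
Local Notation lam4 := (@volume R).
Local Notation c := (tentc R).

Lemma polydisc_bounded (f : C2 -> C) (t : R) : holomorphic_on bidisc f -> t < 1 ->
  exists2 m, 0 <= m & forall z, polydisc t z -> cabs (f z) <= m.
Proof.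
move=> fh t1; have [|M hM] := @compact_bound R (annulus_disc 0 t t) f (@compact_annulus_disc R 0 t t).
  move=> z [/andP[_ z1] z2].
  have zin : bidisc z by apply/bidiscE; split; lra.
  have [d d0 hd] := differentiable_cont2 (fh z zin) (ltr01 : 0 < 1 :> R).
  by exists d => // w _; exact: hd.
exists (Num.max M 0); first by rewrite le_max lexx orbT.
by move=> z; rewrite polydiscE => /hM h; rewrite le_max h.
Qed.

Lemma measurable_polydisc (t : R) : measurable [set q : R4 | polydisc t (Defs.cpoint q)].
Proof.
have -> : [set q : R4 | polydisc t (Defs.cpoint q)] =
    [set p : R2 | cabs (cpl p - 0) <= t] `*` [set p : R2 | cabs (cpl p - 0) <= t].
  by apply/seteqP; split => q; rewrite /polydisc /setX /mkset cpointE !subr0.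
by apply: measurableX; apply: measurable_sublevel; exact: measurable_cabs_cpl.
Qed.

(** Monotone convergence along the polydiscs of radius 1 - 1/(k + 1). *)
Lemma exhaustion_bound (f : C2 -> C) (B : R) : holomorphic_on bidisc f ->
  (forall t : R, t < 1 -> (\int[lam4]_(q in [set q | polydisc t (Defs.cpoint q)]) (modsq f q)%:E <= B%:E)%E) ->
  (sqnorm f <= B%:E)%E.
Proof.
move=> fh hB; pose T k : R := 1 - k.+1%:R^-1.
have T1 k : T k < 1 by rewrite ltrBlDr ltrDl invr_gt0 ltr0n.
pose F k : set R4 := [set q | polydisc (T k) (Defs.cpoint q)].
have mF k : measurable (F k) by exact: measurable_polydisc.
have ndF : {homo F : n m / (n <= m)%N >-> (n <= m)%O}.
  move=> n m nm; apply/subsetPset => q [q1 q2].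
  have Tnm : T n <= T m by rewrite lerD2l lerN2 lef_pV2 ?posrE ?ltr0n// ler_nat.
  by split; apply: le_trans Tnm.
have UF : \bigcup_k F k = @bidisc4 R.
  apply/seteqP; split => q; first by move=> [k _ [q1 q2]]; apply/bidiscE; split; apply: le_lt_trans (T1 k).
  move=> /bidiscE[q1 q2].
  pose M := Num.max (cabs (Defs.cpoint q).1) (cabs (Defs.cpoint q).2).
  have M1 : M < 1 by rewrite gt_max q1.
  have d0 : 0 < 1 - M by rewrite subr_gt0.
  pose k := Num.bound (1 - M)^-1.
  have hk : (1 - M)^-1 < k.+1%:R.
    apply: lt_le_trans (archi_boundP _) _; first by rewrite invr_ge0 ltW.
    by rewrite ler_nat.
  have MT : M <= T k.
    have : k.+1%:R^-1 < 1 - M by rewrite invf_plt ?posrE.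
    by rewrite /T lerBrDr -lerBrDl => /ltW.
  by exists k => //; split; apply: le_trans MT; rewrite le_max lexx ?orbT.
have mf : measurable_fun setT (fun q : R4 => (modsq f q)%:E : \bar R1).
  by apply/measurable_EFinP; exact: modsq_measurable.
have cv := @ge0_nondecreasing_set_cvg_integral _ R4 R F (fun q => (modsq f q)%:E) lam4 ndF mF
  (fun i => measurable_funTS mf) (fun i x _ => modsq_ge0 f x).
have -> : sqnorm f = (\int[lam4]_(q in \bigcup_k F k) (modsq f q)%:E)%E.
  rewrite UF /sqnorm; apply: eq_integral => q /set_mem qin.
  by rewrite modsq_in.
rewrite -(cvg_lim _ cv)//; apply: lime_le.
  by apply/cvg_ex; eexists; exact: cv.
by apply: nearW => k; exact: hB.
Qed.

(** On a compact polydisc the limit is within 1 of some u n, which bounds its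
    square integral there by 2 M^2 + 2 * 16. *)
Lemma limit_sqnorm (f g : C2 -> C) (M : R) (U : set_system nat) (u : nat -> C2 -> C) :
  ProperFilter U -> holomorphic_on bidisc g -> (forall n, bergman (u n)) ->
  (forall n, bergman_norm (u n) <= M) ->
  (forall t e : R, t < 1 -> 0 < e -> U [set n | forall z, polydisc t z -> cabs (u n z - g z) <= e]) ->
  (sqnorm g <= (2 * M ^+ 2 + 32)%:E)%E.
Proof.
move=> PU gh ub uM ug; apply: exhaustion_bound => // t t1.
have [n /= hn] := filter_ex (ug t 1 t1 ltr01).
set S := [set q | _].
have mI : measurable_fun setT (\1_(@bidisc4 R) : R4 -> R1).
  by apply: measurable_indic; exact: measurable_bidisc4.
pose G1 (q : R4) := (2%:E * (modsq (u n) q)%:E)%E.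
pose G2 (q : R4) := (2%:E * (\1_(@bidisc4 R) q)%:E : \bar R)%E.
have mm : measurable_fun setT (fun q : R4 => (modsq (u n) q)%:E : \bar R1).
  by apply/measurable_EFinP; apply: modsq_measurable; have [] := ub n.
have m1 : measurable_fun setT (fun q : R4 => (\1_(@bidisc4 R) q)%:E : \bar R1).
  exact/measurable_EFinP.
have i0 (q : R4) : setT q -> (0 <= (\1_(@bidisc4 R) q : R)%:E)%E by rewrite lee_fin.
have p0 (q : R4) : setT q -> (0 <= (modsq (u n) q)%:E)%E by rewrite lee_fin modsq_ge0.
have mG1 : measurable_fun setT (G1 : R4 -> \bar R1) by exact: emeasurable_funM.
have mG2 : measurable_fun setT (G2 : R4 -> \bar R1) by exact: emeasurable_funM.
have G10 (q : R4) : setT q -> (0 <= G1 q)%E.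
  by move=> _; rewrite /G1 mule_ge0// ?lee_fin ?modsq_ge0.
have G20 (q : R4) : setT q -> (0 <= G2 q)%E.
  by move=> _; rewrite /G2 mule_ge0// lee_fin.
have two : 0 <= 2 :> R by [].
have mB := @measurable_bidisc4 R.
apply: (@le_trans _ _ (\int[lam4]_q (G1 q + G2 q))%E); last first.
  rewrite (@ge0_integralD _ R4 R lam4 setT measurableT _ _ G10 mG1 G20 mG2).
  rewrite EFinD; apply: leeD.
    rewrite (@ge0_integralZl_EFin _ R4 R lam4 setT measurableT _ p0 mm _ two) EFinM.
    apply: lee_wpmul2l => //; rewrite -sqnormE bergman_sqnorm// lee_fin.
    have s0 : 0 <= bergman_norm (u n) := sqrtr_ge0 _.
    by rewrite ler_pXn2r// nnegrE; apply: le_trans (uM n).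
  rewrite (@ge0_integralZl_EFin _ R4 R lam4 setT measurableT _ i0 m1 _ two).
  rewrite (@integral_indic _ R4 R lam4 setT measurableT _ mB) setIT.
  have -> : (32 : R) = 2 * 16 by ring.
  by rewrite EFinM; apply: lee_wpmul2l => //; exact: lam4_bidisc.
rewrite integral_mkcond.
have S_bi q : S q -> bidisc4 q.
  by move=> [q1 q2]; apply/bidiscE; split; apply: le_lt_trans t1.
have mS : measurable S := measurable_polydisc t.
apply: (@ge0_le_integral _ R4 R lam4 setT measurableT).
- by move=> q _; rewrite patchE; case: ifP => _ //; rewrite lee_fin modsq_ge0.
- apply/(measurable_restrictT _ mS); apply: measurable_funTS.
  by apply/measurable_EFinP; exact: modsq_measurable.
- exact: emeasurable_funD.
- move=> q _; rewrite patchE; case: ifPn => [/set_mem Sq|_]; last exact: adde_ge0 (G10 q I) (G20 q I).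
  have qin := S_bi q Sq.
  rewrite /G1 /G2 !modsq_in// indicE mem_set// -!EFinM -EFinD lee_fin.
  have := hn _ Sq; set x := u n _; set y := g _ => hxy.
  have -> : y = x - (x - y) by ring.
  apply: le_trans (cabs_sqrD _ _) _; rewrite lerD2l mulr1.
  have := cabs_ge0 (x - y); nra.
Qed.

Variables (phi : C2 -> C2).
Hypothesis phi_self : forall z, bidisc z -> bidisc (phi z).
Hypothesis comp_holo : forall f : C2 -> C, holomorphic_on bidisc f -> holomorphic_on bidisc (f \o phi).
Hypothesis estimate : forall e : R, 0 < e -> exists2 t, t < 1 &
  forall f (m : R), holomorphic_on bidisc f -> (forall z, polydisc t z -> cabs (f z) <= m) ->
  (sqnorm (f \o phi) <= e%:E * sqnorm f + (16 * m ^+ 2)%:E)%E.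

Lemma composition_bergman f : bergman f -> bergman (f \o phi).
Proof.
move=> [fh ff]; split; first exact: comp_holo.
have [t t1 ht] := estimate ltr01.
have [m m0 hm] := polydisc_bounded fh t1.
apply: (le_lt_trans (ht f m fh hm)).
by apply: lte_add_pinfty; [rewrite mul1e|rewrite ltry].
Qed.

Lemma increasing_selection (P : nat -> set nat) :
  (forall k N, exists2 n, (N <= n)%N & P k n) ->
  exists s : nat -> nat, {homo s : m n / (m < n)%N} /\ forall k, P k (s k).
Proof.
move=> hP.
have /choice[F hF] (x : nat * nat) : exists n, (x.2 <= n)%N /\ P x.1 n.
  by have [n n1 n2] := hP x.1 x.2; exists n.
pose s := fix s k := match k with 0%N => F (0%N, 0%N) | k'.+1 => F (k'.+1, (s k').+1) end.
exists s; split; last by case=> [|k]; [exact: (hF (_, _)).2|exact: (hF (_, _)).2].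
apply: homo_ltn => [m n p|k]; first exact: ltn_trans.
exact: (hF (k.+1, (s k).+1)).1.
Qed.

(** A bounded sequence is locally bounded by point evaluation, hence converges
    locally uniformly along an ultrafilter; the estimate turns this into norm
    convergence of the images along the ultrafilter, and each of its sets is infinite,
    so that an increasing subsequence can be selected. *)
Theorem composition_compact : compact_on_bergman (composition_operator phi).
Proof.
split; [exact: composition_bergman|by []|].
move=> u ub [M uM].
have [U [UU sU]] := ultraFilterLemma (eventually_filter : ProperFilter (@eventually)).
have M0 : 0 <= M by apply: le_trans (uM 0%N); exact: sqrtr_ge0.
have c0 := tentc_gt0 R.
have u_bounded t : t < 1 -> exists B, forall n z, polydisc t z -> cabs (u n z) <= B.
  move=> t1; pose k := c / 4 * ((1 - t) * (1 - t)).
  have k0 : 0 < k.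
    apply: mulr_gt0; first by rewrite divr_gt0.
    by apply: mulr_gt0; rewrite subr_gt0.
  exists (M / k) => n z [z1 z2]; rewrite ler_pdivlMr//.
  apply: le_trans (uM n); rewrite mulrC.
  have zin : bidisc z by apply/bidiscE; split; apply: le_lt_trans t1.
  apply: le_trans (point_evaluation_norm (ub n) zin).
  apply: ler_wpM2r; first exact: cabs_ge0.
  apply: ler_wpM2l; first by rewrite divr_ge0// ltW.
  by apply: ler_pM; lra.
have u_holo n : holomorphic_on bidisc (u n) by have [] := ub n.
have [g [gh ug]] := montel UU u_holo u_bounded.
have gB : bergman g.
  split=> //; apply: le_lt_trans (limit_sqnorm g _ gh ub uM ug) _.
  by rewrite ltry.
pose S := (2 * M ^+ 2 + 2 * bergman_norm g ^+ 2).
have S0 : 0 <= S by rewrite addr_ge0// mulr_ge0// sqr_ge0.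
have small e : 0 < e -> U [set n | bergman_norm (fun z => u n (phi z) - g (phi z)) <= e].
  move=> e0; pose e' := e ^+ 2 / (2 * (S + 1)).
  have e2 : 0 < e ^+ 2 by rewrite exprn_gt0.
  have e'0 : 0 < e' by rewrite divr_gt0// mulr_gt0//; lra.
  have [t t1 ht] := estimate e'0.
  have m0 : 0 < e / 6 by rewrite divr_gt0.
  apply: filterS (ug t (e / 6) t1 m0) => n /= hn.
  have dh := holomorphic_sub (u_holo n) gh.
  have := ht _ _ dh hn.
  have dS : (sqnorm (fun z => u n z - g z)%R <= S%:E)%E.
    apply: le_trans (sqnorm_sub (u_holo n) gh) _.
    rewrite !bergman_sqnorm// -!EFinM -EFinD lee_fin lerD2r ler_wpM2l//.
    have s0 : 0 <= bergman_norm (u n) := sqrtr_ge0 _.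
    by rewrite ler_pXn2r// nnegrE.
  move=> h; have {}h : (sqnorm ((fun z => u n z - g z)%R \o phi) <= (e ^+ 2)%:E)%E.
    apply: (le_trans h); apply: (@le_trans _ _ (e' * S + 16 * (e / 6) ^+ 2)%:E).
      rewrite EFinD; apply: leeD2r.
      have -> : (e' * S)%:E = (e'%:E * S%:E)%E by [].
      apply: lee_wpmul2l => //.
      by rewrite lee_fin ltW.
    rewrite lee_fin.
    have -> : 16 * (e / 6) ^+ 2 = 16 / 36 * e ^+ 2 by field.
    have : e' * S <= e ^+ 2 / 2.
      rewrite /e' mulrAC ler_pdivrMr; last by rewrite mulr_gt0//; lra.
      have -> : e ^+ 2 / 2 * (2 * (S + 1)) = e ^+ 2 * (S + 1) by field.
      by apply: ler_wpM2l; [exact: ltW|lra].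
    lra.
  apply: le_trans (bergman_norm_le (ltW e2) h) _.
  by rewrite sqrtr_sqr ger0_norm// ltW.
have [k N|s [s_mono hs]] := @increasing_selection (fun k =>
    [set n | bergman_norm (fun z => u n (phi z) - g (phi z)) <= k.+1%:R^-1]).
  have k0 : 0 < k.+1%:R^-1 :> R by rewrite invr_gt0 ltr0n.
  have UN : U [set n | (N <= n)%N] by apply: sU; exists N.
  by have [n [n1 n2]] := filter_ex (filterI (small _ k0) UN); exists n.
exists s, (g \o phi); split=> //; first exact: composition_bergman.
apply/cvgrPdist_le => e e0.
have k0 : 0 <= e^-1 by rewrite invr_ge0 ltW.
exists (Num.bound e^-1) => // k /= hk.
rewrite sub0r normrN ger0_norm; last exact: sqrtr_ge0.
apply: le_trans (hs k) _.
rewrite -[leRHS]invrK lef_pV2 ?posrE ?ltr0n ?invr_gt0//.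
apply: le_trans (ltW (archi_boundP k0)) _.
by rewrite ler_nat (leq_trans hk).
Qed.
End Compactness.

(** * Boundary values of the symbol *)

Section Boundary.
Variable R : realType.
Local Notation C := (CC R).
Local Notation C2 := (CC2 R).

Let shrink (h : R) (z : C2) : C2 := scale (1 - h) z.

Lemma shrink_near (h : R) z : 0 <= h <= 1 ->
  cabs ((shrink h z).1 - z.1) = h * cabs z.1 /\ cabs ((shrink h z).2 - z.2) = h * cabs z.2.
Proof.
move=> /andP[h0 h1]; have e (x : C) : (1 - h)%:C * x - x = - (h%:C * x).
  by rewrite rmorphB rmorph1; ring.
by rewrite /shrink /scale !e !cabsN !cabsM !cabs_real ger0_norm.
Qed.

Lemma shrink_bidisc (h : R) z : 0 < h <= 1 -> polydisc 1 z -> bidisc (shrink h z).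
Proof.
move=> /andP[h0 h1] [z1 z2]; have h2 : 0 <= 1 - h by rewrite subr_ge0.
have [e1 e2] := scale_cabs z h2; apply/bidiscE; rewrite e1 e2.
by have := cabs_ge0 z.1; have := cabs_ge0 z.2; split; nra.
Qed.

Lemma closure_bidisc : closure bidisc = @polydisc R 1.
Proof.
apply/seteqP; split.
  have cl := @closed_annulus_disc R 0 1 1; rewrite -polydiscE in cl.
  rewrite ((closure_id _).1 cl); apply: closureS => z /bidiscE[z1 z2].
  by split; exact: ltW.
move=> z z1 B /nbhs_C2[d d0 hd].
pose h := Num.min d 1; have h01 : 0 < h <= 1 by rewrite lt_min d0 ltr01 ge_min lexx orbT.
have hd' : h <= d by rewrite ge_min lexx.
have /andP[h0 h1] := h01.
exists (shrink h z); split; first exact: shrink_bidisc.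
have [|e1 e2] := @shrink_near h z; first by rewrite ltW.
have [q1 q2] := z1; have g1 := cabs_ge0 z.1; have g2 := cabs_ge0 z.2.
by apply: hd; rewrite ?e1 ?e2; nra.
Qed.

Lemma boundary_bidisc : boundary bidisc = @polydisc R 1 `\` bidisc.
Proof.
rewrite /boundary closure_bidisc; congr (_ `\` _).
apply/interior_id; rewrite openE => z /bidisc_open[d d0 hd].
by apply/nbhs_C2; exists d.
Qed.

Lemma lipschitz_norm1 (f : C2 -> C) : lipschitz_euclidean (closure bidisc) f ->
  exists2 L, 0 < L & forall z w, polydisc 1 z -> polydisc 1 w ->
    cabs (f z - f w) <= L * norm1 (z - w).
Proof.
rewrite closure_bidisc => -[L hL]; exists (`|L| + 1) => [|z w z1 w1].
  by have := normr_ge0 L; lra.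
apply: (le_trans (hL z w z1 w1)).
have n0 := norm1_ge0 (z - w).
have en : Defs.edist z w <= norm1 (z - w).
  rewrite -[leRHS](ger0_norm n0) -sqrtr_sqr ler_sqrt ?sqr_ge0// /norm1.
  rewrite -[(z - w).1]/(z.1 - w.1) -[(z - w).2]/(z.2 - w.2).
  by have := cabs_ge0 (z.1 - w.1); have := cabs_ge0 (z.2 - w.2); nra.
have e0 : 0 <= Defs.edist z w := sqrtr_ge0 _.
apply: (@le_trans _ _ (`|L| * Defs.edist z w)); first by rewrite ler_wpM2r// ler_norm.
by apply: ler_pM => //; rewrite lerDl.
Qed.

Variables (phi phib : C2 -> C2).
Hypothesis phi_holo : holomorphic_on bidisc phi.
Hypothesis phi_self : forall z, bidisc z -> bidisc (phi z).
Hypothesis phib_ext : forall z, bidisc z -> phib z = phi z.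
Hypothesis phib_lip : exists2 L, 0 < L & forall b z w, polydisc 1 z -> polydisc 1 w ->
    cabs (component b (phib z) - component b (phib w)) <= L * norm1 (z - w).

Lemma component_holo b : holomorphic_on bidisc (fun z => component b (phi z)).
Proof.
move=> z zin; case: b.
  apply: (@differentiable_comp _ C2 C2 C phi fst z); first exact: phi_holo.
  by apply: linear_differentiable => ?; exact: cvg_fst.
apply: (@differentiable_comp _ C2 C2 C phi snd z); first exact: phi_holo.
by apply: linear_differentiable => ?; exact: cvg_snd.
Qed.

Lemma composition_holo (f : C2 -> C) : holomorphic_on bidisc f -> holomorphic_on bidisc (f \o phi).
Proof.
move=> fh z zin; apply: (@differentiable_comp _ C2 C2 C phi f z); first exact: phi_holo.
by apply: fh; exact: phi_self.
Qed.

Lemma extension_continuous b (z : C2) (e : R) : polydisc 1 z -> 0 < e ->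
  exists2 d : R, 0 < d & forall w : C2, polydisc 1 w ->
    cabs (w.1 - z.1) <= d -> cabs (w.2 - z.2) <= d ->
    cabs (component b (phib w) - component b (phib z)) <= e.
Proof.
move=> z1 e0; have [L L0 hL] := phib_lip.
exists (e / (2 * L)); first by rewrite divr_gt0// mulr_gt0.
move=> w w1 h1 h2; apply: (le_trans (hL b w z w1 z1)).
have h : norm1 (w - z) <= e / (2 * L) + e / (2 * L) by exact: lerD.
apply: le_trans (ler_wpM2l (ltW L0) h) _.
by rewrite le_eqVlt; apply/orP; left; apply/eqP; field; rewrite gt_eqF.
Qed.

(** The Lipschitz bound along a radius: phi approaches the boundary at most linearly. *)
Lemma radial_approach : exists2 L, 0 < L & forall b (z : C2) (h : R), polydisc 1 z -> 0 < h <= 1 ->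
  cabs (component b (phib z)) - L * h <= cabs (component b (phi (shrink h z))).
Proof.
have [L L0 hL] := phib_lip; exists (2 * L); first by rewrite mulr_gt0.
move=> b z h z1 h01; have /andP[h0 h1] := h01.
have sin := shrink_bidisc h01 z1; have s1 : polydisc 1 (shrink h z).
  by have [] := (bidiscE _).1 sin => ? ?; split; exact: ltW.
have := hL b z (shrink h z) z1 s1; rewrite (phib_ext sin).
have -> : norm1 (z - shrink h z) = h * norm1 z.
  have [|e1 e2] := @shrink_near h z; first by rewrite ltW.
  by rewrite /norm1 -[(z - _).1]/(z.1 - _) -[(z - _).2]/(z.2 - _) !(cabs_distrC z.1) (cabs_distrC z.2) e1 e2 mulrDr.
have n2 : h * norm1 z <= 2 * h.
  by have [q1 q2] := z1; rewrite /norm1; have := cabs_ge0 z.1; have := cabs_ge0 z.2; nra.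
have := cabs_triangle (component b (phib z)) (component b (phi (shrink h z))).
by nra.
Qed.

Lemma extension_le1 b z : polydisc 1 z -> cabs (component b (phib z)) <= 1.
Proof.
move=> z1; have [L L0 hL] := radial_approach.
apply/ler_addgt0Pr => e e0; pose h := Num.min 1 (e / L).
have h01 : 0 < h <= 1 by rewrite lt_min ltr01 divr_gt0//= ge_min lexx.
have hL' : L * h <= e.
  have : h <= e / L by rewrite ge_min lexx orbT.
  by rewrite ler_pdivlMr// mulrC.
have := hL b z h z1 h01.
have : cabs (component b (phi (shrink h z))) < 1.
  by have /phi_self/bidiscE[] := shrink_bidisc h01 z1; case: b.
lra.
Qed.

(** Compactness fails as soon as, along one radius, the product of the distances of
    the image tends to zero but is at most a multiple of that of the point. *)
Lemma not_compact_radial (z : C2) (k K : R) : polydisc 1 z -> 0 < k ->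
  compact_on_bergman (composition_operator phi) ->
  (forall h, 0 < h <= 1 ->
     let e := (1 - cabs (phi (shrink h z)).1) * (1 - cabs (phi (shrink h z)).2) in
     k * e <= (1 - cabs (shrink h z).1) * (1 - cabs (shrink h z).2) /\ e <= K * h) -> False.
Proof.
move=> z1 k0 comp H; pose hn n : R := n.+1%:R^-1.
have h01 n : 0 < hn n <= 1 by rewrite invr_gt0 ltr0n invf_le1 ?ltr0n// ler1n.
apply: (@comparable_distances_not_compact R phi (fun n => shrink (hn n) z) k phi_self comp) => //.
- by move=> n; exact: shrink_bidisc.
- by move=> n; have [] := H _ (h01 n).
- move=> r r0; pose K' := `|K| + 1.
  have K'0 : 0 < K' by rewrite /K'; have := normr_ge0 K; lra.
  have k1 : 0 <= K' / r by rewrite divr_ge0// ltW.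
  exists (Num.bound (K' / r)) => n nN; have [_ he] := H _ (h01 n).
  apply: (le_trans he); apply: (@le_trans _ _ (K' * hn n)).
    have /andP[hn0 _] := h01 n; apply: ler_wpM2r; first exact: ltW.
    by rewrite /K'; have := ler_norm K; lra.
  rewrite ler_pdivrMr ?ltr0n// mulrC -ler_pdivrMr//.
  by apply: le_trans (ltW (archi_boundP k1)) _; rewrite ler_nat (leq_trans nN).
Qed.

(** If phib z is on the torus, both distances of the image are O(h), against at
    least h each for the shrunk point. If z is off the torus, one of its distances
    stays bounded below, so one component on the circle is already enough. *)
Lemma necessity : compact_on_bergman (composition_operator phi) ->
  (forall z, polydisc 1 z -> ~ (cabs (phib z).1 = 1 /\ cabs (phib z).2 = 1)) /\
  (forall z, polydisc 1 z -> ~ (cabs z.1 = 1 /\ cabs z.2 = 1) ->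
    forall b, cabs (component b (phib z)) < 1).
Proof.
move=> comp; have [L L0 hL] := radial_approach.
have prod b (w : C2) : (1 - cabs w.1) * (1 - cabs w.2) =
    (1 - cabs (component b w)) * (1 - cabs (component (~~ b) w)).
  by case: b => //=; rewrite mulrC.
have img b z h : polydisc 1 z -> 0 < h <= 1 -> 0 < 1 - cabs (component b (phi (shrink h z))).
  by move=> z1 h01; have /phi_self/bidiscE[? ?] := shrink_bidisc h01 z1; case: b; rewrite subr_gt0.
have dist (x : C) (h : R) : 0 <= h <= 1 -> cabs x <= 1 -> h <= 1 - (1 - h) * cabs x /\
    1 - cabs x <= 1 - (1 - h) * cabs x.
  by move=> /andP[h0 h1] x1; have := cabs_ge0 x; split; nra.
have small b z h : polydisc 1 z -> 0 < h <= 1 -> cabs (component b (phib z)) = 1 ->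
    1 - cabs (component b (phi (shrink h z))) <= L * h.
  by move=> z1 h01 e; have := hL b z h z1 h01; rewrite e; lra.
have shr z h : 0 < h <= 1 -> cabs (shrink h z).1 = (1 - h) * cabs z.1 /\
    cabs (shrink h z).2 = (1 - h) * cabs z.2.
  by move=> /andP[h0 h1]; apply: scale_cabs; rewrite subr_ge0.
split.
  move=> z z1 [e1 e2]; pose k := (L ^+ 2)^-1.
  have k0 : 0 < k by rewrite invr_gt0 exprn_gt0.
  apply: (@not_compact_radial z k L z1 k0 comp) => h h01 e.
  have [q1 q2] := z1; have /andP[h0 h1] := h01.
  have [s1 s2] := shr z h h01; rewrite s1 s2.
  have h01' : 0 <= h <= 1 by rewrite ltW.
  have [p1 _] := dist z.1 h h01' q1; have [p2 _] := dist z.2 h h01' q2.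
  have a1 := small true z h z1 h01 e1; have a2 := small false z h z1 h01 e2.
  have b1 := img true z h z1 h01; have b2 := img false z h z1 h01.
  rewrite /component in a1 a2 b1 b2; split.
    apply: (@le_trans _ _ (h * h)); last by apply: ler_pM => //; exact: ltW.
    rewrite /k mulrC ler_pdivrMr ?exprn_gt0//.
    have -> : h * h * L ^+ 2 = (L * h) * (L * h) by ring.
    by apply: ler_pM => //; exact: ltW.
  rewrite /e -[leRHS]mulr1; apply: ler_pM => //; try exact: ltW.
  by have := cabs_ge0 (phi (shrink h z)).2; lra.
move=> z z1 nt b; rewrite lt_neqAle extension_le1// andbT; apply/eqP => e1.
have [q1 q2] := z1.
have [i hi] : exists i, cabs (component i z) < 1.
  have [t1|t1] := eqVneq (cabs z.1) 1; last by exists true; rewrite lt_neqAle t1.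
  have [t2|t2] := eqVneq (cabs z.2) 1; last by exists false; rewrite lt_neqAle t2.
  by case: nt.
pose k := (1 - cabs (component i z)) / L.
have k0 : 0 < k by rewrite divr_gt0// subr_gt0.
apply: (@not_compact_radial z k L z1 k0 comp) => h h01 e.
have /andP[h0 h1] := h01.
have h01' : 0 <= h <= 1 by rewrite ltW.
have a1 := small b z h z1 h01 e1.
have b1 := img b z h z1 h01; have b2 := img (~~ b) z h z1 h01.
have eL : e <= L * h.
  rewrite /e (prod b) -[leRHS]mulr1; apply: ler_pM => //; try exact: ltW.
  by have := cabs_ge0 (component (~~ b) (phi (shrink h z))); lra.
split=> //.
have iq j : cabs (component j z) <= 1 by case: j.
have si j : cabs (component j (shrink h z)) = (1 - h) * cabs (component j z).
  by have [s1 s2] := shr z h h01; case: j.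
rewrite (prod i) !si.
have [_ p1] := dist _ h h01' (iq i); have [p2 _] := dist _ h h01' (iq (~~ i)).
apply: (@le_trans _ _ ((1 - cabs (component i z)) * h)).
  apply: (le_trans (ler_wpM2l (ltW k0) eL)).
  by rewrite le_eqVlt; apply/orP; left; apply/eqP; rewrite /k; field; rewrite gt_eqF.
by apply: ler_pM => //; [rewrite subr_ge0 ltW|exact: ltW].
Qed.

Lemma sufficiency :
  (forall z, polydisc 1 z -> ~ (cabs (phib z).1 = 1 /\ cabs (phib z).2 = 1)) ->
  (forall z, polydisc 1 z -> ~ (cabs z.1 = 1 /\ cabs z.2 = 1) ->
    forall b, cabs (component b (phib z)) < 1) ->
  compact_on_bergman (composition_operator phi).
Proof.
move=> h1 h2; apply: composition_compact; first exact: composition_holo.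
exact: (composition_estimate phi_self component_holo composition_holo phib_ext
  extension_continuous h1 h2 extension_le1).
Qed.
End Boundary.

Theorem theorem1 (R : realType) (phi phib : CC2 R -> CC2 R)
    (phi_holo : holomorphic_on bidisc phi)
    (phi_self : forall z, bidisc z -> bidisc (phi z))
    (phib_ext : forall z, bidisc z -> phib z = phi z)
    (phib1_lip : lipschitz_euclidean (closure bidisc) (fun z => (phib z).1))
    (phib2_lip : lipschitz_euclidean (closure bidisc) (fun z => (phib z).2)) :
  compact_on_bergman (composition_operator phi) <->
  (phib @` closure bidisc) `&` torus = set0 /\
  (phib @` (closure bidisc `\` torus)) `&` boundary bidisc = set0.
Proof.
have lip : exists2 L, 0 < L & forall b z w, polydisc 1 z -> polydisc 1 w ->
    cabs (component b (phib z) - component b (phib w)) <= L * norm1 (z - w).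
  have [L1 L10 h1] := lipschitz_norm1 phib1_lip.
  have [L2 L20 h2] := lipschitz_norm1 phib2_lip.
  exists (L1 + L2); first exact: addr_gt0.
  move=> b z w z1 w1; have n0 := norm1_ge0 (z - w).
  by case: b; [apply: le_trans (h1 z w z1 w1) _|apply: le_trans (h2 z w z1 w1) _]; nra.
have le1 := extension_le1 phi_self phib_ext lip.
split=> [/(necessity phi_self phib_ext lip)[h1 h2]|[]].
  split; apply/seteqP; split=> // w [[z zin <-]].
    by move=> tor; rewrite closure_bidisc in zin; exact: (h1 z).
  rewrite boundary_bidisc => -[_]; apply; move: zin; rewrite closure_bidisc => -[z1 nt].
  by apply/bidiscE; split; [exact: (h2 z z1 nt true)|exact: (h2 z z1 nt false)].
rewrite boundary_bidisc closure_bidisc => s1 s2.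
apply: (sufficiency phi_holo phi_self phib_ext lip).
  by move=> z z1 tor; have : set0 (phib z) by rewrite -s1; split=> //; exists z.
move=> z z1 nt b; rewrite lt_neqAle le1// andbT; apply/eqP => e.
have : set0 (phib z); last by [].
rewrite -s2; split; first by exists z.
split; first by split; [exact: (le1 true)|exact: (le1 false)].
by move=> /bidiscE[p1 p2]; case: b e => /= e; [move: p1|move: p2]; rewrite e ltxx.
Qed.
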